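(* Let $q\ge 2$ be an integer, let $r$ be a positive integer, and let $f$ be a real-valued function on the nonnegative integers that is $q$-quasiadditive with parameter $r$, i.e. $f(q^{k+r}a+b)=f(a)+f(b)$ for all nonnegative integers $a,b,k$ with $0\le b<q^k$. Assume $f$ has at most logarithmic growth, i.e. $f(n)=O(\log n)$, and that $f$ is not the constant function $f\equiv 0$. Let $\mathcal{B}$ be the set of all positive integers not divisible by $q$ whose $q$-ary representation does not contain the block $0^r$, let $\ell(n)$ be the length of the $q$-ary representation of $n$, and let $\hat B(x,t)=\sum_{n\in\mathcal{B}} x^{\ell(n)} e^{f(n)t}$, with partial derivatives $\hat B_t,\hat B_{tt},\hat B_{tx}$ evaluated at $(1/q,0)$. Define $$\hat\mu=\frac{\hat B_t(1/q,0)}{q^{2r}},$$ $$\hat\sigma^2 = -\hat B_t(1/q,0)^2 q^{-4r+1}(q-1)^{-1} + 2\hat B_t(1/q,0)^2 q^{-3r+1}(q-1)^{-1} - \hat B_t(1/q,0)^2 q^{-4r}(q-1)^{-1} - 4r\hat B_t(1/q,0)^2 q^{-4r} + \hat B_{tt}(1/q,0)q^{-2r} - 2\hat B_t(1/q,0)\hat B_{tx}(1/q,0)q^{-4r-1}.$$ Let $M_K$ be an integer chosen uniformly at random from $\{0,1,\dots,K-1\}$. Then $$\frac{f(M_K)-\hat\mu\log_q K}{\hat\sigma\sqrt{\log_q K}}$$ converges weakly to a standard Gaussian distribution as $K\to\infty$.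
   Context: An arithmetic function is a function defined on the nonnegative integers. The $q$-ary representation of a positive integer has no leading zeros. *)

(* Defs.v *)
From Stdlib Require Import Reals List Arith ClassicalEpsilon.
From Coquelicot Require Import Coquelicot.
Import ListNotations.
Open Scope R_scope.

Definition quasiadditive (q r : nat) (f : nat -> R) : Prop :=
  forall a b k : nat, (b < q ^ k)%nat ->
    f (q ^ (k + r) * a + b)%nat = f a + f b.

Definition log_growth (f : nat -> R) : Prop :=
  exists (C : R) (N : nat), forall n : nat, (N <= n)%nat ->
    Rabs (f n) <= C * ln (INR n).

(* q-ary digits of n, least significant first (no leading zeros; [] for 0).
   Fuel n suffices since n / q < n for n > 0, q >= 2. *)
Fixpoint digits_aux (fuel q n : nat) : list nat :=
  match fuel with
  | O => []
  | S fuel' => if Nat.eqb n 0 then [] else (n mod q) :: digits_aux fuel' q (n / q)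
  end.
Definition digits (q n : nat) : list nat := digits_aux n q n.

Definition qlen (q n : nat) : nat := length (digits q n).

Definition inB (q r n : nat) : Prop :=
  (0 < n)%nat /\ n mod q <> 0%nat /\
  ~ (exists l1 l2 : list nat, digits q n = l1 ++ repeat 0%nat r ++ l2).

Definition Bhat (q r : nat) (f : nat -> R) (x t : R) : R :=
  Series (fun n : nat =>
    if excluded_middle_informative (inB q r n)
    then x ^ (qlen q n) * exp (f n * t) else 0).

Definition Bt (q r : nat) (f : nat -> R) : R :=
  Derive (fun t => Bhat q r f (/ INR q) t) 0.
Definition Btt (q r : nat) (f : nat -> R) : R :=
  Derive (fun t => Derive (fun s => Bhat q r f (/ INR q) s) t) 0.
Definition Btx (q r : nat) (f : nat -> R) : R :=
  Derive (fun x => Derive (fun t => Bhat q r f x t) 0) (/ INR q).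

Definition qpow (q : nat) (e : Z) : R := powerRZ (INR q) e.

Definition mu_hat (q r : nat) (f : nat -> R) : R :=
  Bt q r f / (INR q) ^ (2 * r).

Definition sigma2_hat (q r : nat) (f : nat -> R) : R :=
  let b := Bt q r f in
  let R' := Z.of_nat r in
  - b ^ 2 * qpow q (-4 * R' + 1) / (INR q - 1)
  + 2 * b ^ 2 * qpow q (-3 * R' + 1) / (INR q - 1)
  - b ^ 2 * qpow q (-4 * R') / (INR q - 1)
  - 4 * INR r * b ^ 2 * qpow q (-4 * R')
  + Btt q r f * qpow q (-2 * R')
  - 2 * b * Btx q r f * qpow q (-4 * R' - 1).

Definition sigma_hat (q r : nat) (f : nat -> R) : R := sqrt (sigma2_hat q r f).

Definition logq (q : nat) (x : R) : R := ln x / ln (INR q).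

Definition Znorm (q r : nat) (f : nat -> R) (K m : nat) : R :=
  (f m - mu_hat q r f * logq q (INR K)) /
  (sigma_hat q r f * sqrt (logq q (INR K))).

Definition unif_expect (K : nat) (h : nat -> R) : R :=
  / INR K * fold_right Rplus 0 (map h (seq 0 K)).

Definition gauss_density (x : R) : R := exp (- x ^ 2 / 2) / sqrt (2 * PI).

Definition converges_weakly_to_std_gaussian (X : nat -> nat -> R) : Prop :=
  forall g : R -> R,
    (forall x, continuous g x) ->
    (exists M, forall x, Rabs (g x) <= M) ->
    exists v : R,
      is_RInt_gen (fun x => g x * gauss_density x)
        (Rbar_locally m_infty) (Rbar_locally p_infty) v /\
      is_lim_seq (fun K => unif_expect K (fun m => g (X K m))) v.

(* Main.v *)
(** Appending uniform random digits to n turns f into an additive functional of the digit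
    process: by quasiadditivity, f grows by f(B) each time a block B is completed by r zeros,
    and every quantity involved depends only on the digits below the lowest run of r zeros.
    Such "local" functions of polynomial growth in the length forget their starting point
    exponentially fast, so the Poisson equation W - A W = psi - mean psi (A = average over the
    next digit) has a local solution. One corrector turns f into a martingale up to a local
    term; a second one compensates the fluctuations of its conditional variance.

    Evaluating the heat kernel along this martingale, with the remaining variance as time
    and with the second corrector added to second order, gives a telescoping proof that
    E phi_s(Z - a) is close to phi_(s+1)(a), uniformly in a. Integrating against g(a) da and
    letting s -> 0 yields the weak convergence. An arbitrary K is split as q^i c + rem with c
    large but bounded.

    The formulas for the mean and the variance come from the means of beta and beta^2 and from
    the value of the first corrector W at 0, since beta W = W(0) beta: beta is supported on
    numbers ending in r zeros. If the variance vanished, all jumps of the martingale would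
    vanish, and then f = 0. *)
Require Import Defs.
From Stdlib Require Import Reals Lra Lia List Arith Classical ClassicalEpsilon.
From Coquelicot Require Import Coquelicot.
Import ListNotations.
Open Scope R_scope.

(* Coquelicot states equalities in carriers such as [R_NormedModule], which [ring] does not see as [R]. *)
Ltac real_eq := match goal with |- ?x = ?y => change (@eq R x y) end.

(** A new low-order digit alters the whole unfinished block, so [f] itself has no usable increments
    along the digit chain; only the digits above the lowest run of [r] zeros contribute additively,
    and the rest is a local error at both ends of the path. Two correctors are needed because the
    rescaled path, with step size [eta], has about [eta ^ -2] steps. Errors of order [eta] or
    [eta ^ 2] per step would not vanish in the sum. The first corrector removes the drift, the
    second the fluctuation of the variance, and the remaining [eta ^ 3] per step adds up to order
    [eta]. The heat kernel serves as test function because it solves the equation that the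
    telescoping has to match, its derivatives are bounded as long as its variance stays above [s],
    and all errors are uniform in the shift [a]. Everything stays real and elementary. The leading
    part [c] of [K] must be large, since the incomplete last interval has a share of about 1/c, and
    bounded, since the error carries a power of the length of the starting point. *)

(** * Finite sums of reals over initial segments *)

Fixpoint bsum (h : nat -> R) (n : nat) : R :=
  match n with O => 0 | S m => bsum h m + h m end.

Lemma bsum_ext (g h : nat -> R) (n : nat) :
  (forall i, (i < n)%nat -> g i = h i) -> bsum g n = bsum h n.
Proof.
  induction n as [|n IH]; intros H; simpl; auto.
  rewrite IH by (intros; apply H; lia). rewrite H by lia. reflexivity.
Qed.

Lemma bsum_plus (g h : nat -> R) (n : nat) :
  bsum (fun i => g i + h i) n = bsum g n + bsum h n.
Proof. induction n as [|n IH]; simpl; [lra|rewrite IH; lra]. Qed.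

Lemma bsum_minus (g h : nat -> R) (n : nat) :
  bsum (fun i => g i - h i) n = bsum g n - bsum h n.
Proof. induction n as [|n IH]; simpl; [lra|rewrite IH; lra]. Qed.

Lemma bsum_scal (c : R) (h : nat -> R) (n : nat) :
  bsum (fun i => c * h i) n = c * bsum h n.
Proof. induction n as [|n IH]; simpl; [lra|rewrite IH; lra]. Qed.

Lemma bsum_const (c : R) (n : nat) : bsum (fun _ => c) n = INR n * c.
Proof. induction n as [|n IH]; [simpl; lra|rewrite S_INR; simpl; rewrite IH; lra]. Qed.

Lemma bsum_le (g h : nat -> R) (n : nat) :
  (forall i, (i < n)%nat -> g i <= h i) -> bsum g n <= bsum h n.
Proof.
  induction n as [|n IH]; intros H; simpl; [lra|].
  apply Rplus_le_compat; [apply IH; intros; apply H; lia|apply H; lia].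
Qed.

Lemma bsum_nonneg (h : nat -> R) (n : nat) :
  (forall i, (i < n)%nat -> 0 <= h i) -> 0 <= bsum h n.
Proof.
  intros H. replace 0 with (bsum (fun _ => 0) n) by (rewrite bsum_const; lra).
  now apply bsum_le.
Qed.

Lemma bsum_zero (h : nat -> R) (n : nat) :
  (forall i, (i < n)%nat -> h i = 0) -> bsum h n = 0.
Proof.
  intros H. rewrite (bsum_ext _ (fun _ => 0)) by exact H. rewrite bsum_const; lra.
Qed.

Lemma bsum_Rabs (h : nat -> R) (n : nat) :
  Rabs (bsum h n) <= bsum (fun i => Rabs (h i)) n.
Proof.
  induction n as [|n IH]; simpl; [rewrite Rabs_R0; lra|].
  eapply Rle_trans; [apply Rabs_triang|lra].
Qed.

Lemma bsum_add (h : nat -> R) (m n : nat) :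
  bsum h (m + n) = bsum h m + bsum (fun i => h (m + i)%nat) n.
Proof.
  induction n as [|n IH]; simpl; [rewrite Nat.add_0_r; lra|].
  rewrite Nat.add_succ_r; simpl. rewrite IH; lra.
Qed.

Lemma bsum_mul (h : nat -> R) (a b : nat) :
  bsum h (a * b) = bsum (fun i => bsum (fun j => h (b * i + j)%nat) b) a.
Proof.
  induction a as [|a IH]; simpl; auto.
  rewrite Nat.add_comm, bsum_add, IH. f_equal.
  apply bsum_ext; intros j _. f_equal; lia.
Qed.

Lemma bsum_swap (h : nat -> nat -> R) (m n : nat) :
  bsum (fun i => bsum (h i) n) m = bsum (fun j => bsum (fun i => h i j) m) n.
Proof.
  induction m as [|m IH]; simpl.
  - rewrite bsum_zero; auto.
  - rewrite IH, <- bsum_plus. reflexivity.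
Qed.

Lemma bsum_delta (c : R) (k n : nat) :
  bsum (fun i => if Nat.eqb i k then c else 0) n = if Nat.ltb k n then c else 0.
Proof.
  induction n as [|n IH]; [reflexivity|]. simpl bsum. rewrite IH.
  destruct (Nat.eqb_spec n k), (Nat.ltb_spec k n), (Nat.ltb_spec k (S n)); try lia; lra.
Qed.

Lemma bsum_ge_term (h : nat -> R) (n k : nat) :
  (k < n)%nat -> (forall i, (i < n)%nat -> 0 <= h i) -> h k <= bsum h n.
Proof.
  intros Hk H.
  apply Rle_trans with (bsum (fun i => if Nat.eqb i k then h k else 0) n).
  - rewrite bsum_delta. destruct (Nat.ltb_spec k n); [lra|lia].
  - apply bsum_le. intros i Hi. destruct (Nat.eqb_spec i k); [subst; lra|auto].
Qed.

Lemma fold_right_bsum (h : nat -> R) (n : nat) :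
  fold_right Rplus 0 (map h (seq 0 n)) = bsum h n.
Proof.
  induction n as [|n IH]; [reflexivity|].
  rewrite seq_S, map_app, fold_right_app. simpl.
  rewrite <- IH. generalize (map h (seq 0 n)) as l.
  induction l as [|x l IHl]; simpl; [lra|rewrite IHl; lra].
Qed.

Lemma sum_n_bsum (h : nat -> R) (n : nat) : sum_n h n = bsum h (S n).
Proof.
  induction n as [|n IH].
  - rewrite sum_O; simpl; lra.
  - rewrite sum_Sn, IH. reflexivity.
Qed.

Lemma is_series_bsum (h : nat -> R) (l : R) :
  is_series h l <-> is_lim_seq (bsum h) l.
Proof.
  split; intros H.
  - apply is_lim_seq_incr_1. apply is_lim_seq_ext with (sum_n h); [intros; apply sum_n_bsum|exact H].
  - apply is_lim_seq_incr_1 in H.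
    change (is_lim_seq (sum_n h) l).
    apply is_lim_seq_ext with (fun n => bsum h (S n)); [intros; now rewrite sum_n_bsum|exact H].
Qed.

(** * Averages over appended digits *)

Definition avg (q : nat) (h : nat -> R) (n : nat) : R :=
  bsum (fun d => h (q * n + d)%nat) q / INR q.

Fixpoint avgn (q j : nat) (h : nat -> R) : nat -> R :=
  match j with O => h | S i => avg q (avgn q i h) end.

Section Averages.

Variable q : nat.
Hypothesis Hq : (2 <= q)%nat.

Lemma INR_q_pos : 0 < INR q.
Proof. apply lt_0_INR; lia. Qed.

Lemma INR_q_ge2 : 2 <= INR q.
Proof. apply (le_INR 2); lia. Qed.

Lemma pow_q_pos (k : nat) : (0 < q ^ k)%nat.
Proof. apply Nat.neq_0_lt_0, Nat.pow_nonzero; lia. Qed.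

Lemma INR_pow_pos (k : nat) : 0 < INR q ^ k.
Proof. apply pow_lt, INR_q_pos. Qed.

Lemma avg_ext_strong (g h : nat -> R) (n : nat) :
  (forall d, (d < q)%nat -> g (q * n + d)%nat = h (q * n + d)%nat) -> avg q g n = avg q h n.
Proof. intros H. unfold avg. f_equal. now apply bsum_ext. Qed.

Lemma avg_ext (g h : nat -> R) (n : nat) : (forall m, g m = h m) -> avg q g n = avg q h n.
Proof. intros H. apply avg_ext_strong; auto. Qed.

Lemma avg_plus (g h : nat -> R) (n : nat) :
  avg q (fun m => g m + h m) n = avg q g n + avg q h n.
Proof. unfold avg. rewrite bsum_plus. lra. Qed.

Lemma avg_minus (g h : nat -> R) (n : nat) :
  avg q (fun m => g m - h m) n = avg q g n - avg q h n.
Proof. unfold avg. rewrite bsum_minus. lra. Qed.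

Lemma avg_scal (c : R) (h : nat -> R) (n : nat) :
  avg q (fun m => c * h m) n = c * avg q h n.
Proof. unfold avg. rewrite bsum_scal. lra. Qed.

Lemma avg_const (c : R) (n : nat) : avg q (fun _ => c) n = c.
Proof. unfold avg. rewrite bsum_const. field. apply Rgt_not_eq, INR_q_pos. Qed.

Lemma avg_le_strong (g h : nat -> R) (n : nat) :
  (forall d, (d < q)%nat -> g (q * n + d)%nat <= h (q * n + d)%nat) -> avg q g n <= avg q h n.
Proof.
  intros H. unfold avg. apply Rmult_le_compat_r.
  - apply Rlt_le, Rinv_0_lt_compat, INR_q_pos.
  - now apply bsum_le.
Qed.

Lemma avg_le (g h : nat -> R) (n : nat) : (forall m, g m <= h m) -> avg q g n <= avg q h n.
Proof. intros H. apply avg_le_strong; auto. Qed.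

Lemma avg_Rabs (h : nat -> R) (n : nat) :
  Rabs (avg q h n) <= avg q (fun m => Rabs (h m)) n.
Proof.
  unfold avg, Rdiv. rewrite Rabs_mult, (Rabs_pos_eq (/ INR q)).
  - apply Rmult_le_compat_r; [|apply bsum_Rabs]. apply Rlt_le, Rinv_0_lt_compat, INR_q_pos.
  - apply Rlt_le, Rinv_0_lt_compat, INR_q_pos.
Qed.

Lemma avgn_ext (j : nat) (g h : nat -> R) (n : nat) :
  (forall m, g m = h m) -> avgn q j g n = avgn q j h n.
Proof.
  intros H. revert n; induction j as [|j IH]; intros n; simpl; auto. now apply avg_ext.
Qed.

Lemma avgn_plus (j : nat) (g h : nat -> R) (n : nat) :
  avgn q j (fun m => g m + h m) n = avgn q j g n + avgn q j h n.
Proof.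
  revert n; induction j as [|j IH]; intros n; simpl; auto.
  rewrite <- avg_plus. now apply avg_ext.
Qed.

Lemma avgn_minus (j : nat) (g h : nat -> R) (n : nat) :
  avgn q j (fun m => g m - h m) n = avgn q j g n - avgn q j h n.
Proof.
  revert n; induction j as [|j IH]; intros n; simpl; auto.
  rewrite <- avg_minus. now apply avg_ext.
Qed.

Lemma avgn_scal (j : nat) (c : R) (h : nat -> R) (n : nat) :
  avgn q j (fun m => c * h m) n = c * avgn q j h n.
Proof.
  revert n; induction j as [|j IH]; intros n; simpl; auto.
  rewrite <- avg_scal. now apply avg_ext.
Qed.

Lemma avgn_const (j : nat) (c : R) (n : nat) : avgn q j (fun _ => c) n = c.
Proof.
  revert n; induction j as [|j IH]; intros n; simpl; auto.
  rewrite (avg_ext _ (fun _ => c)) by exact IH. apply avg_const.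
Qed.

Lemma avgn_le (j : nat) (g h : nat -> R) (n : nat) :
  (forall m, g m <= h m) -> avgn q j g n <= avgn q j h n.
Proof.
  intros H. revert n; induction j as [|j IH]; intros n; simpl; auto. now apply avg_le.
Qed.

Lemma avgn_Rabs (j : nat) (h : nat -> R) (n : nat) :
  Rabs (avgn q j h n) <= avgn q j (fun m => Rabs (h m)) n.
Proof.
  revert n; induction j as [|j IH]; intros n; simpl; [lra|].
  eapply Rle_trans; [apply avg_Rabs|]. now apply avg_le.
Qed.

Lemma avgn_add (i j : nat) (h : nat -> R) (n : nat) :
  avgn q (i + j) h n = avgn q i (avgn q j h) n.
Proof. revert n; induction i as [|i IH]; intros n; simpl; auto. now apply avg_ext. Qed.

Lemma avgn_avg (j : nat) (h : nat -> R) (n : nat) :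
  avgn q j (avg q h) n = avgn q (S j) h n.
Proof. rewrite <- Nat.add_1_r. now rewrite avgn_add. Qed.

(** Appending [j] independent uniform digits appends one uniform [u < q ^ j]. Started at 0 this is
    the uniform integer below [q ^ j], started at [n] it runs over an interval of [q ^ j]
    consecutive integers; this links the digit chain to sums over integers. *)
Lemma avgn_explicit (j : nat) (h : nat -> R) (n : nat) :
  avgn q j h n = bsum (fun u => h (q ^ j * n + u)%nat) (q ^ j) / INR q ^ j.
Proof.
  revert n; induction j as [|j IH]; intros n.
  - simpl. replace (n + 0 + 0)%nat with n by lia. field.
  - simpl avgn. unfold avg.
    rewrite (bsum_ext _ (fun d => / INR q ^ j * bsum (fun u => h (q ^ j * (q * n + d) + u)%nat) (q ^ j))).
    2:{ intros d _. rewrite IH. lra. }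
    rewrite bsum_scal. change (q ^ S j)%nat with (q * q ^ j)%nat.
    rewrite bsum_mul, <- tech_pow_Rmult.
    rewrite (bsum_ext (fun d => bsum (fun u => h (q ^ j * (q * n + d) + u)%nat) (q ^ j))
       (fun i => bsum (fun j0 => h (q * q ^ j * n + (q ^ j * i + j0))%nat) (q ^ j))).
    2:{ intros d _. apply bsum_ext. intros u _. f_equal. lia. }
    field. split; apply Rgt_not_eq; [apply INR_pow_pos|apply INR_q_pos].
Qed.

End Averages.

(** * Digits and length *)

Lemma digits_aux_fuel (q : nat) (Hq : (2 <= q)%nat) (fuel n : nat) :
  (n <= fuel)%nat -> digits_aux fuel q n = digits q n.
Proof.
  unfold digits. revert n. induction fuel as [fuel IH] using lt_wf_ind. intros n Hn.
  destruct fuel as [|fuel]; [now replace n with 0%nat by lia|].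
  destruct n as [|n]; [reflexivity|]. cbn [digits_aux Nat.eqb].
  assert (H : (S n / q < S n)%nat) by (apply Nat.div_lt; lia).
  f_equal. rewrite (IH fuel) by lia. destruct (Nat.eq_dec fuel n) as [->|Hne].
  - symmetry. apply IH; lia.
  - symmetry. apply IH; lia.
Qed.

Lemma digits_eq (q : nat) (Hq : (2 <= q)%nat) (n : nat) :
  digits q n = if Nat.eqb n 0 then [] else (n mod q)%nat :: digits q (n / q).
Proof.
  destruct n as [|n]; [reflexivity|]. unfold digits at 1. cbn [digits_aux Nat.eqb].
  f_equal. apply digits_aux_fuel; auto.
  assert (H : (S n / q < S n)%nat) by (apply Nat.div_lt; lia). lia.
Qed.

Lemma qlen_le_iff (q : nat) (Hq : (2 <= q)%nat) (n k : nat) :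
  (qlen q n <= k)%nat <-> (n < q ^ k)%nat.
Proof.
  unfold qlen. revert n; induction k as [|k IH]; intros n.
  - rewrite digits_eq by exact Hq. simpl. destruct (Nat.eqb_spec n 0); simpl; lia.
  - rewrite digits_eq by exact Hq. destruct (Nat.eqb_spec n 0) as [->|Hn]; cbn [length].
    + pose proof (pow_q_pos q Hq (S k)). simpl length. lia.
    + assert (E : (S (length (digits q (n / q))) <= S k <-> length (digits q (n / q)) <= k)%nat) by lia.
      rewrite E, IH. cbn [Nat.pow]. split; intros H.
      * pose proof (Nat.mul_succ_div_gt n q ltac:(lia)). nia.
      * apply Nat.Div0.div_lt_upper_bound; lia.
Qed.

Lemma lt_pow_qlen (q : nat) (Hq : (2 <= q)%nat) (n : nat) : (n < q ^ qlen q n)%nat.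
Proof. now apply qlen_le_iff. Qed.

Lemma qlen_append (q : nat) (Hq : (2 <= q)%nat) (n j u : nat) :
  (u < q ^ j)%nat -> (qlen q (q ^ j * n + u) <= qlen q n + j)%nat.
Proof.
  intros Hu. apply qlen_le_iff; auto. rewrite Nat.pow_add_r.
  pose proof (lt_pow_qlen q Hq n). nia.
Qed.

Lemma qlen_mono (q : nat) (Hq : (2 <= q)%nat) (m n : nat) :
  (m <= n)%nat -> (qlen q m <= qlen q n)%nat.
Proof.
  intros H. apply qlen_le_iff; auto. pose proof (lt_pow_qlen q Hq n). lia.
Qed.

(** * Digit strings without r consecutive zeros *)

(** Reads [u] as a string of exactly [j] digits, leading zeros included, with one test per window of
    [r] digits. The truncated [j + 1 - r] is the number of windows, so every string shorter than [r]
    passes. *)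
Definition avoidb (q r j u : nat) : bool :=
  forallb (fun k => negb (Nat.eqb ((u / q ^ k) mod q ^ r) 0)) (seq 0 (j + 1 - r)).

Lemma avoidb_spec (q r j u : nat) :
  avoidb q r j u = true <->
  (forall k, (k + r <= j)%nat -> ((u / q ^ k) mod q ^ r <> 0)%nat).
Proof.
  unfold avoidb. rewrite forallb_forall. split; intros H k Hk.
  - assert (Hin : In k (seq 0 (j + 1 - r))) by (apply in_seq; lia).
    apply H in Hin. intros E. rewrite E in Hin. discriminate.
  - apply in_seq in Hk. apply Bool.negb_true_iff, Nat.eqb_neq, H. lia.
Qed.

Lemma avoidb_false (q r j u : nat) :
  avoidb q r j u = false ->
  exists k, (k + r <= j)%nat /\ ((u / q ^ k) mod q ^ r = 0)%nat.
Proof.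
  intros H. apply NNPP. intros Hn.
  enough (E : avoidb q r j u = true) by congruence.
  apply avoidb_spec. intros k Hk E. apply Hn. eauto.
Qed.

Definition pavoid (q r j : nat) : R :=
  bsum (fun u => if avoidb q r j u then 1 else 0) (q ^ j) / INR q ^ j.

(** Induction on [p] with [th] split into two factors [sqrt th]: one absorbs the first [p] powers,
    the other the last one by Bernoulli's inequality. *)
Lemma pow_absorbed (p : nat) :
  forall th, 1 < th -> exists C, 0 < C /\ forall j, (1 + INR j) ^ p <= C * th ^ j.
Proof.
  induction p as [|p IH]; intros th Hth.
  - exists 1; split; [lra|]. intros j. simpl. pose proof (pow_R1_Rle th j ltac:(lra)). lra.
  - assert (Hs : 1 < sqrt th) by (rewrite <- sqrt_1; apply sqrt_lt_1; lra).
    destruct (IH (sqrt th) Hs) as [C [HC H]].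
    set (s := sqrt th) in *.
    exists (C * (1 + / (s - 1))). assert (Hi : 0 < / (s - 1)) by (apply Rinv_0_lt_compat; lra).
    split; [apply Rmult_lt_0_compat; lra|]. intros j.
    assert (Hb : 1 + INR j <= (1 + / (s - 1)) * s ^ j).
    { pose proof (poly j (s - 1) ltac:(lra)) as Hp.
      replace (1 + (s - 1)) with s in Hp by ring.
      pose proof (pos_INR j).
      apply Rle_trans with ((1 + / (s - 1)) * (1 + INR j * (s - 1))).
      - apply Rle_trans with (1 + INR j * (s - 1) + / (s - 1) + INR j).
        + assert (0 <= INR j * (s - 1)) by (apply Rmult_le_pos; lra). lra.
        + right. field. lra.
      - apply Rmult_le_compat_l; lra. }
    replace th with (s * s) by (apply sqrt_sqrt; lra).
    rewrite Rpow_mult_distr. cbn [pow].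
    replace (C * (1 + / (s - 1)) * (s ^ j * s ^ j))
      with ((1 + / (s - 1)) * s ^ j * (C * s ^ j)) by ring.
    pose proof (pos_INR j).
    apply Rmult_le_compat; try lra. apply pow_le; lra. apply H.
Qed.

Section Avoid.

Variables q r : nat.
Hypothesis Hq : (2 <= q)%nat.

(** Coupling: if the appended string contains a run of [r] zeros, a local [psi] sees only the digits
    below that run, and the starting point is forgotten. *)
Lemma avoid_local_eq (psi : nat -> R) (j u m n : nat) :
  (forall a b k, (b < q ^ k)%nat -> psi (q ^ (k + r) * a + b)%nat = psi b) ->
  (u < q ^ j)%nat -> avoidb q r j u = false ->
  psi (q ^ j * m + u)%nat = psi (q ^ j * n + u)%nat.
Proof.
  intros Hl Hu Ha. destruct (avoidb_false _ _ _ _ Ha) as [k [Hk E]].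
  pose proof (pow_q_pos q Hq k) as Pk.
  assert (Key : forall x, psi (q ^ j * x + u)%nat = psi (u mod q ^ k)%nat).
  { intros x. apply Nat.Div0.mod_divides in E. destruct E as [c E].
    rewrite <- (Hl (q ^ (j - k - r) * x + c)%nat (u mod q ^ k)%nat k) by (apply Nat.mod_upper_bound; lia).
    f_equal. pose proof (Nat.div_mod_eq u (q ^ k)) as Eu. rewrite E in Eu.
    replace j with ((k + r) + (j - k - r))%nat at 1 by lia.
    rewrite (Nat.pow_add_r q (k + r)). rewrite !(Nat.pow_add_r q k r). nia. }
  now rewrite !Key.
Qed.

Hypothesis Hr : (1 <= r)%nat.

Lemma pavoid_nonneg (j : nat) : 0 <= pavoid q r j.
Proof.
  apply Rmult_le_pos; [apply bsum_nonneg; intros; destruct avoidb; lra|].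
  apply Rlt_le, Rinv_0_lt_compat, INR_pow_pos; auto.
Qed.

Lemma pavoid_le_1 (j : nat) : pavoid q r j <= 1.
Proof.
  unfold pavoid. apply Rle_div_l; [apply INR_pow_pos; auto|].
  apply Rle_trans with (bsum (fun _ => 1) (q ^ j)).
  - apply bsum_le. intros; destruct avoidb; lra.
  - rewrite bsum_const, pow_INR. lra.
Qed.

(** Write the longer string as [q ^ r * i + c]. Its [r] lowest digits must not all vanish, which
    excludes [c = 0], and its upper part [i] must itself avoid the run. *)
Lemma pavoid_step (j : nat) : pavoid q r (j + r) <= (1 - / INR q ^ r) * pavoid q r j.
Proof.
  unfold pavoid. pose proof (INR_pow_pos q Hq j). pose proof (INR_pow_pos q Hq r).
  rewrite pow_add. apply Rle_div_l; [now apply Rmult_lt_0_compat|].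
  replace ((1 - / INR q ^ r) * (bsum (fun u => if avoidb q r j u then 1 else 0) (q ^ j) / INR q ^ j)
     * (INR q ^ j * INR q ^ r))
    with ((INR q ^ r - 1) * bsum (fun u => if avoidb q r j u then 1 else 0) (q ^ j))
    by (field; lra).
  rewrite <- bsum_scal, Nat.pow_add_r, bsum_mul. apply bsum_le. intros i Hi.
  pose proof (pow_q_pos q Hq r) as Pr.
  apply Rle_trans with
    (bsum (fun c => (if avoidb q r j i then 1 else 0) - (if Nat.eqb c 0 then (if avoidb q r j i then 1 else 0) else 0)) (q ^ r)).
  - apply bsum_le. intros c Hc.
    destruct (avoidb q r (j + r) (q ^ r * i + c)) eqn:E.
    + rewrite avoidb_spec in E.
      replace (avoidb q r j i) with true.
      * destruct (Nat.eqb_spec c 0) as [->|]; [|lra].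
        exfalso. apply (E 0%nat); [lia|].
        rewrite Nat.pow_0_r, Nat.div_1_r, Nat.add_0_r, Nat.mul_comm. apply Nat.Div0.mod_mul.
      * symmetry. apply avoidb_spec. intros k Hk Ek. apply (E (r + k)%nat); [lia|].
        rewrite Nat.pow_add_r, <- Nat.Div0.div_div, (Nat.mul_comm _ i), Nat.div_add_l by lia.
        rewrite (Nat.div_small c) by lia. now rewrite Nat.add_0_r.
    + destruct (Nat.eqb c 0), (avoidb q r j i); lra.
  - rewrite bsum_minus, bsum_const, bsum_delta, pow_INR.
    destruct (Nat.ltb_spec 0 (q ^ r)); [|lia]. destruct (avoidb q r j i); lra.
Qed.

(** [y] converts the loss per [r] digits of [pavoid_step] into a loss per digit: [1 - / q ^ r] is at
    most [(1 - y) ^ r] by Bernoulli's inequality. The factor [/ (1 - y) ^ r] covers the start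
    [j < r] of the induction. *)
Lemma pavoid_geometric :
  exists rho C, 0 < rho < 1 /\ 0 < C /\ forall j, pavoid q r j <= C * rho ^ j.
Proof.
  set (y := / INR q ^ r / INR r).
  assert (Hqr : 2 <= INR q ^ r).
  { destruct r as [|r']; [lia|]. cbn [pow]. pose proof (INR_q_ge2 q Hq).
    pose proof (pow_R1_Rle (INR q) r' ltac:(lra)).
    apply Rle_trans with (2 * 1); [lra|apply Rmult_le_compat; lra]. }
  assert (Hrr : 1 <= INR r) by (apply (le_INR 1); lia).
  assert (Hi : 0 < / INR q ^ r <= /2).
  { split; [apply Rinv_0_lt_compat; lra|apply Rinv_le_contravar; lra]. }
  assert (Hy : 0 < y <= /2).
  { unfold y. split; [apply Rdiv_lt_0_compat; lra|]. apply Rle_div_l; nra. }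
  assert (Bern : 1 - / INR q ^ r <= (1 - y) ^ r).
  { replace (/ INR q ^ r) with (INR r * y) by (unfold y; field; lra).
    clearbody y. generalize r as n. induction n as [|n IH]; [simpl; lra|].
    rewrite S_INR. cbn [pow]. pose proof (pos_INR n).
    apply Rle_trans with ((1 - y) * (1 - INR n * y)); [|apply Rmult_le_compat_l; lra].
    assert (0 <= INR n * y * y) by (repeat apply Rmult_le_pos; lra). lra. }
  clearbody y. exists (1 - y), (/ (1 - y) ^ r).
  assert (Pr : 0 < (1 - y) ^ r) by (apply pow_lt; lra).
  split; [lra|]. split; [now apply Rinv_0_lt_compat|].
  intros j. apply Rmult_le_reg_l with ((1 - y) ^ r); [exact Pr|].
  replace ((1 - y) ^ r * (/ (1 - y) ^ r * (1 - y) ^ j)) with ((1 - y) ^ j) by (field; lra).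
  induction j as [j IH] using lt_wf_ind.
  destruct (Nat.lt_ge_cases j r) as [Hj|Hj].
  - pose proof (pavoid_le_1 j).
    apply Rle_trans with ((1 - y) ^ r * 1); [apply Rmult_le_compat_l; lra|].
    rewrite Rmult_1_r. replace r with (j + (r - j))%nat by lia. rewrite pow_add.
    assert (0 < (1 - y) ^ j) by (apply pow_lt; lra).
    assert ((1 - y) ^ (r - j) <= 1).
    { apply Rle_trans with (1 ^ (r - j)); [apply pow_incr; lra|rewrite pow1; lra]. }
    apply Rle_trans with ((1 - y) ^ j * 1); [|lra]. apply Rmult_le_compat_l; lra.
  - pose proof (pavoid_step (j - r)) as Hs. replace (j - r + r)%nat with j in Hs by lia.
    specialize (IH (j - r)%nat ltac:(lia)). pose proof (pavoid_nonneg (j - r)).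
    replace j with (r + (j - r))%nat at 2 by lia. rewrite pow_add.
    apply Rle_trans with ((1 - y) ^ r * ((1 - / INR q ^ r) * pavoid q r (j - r))); [apply Rmult_le_compat_l; lra|].
    apply Rle_trans with ((1 - y) ^ r * ((1 - y) ^ r * pavoid q r (j - r))).
    + apply Rmult_le_compat_l; [lra|]. apply Rmult_le_compat_r; lra.
    + apply Rmult_le_compat_l; lra.
Qed.

(** The rate [th], midway between [rho] and 1, is fixed before the exponent [p], so all tame
    functions mix at one common rate whatever their growth. *)
Lemma avoid_decay :
  exists th, 0 < th < 1 /\
    forall p, exists C, 0 < C /\ forall j, pavoid q r j * (1 + INR j) ^ p <= C * th ^ j.
Proof.
  destruct pavoid_geometric as [rho [C [Hrho [HC H]]]].
  exists ((1 + rho) / 2). split; [lra|]. intros p.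
  set (th := (1 + rho) / 2).
  destruct (pow_absorbed p (th / rho)) as [C' [HC' H']].
  { unfold th. apply Rlt_div_r; lra. }
  exists (C * C'). split; [now apply Rmult_lt_0_compat|]. intros j.
  specialize (H j). specialize (H' j). pose proof (pavoid_nonneg j).
  replace (C * C' * th ^ j) with ((C * rho ^ j) * (C' * (th / rho) ^ j)).
  - apply Rmult_le_compat; auto. apply pow_le. pose proof (pos_INR j). lra.
  - assert (Er : th ^ j = rho ^ j * (th / rho) ^ j).
    { rewrite <- Rpow_mult_distr. f_equal. field. lra. }
    rewrite Er. ring.
Qed.

End Avoid.

(** * Local functions and the Poisson equation *)

(** The shift by one keeps the weight at least 1, also at [n = 0], so that its powers increase with
    the exponent and weights of appended strings can be bounded by products. *)
Definition lenw (q n : nat) : R := 1 + INR (qlen q n).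

(* [psi] depends only on the digits below any run of [r] zeros. *)
Definition local (q r : nat) (psi : nat -> R) : Prop :=
  forall a b k, (b < q ^ k)%nat -> psi (q ^ (k + r) * a + b)%nat = psi b.

Definition growth (q : nat) (psi : nat -> R) : Prop :=
  exists C p, 0 <= C /\ forall n, Rabs (psi n) <= C * lenw q n ^ p.

Definition tame (q r : nat) (psi : nat -> R) : Prop := local q r psi /\ growth q psi.

(* Satisfied by [beta] below, which itself is not local: the case [k = 0] fails. *)
Definition pretame (q r : nat) (psi : nat -> R) : Prop :=
  forall d, (d < q)%nat -> tame q r (fun n => psi (q * n + d)%nat).

(** The long-run mean, computed from the starting point 0; [tame_lim] and [pretame_lim] show that
    every starting point leads to the same value. *)
Definition mean (q : nat) (psi : nat -> R) : R :=
  real (Lim_seq (fun j => avgn q j psi 0%nat)).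

(** The Neumann series of the averaging operator applied to [psi - mean q psi], the classical
    solution of the Poisson equation. *)
Definition corrector (q : nat) (psi : nat -> R) (n : nat) : R :=
  Series (fun j => avgn q j psi n - mean q psi).

(** * Limits and series with geometric bounds *)

Lemma is_lim_seq_squeeze_0 (u w : nat -> R) :
  (forall n, Rabs (u n) <= w n) -> is_lim_seq w 0 -> is_lim_seq u 0.
Proof.
  intros H Hw. apply is_lim_seq_abs_0, (is_lim_seq_le_le (fun _ => 0) _ w); auto.
  - intros n. split; [apply Rabs_pos|auto].
  - apply is_lim_seq_const.
Qed.

Lemma is_lim_seq_geometric_0 (u : nat -> R) (C th : R) :
  0 < th < 1 -> (forall n, Rabs (u n) <= C * th ^ n) -> is_lim_seq u 0.
Proof.
  intros Hth H. apply (is_lim_seq_squeeze_0 _ _ H).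
  replace (Finite 0) with (Rbar_mult C 0) by (simpl; f_equal; ring).
  apply is_lim_seq_scal_l, is_lim_seq_geom. rewrite Rabs_pos_eq; lra.
Qed.

Lemma geometric_cauchy (u : nat -> R) (C th : R) :
  0 < th < 1 -> (forall j, Rabs (u (S j) - u j) <= C * th ^ j) ->
  exists l : R, is_lim_seq u l /\ forall j, Rabs (u j - l) <= C / (1 - th) * th ^ j.
Proof.
  intros Hth H.
  assert (HC : 0 <= C).
  { specialize (H 0%nat). simpl in H. pose proof (Rabs_pos (u 1%nat - u 0%nat)). lra. }
  assert (HC' : 0 <= C / (1 - th)) by (apply Rdiv_le_0_compat; lra).
  (* The factor [1 - th ^ k] is the exact geometric sum; the plain bound [Hb] would not survive the
     induction on [k]. *)
  assert (Hk : forall j k, Rabs (u (j + k)%nat - u j) <= C / (1 - th) * th ^ j * (1 - th ^ k)).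
  { intros j k. induction k as [|k IH].
    - rewrite Nat.add_0_r, Rminus_diag, Rabs_R0. simpl. lra.
    - rewrite Nat.add_succ_r.
      replace (u (S (j + k)) - u j) with ((u (S (j + k)) - u (j + k)%nat) + (u (j + k)%nat - u j)) by ring.
      eapply Rle_trans; [apply Rabs_triang|]. specialize (H (j + k)%nat).
      rewrite pow_add in H.
      replace (C / (1 - th) * th ^ j * (1 - th ^ S k))
        with (C * (th ^ j * th ^ k) + C / (1 - th) * th ^ j * (1 - th ^ k)) by (simpl; field; lra).
      lra. }
  assert (Hb : forall j k, Rabs (u (j + k)%nat - u j) <= C / (1 - th) * th ^ j).
  { intros j k. eapply Rle_trans; [apply Hk|].
    assert (0 <= C / (1 - th) * th ^ j) by (apply Rmult_le_pos; [lra|apply pow_le; lra]).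
    assert (0 <= th ^ k) by (apply pow_le; lra).
    rewrite <- (Rmult_1_r (C / (1 - th) * th ^ j)) at 2.
    apply Rmult_le_compat_l; lra. }
  assert (Hlim : is_lim_seq (fun j => C / (1 - th) * th ^ j) 0).
  { apply is_lim_seq_geometric_0 with (C / (1 - th)) th; auto. intros n.
    rewrite Rabs_pos_eq; [lra|]. apply Rmult_le_pos; auto. apply pow_le; lra. }
  assert (Hex : ex_finite_lim_seq u).
  { apply ex_lim_seq_cauchy_corr. intros eps.
    apply is_lim_seq_spec in Hlim. destruct (Hlim (pos_div_2 eps)) as [N HN].
    assert (Hn : forall n, (N <= n)%nat -> Rabs (u n - u N) < eps / 2).
    { intros n Hn. replace n with (N + (n - N))%nat by lia.
      eapply Rle_lt_trans; [apply Hb|]. specialize (HN N ltac:(lia)). simpl in HN.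
      rewrite Rminus_0_r in HN. eapply Rle_lt_trans; [apply Rle_abs|exact HN]. }
    exists N. intros n m Hn' Hm'.
    replace (u n - u m) with ((u n - u N) - (u m - u N)) by ring.
    eapply Rle_lt_trans; [apply Rabs_triang|]. rewrite Rabs_Ropp.
    pose proof (Hn n Hn'). pose proof (Hn m Hm'). lra. }
  destruct Hex as [l Hl]. exists l. split; auto. intros j.
  assert (Hj : is_lim_seq (fun k => Rabs (u j - u (k + j)%nat)) (Rabs (u j - l))).
  { change (Finite (Rabs (u j - l))) with (Rbar_abs (Finite (u j - l))).
    apply is_lim_seq_abs. apply is_lim_seq_minus'; [apply is_lim_seq_const|].
    now apply (is_lim_seq_incr_n u j). }
  apply (is_lim_seq_le _ _ (Rabs (u j - l)) (C / (1 - th) * th ^ j)) with (2 := Hj) (3 := is_lim_seq_const _).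
  intros k. rewrite Rabs_minus_sym, Nat.add_comm. apply Hb.
Qed.

Lemma is_series_geometric_bound (u : nat -> R) (C th : R) :
  0 < th < 1 -> (forall j, Rabs (u j) <= C * th ^ j) ->
  ex_series u /\ Rabs (Series u) <= C / (1 - th).
Proof.
  intros Hth H.
  assert (Hg : is_series (fun j => C * th ^ j) (C / (1 - th))).
  { replace (C / (1 - th)) with (scal C (/ (1 - th))) by reflexivity.
    apply (is_series_scal C (fun j => th ^ j)). apply is_series_geom. rewrite Rabs_pos_eq; lra. }
  assert (Ha : ex_series (fun j => Rabs (u j))).
  { apply (@ex_series_le R_AbsRing R_CompleteNormedModule _ (fun j => C * th ^ j)).
    - intros j. change norm with Rabs. rewrite Rabs_Rabsolu. apply H.
    - eexists; apply Hg. }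
  split; [now apply ex_series_Rabs|].
  eapply Rle_trans; [now apply Series_Rabs|].
  rewrite <- (is_series_unique _ _ Hg). apply Series_le.
  - intros j; split; [apply Rabs_pos|apply H].
  - eexists; apply Hg.
Qed.

Lemma is_series_Rmult (c : R) (u : nat -> R) (l : R) :
  is_series u l -> is_series (fun n => c * u n) (c * l).
Proof. intros H. exact (is_series_scal c u l H). Qed.

Lemma is_series_finite_sum (u : nat -> nat -> R) (l : nat -> R) (N : nat) :
  (forall d, (d < N)%nat -> is_series (u d) (l d)) ->
  is_series (fun j => bsum (fun d => u d j) N) (bsum l N).
Proof.
  induction N as [|N IH]; intros H; simpl.
  - apply is_series_bsum. apply is_lim_seq_ext with (fun _ => 0); [|apply is_lim_seq_const].
    intros n. rewrite bsum_const. lra.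
  - apply (is_series_plus (fun j => bsum (fun d => u d j) N) (u N)); auto.
Qed.

(** * Mixing, means and correctors of tame functions *)

Section Tame.

Variables q r : nat.
Hypothesis Hq : (2 <= q)%nat.

Lemma lenw_ge_1 (n : nat) : 1 <= lenw q n.
Proof. unfold lenw. pose proof (pos_INR (qlen q n)). lra. Qed.

Lemma lenw_pow_ge_1 (n p : nat) : 1 <= lenw q n ^ p.
Proof. apply pow_R1_Rle, lenw_ge_1. Qed.

Lemma lenw_append (n j u : nat) :
  (u < q ^ j)%nat -> lenw q (q ^ j * n + u)%nat <= (1 + INR j) * lenw q n.
Proof.
  intros Hu. unfold lenw. pose proof (le_INR _ _ (qlen_append q Hq n j u Hu)) as H.
  rewrite plus_INR in H. pose proof (pos_INR (qlen q n)). pose proof (pos_INR j).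
  assert (0 <= INR j * INR (qlen q n)) by now apply Rmult_le_pos. lra.
Qed.

Lemma lenw_mono (m n : nat) : (m <= n)%nat -> lenw q m <= lenw q n.
Proof. intros H. apply Rplus_le_compat_l, le_INR. now apply qlen_mono. Qed.

Lemma growth_const (c : R) : growth q (fun _ => c).
Proof. exists (Rabs c), 0%nat. split; [apply Rabs_pos|]. intros n; simpl; lra. Qed.

Lemma growth_plus (f g : nat -> R) : growth q f -> growth q g -> growth q (fun n => f n + g n).
Proof.
  intros [C [p [HC H]]] [C' [p' [HC' H']]]. exists (C + C'), (p + p')%nat. split; [lra|].
  intros n. eapply Rle_trans; [apply Rabs_triang|].
  rewrite Rmult_plus_distr_r. apply Rplus_le_compat.
  - eapply Rle_trans; [apply H|]. apply Rmult_le_compat_l; auto.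
    apply Rle_pow; [apply lenw_ge_1|apply Nat.le_add_r].
  - eapply Rle_trans; [apply H'|]. apply Rmult_le_compat_l; auto.
    apply Rle_pow; [apply lenw_ge_1|apply Nat.le_add_l].
Qed.

Lemma growth_mult (f g : nat -> R) : growth q f -> growth q g -> growth q (fun n => f n * g n).
Proof.
  intros [C [p [HC H]]] [C' [p' [HC' H']]]. exists (C * C'), (p + p')%nat.
  split; [now apply Rmult_le_pos|].
  intros n. rewrite Rabs_mult, pow_add.
  replace (C * C' * (lenw q n ^ p * lenw q n ^ p')) with ((C * lenw q n ^ p) * (C' * lenw q n ^ p')) by ring.
  apply Rmult_le_compat; auto using Rabs_pos.
Qed.

Lemma growth_Rabs (f : nat -> R) : growth q f -> growth q (fun n => Rabs (f n)).
Proof. intros [C [p [HC H]]]. exists C, p. split; auto. intros n. rewrite Rabs_Rabsolu. auto. Qed.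

Lemma growth_shift (f : nat -> R) (d : nat) :
  (d < q)%nat -> growth q f -> growth q (fun n => f (q * n + d)%nat).
Proof.
  intros Hd [C [p [HC H]]]. exists (C * 2 ^ p), p.
  split; [apply Rmult_le_pos; [lra|apply pow_le; lra]|].
  intros n. eapply Rle_trans; [apply H|]. rewrite Rmult_assoc. apply Rmult_le_compat_l; auto.
  rewrite <- Rpow_mult_distr. apply pow_incr. split; [pose proof (lenw_ge_1 (q * n + d)); lra|].
  pose proof (lenw_append n 1 d) as Ha. rewrite Nat.pow_1_r in Ha. simpl INR in Ha.
  replace 2 with (1 + 1) by ring. auto.
Qed.

Lemma tame_const (c : R) : tame q r (fun _ => c).
Proof. split; [now intros a b k|apply growth_const]. Qed.

Lemma tame_plus (f g : nat -> R) : tame q r f -> tame q r g -> tame q r (fun n => f n + g n).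
Proof.
  intros [Lf Gf] [Lg Gg]. split; [|now apply growth_plus].
  intros a b k Hb. now rewrite Lf, Lg.
Qed.

Lemma tame_mult (f g : nat -> R) : tame q r f -> tame q r g -> tame q r (fun n => f n * g n).
Proof.
  intros [Lf Gf] [Lg Gg]. split; [|now apply growth_mult].
  intros a b k Hb. now rewrite Lf, Lg.
Qed.

Lemma tame_ext (f g : nat -> R) : (forall n, f n = g n) -> tame q r f -> tame q r g.
Proof.
  intros E [Lf [C [p [HC H]]]]. split.
  - intros a b k Hb. rewrite <- !E. auto.
  - exists C, p. split; auto. intros n. rewrite <- E. auto.
Qed.

Lemma tame_minus (f g : nat -> R) : tame q r f -> tame q r g -> tame q r (fun n => f n - g n).
Proof.
  intros Hf Hg. apply tame_ext with (fun n => f n + (-1) * g n); [intros; ring|].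
  apply tame_plus; auto. apply tame_mult; auto. apply tame_const.
Qed.

Lemma tame_Rabs (f : nat -> R) : tame q r f -> tame q r (fun n => Rabs (f n)).
Proof.
  intros [Lf Gf]. split; [|now apply growth_Rabs]. intros a b k Hb. now rewrite Lf.
Qed.

Lemma tame_shift (f : nat -> R) (d : nat) :
  (d < q)%nat -> tame q r f -> tame q r (fun n => f (q * n + d)%nat).
Proof.
  intros Hd [Lf Gf]. split; [|now apply growth_shift].
  intros a b k Hb.
  replace (q * (q ^ (k + r) * a + b) + d)%nat with (q ^ (S k + r) * a + (q * b + d))%nat
    by (cbn [Nat.add Nat.pow]; ring).
  apply Lf. cbn [Nat.pow]. nia.
Qed.

Lemma tame_bsum (f : nat -> nat -> R) (N : nat) :
  (forall d, (d < N)%nat -> tame q r (f d)) -> tame q r (fun n => bsum (fun d => f d n) N).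
Proof.
  induction N as [|N IH]; intros H; simpl; [apply tame_const|].
  apply tame_plus; auto.
Qed.

Lemma tame_pretame (f : nat -> R) : tame q r f -> pretame q r f.
Proof. intros Hf d Hd. now apply tame_shift. Qed.

Lemma pretame_avg (f : nat -> R) : pretame q r f -> tame q r (avg q f).
Proof. intros Hf. apply tame_mult; [|apply tame_const]. now apply tame_bsum. Qed.

Lemma tame_avg (f : nat -> R) : tame q r f -> tame q r (avg q f).
Proof. intros Hf. now apply pretame_avg, tame_pretame. Qed.

Lemma pretame_plus (f g : nat -> R) :
  pretame q r f -> pretame q r g -> pretame q r (fun n => f n + g n).
Proof. intros Hf Hg d Hd. apply (tame_plus (fun n => f (q * n + d)%nat)); auto. Qed.

Lemma pretame_mult (f g : nat -> R) :
  pretame q r f -> pretame q r g -> pretame q r (fun n => f n * g n).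
Proof. intros Hf Hg d Hd. apply (tame_mult (fun n => f (q * n + d)%nat)); auto. Qed.

Lemma tame_avgn (f : nat -> R) (j : nat) : tame q r f -> tame q r (avgn q j f).
Proof. intros Hf. induction j; simpl; auto using tame_avg. Qed.

Variable th : R.
Hypothesis Hth : 0 < th < 1.
Hypothesis Hdecay : forall p, exists C, 0 < C /\
  forall j, pavoid q r j * (1 + INR j) ^ p <= C * th ^ j.

(** Both starting points receive the same string [u]. The difference vanishes unless [u] avoids a
    run of [r] zeros, and then polynomial growth bounds it; [Hdecay] absorbs the polynomial factor
    in [j]. *)
Lemma tame_mixing (psi : nat -> R) :
  tame q r psi -> exists C p, 0 <= C /\ forall j n m,
    Rabs (avgn q j psi n - avgn q j psi m) <= C * th ^ j * (lenw q n ^ p + lenw q m ^ p).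
Proof.
  intros [Hl [C [p [HC Hg]]]]. destruct (Hdecay p) as [C' [HC' Hd]].
  exists (C * C'), p. split; [apply Rmult_le_pos; lra|]. intros j n m.
  pose proof (INR_pow_pos q Hq j) as Pj. specialize (Hd j).
  pose proof (lenw_pow_ge_1 n p) as Ln. pose proof (lenw_pow_ge_1 m p) as Lm.
  rewrite !avgn_explicit by exact Hq.
  unfold Rdiv. rewrite <- Rmult_minus_distr_r, <- bsum_minus, Rabs_mult.
  rewrite (Rabs_pos_eq (/ _)) by (apply Rlt_le, Rinv_0_lt_compat; lra).
  apply Rle_trans with (C * (1 + INR j) ^ p * (lenw q n ^ p + lenw q m ^ p) * pavoid q r j).
  - unfold pavoid, Rdiv. rewrite <- Rmult_assoc. apply Rmult_le_compat_r;
      [apply Rlt_le, Rinv_0_lt_compat; lra|].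
    eapply Rle_trans; [apply bsum_Rabs|]. rewrite <- bsum_scal. apply bsum_le. intros u Hu.
    destruct (avoidb q r j u) eqn:E.
    + unfold Rminus. eapply Rle_trans; [apply Rabs_triang|]. rewrite Rabs_Ropp.
      assert (Hx : forall x, Rabs (psi (q ^ j * x + u)%nat) <= C * (1 + INR j) ^ p * lenw q x ^ p).
      { intros x. eapply Rle_trans; [apply Hg|]. rewrite Rmult_assoc. apply Rmult_le_compat_l; auto.
        rewrite <- Rpow_mult_distr. apply pow_incr.
        split; [pose proof (lenw_ge_1 (q ^ j * x + u)); lra|]. now apply lenw_append. }
      pose proof (Hx n). pose proof (Hx m). lra.
    + rewrite (avoid_local_eq q r Hq psi j u n m Hl Hu E), Rminus_diag, Rabs_R0. lra.
  - replace (C * (1 + INR j) ^ p * (lenw q n ^ p + lenw q m ^ p) * pavoid q r j)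
      with (C * (lenw q n ^ p + lenw q m ^ p) * (pavoid q r j * (1 + INR j) ^ p)) by ring.
    replace (C * C' * th ^ j * (lenw q n ^ p + lenw q m ^ p))
      with (C * (lenw q n ^ p + lenw q m ^ p) * (C' * th ^ j)) by ring.
    apply Rmult_le_compat_l; auto. apply Rmult_le_pos; lra.
Qed.

(** One more step from 0 averages over the starting points [d < q], so [tame_mixing] bounds the
    difference of consecutive averages and [geometric_cauchy] applies. A second use of mixing passes
    from 0 to [n]. *)
Lemma tame_mean (psi : nat -> R) :
  tame q r psi -> exists C p, 0 <= C /\ forall j n,
    Rabs (avgn q j psi n - mean q psi) <= C * th ^ j * lenw q n ^ p.
Proof.
  intros Ht. destruct (tame_mixing psi Ht) as [C [p [HC H]]].
  (* A single digit has weight [lenw] at most 2, and 0 has weight 1. *)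
  set (D := C * (2 ^ p + 1)).
  assert (L0 : lenw q 0 = 1) by (unfold lenw; change (qlen q 0) with 0%nat; simpl; ring).
  destruct (geometric_cauchy (fun j => avgn q j psi 0%nat) D th Hth) as [l [Hl Hj]].
  { intros j. cbn [avgn].
    replace (avg q (avgn q j psi) 0 - avgn q j psi 0%nat)
      with (avg q (fun m => avgn q j psi m - avgn q j psi 0%nat) 0)
      by (rewrite avg_minus, avg_const by auto; reflexivity).
    eapply Rle_trans; [apply avg_Rabs; auto|].
    apply Rle_trans with (avg q (fun _ => D * th ^ j) 0); [|rewrite avg_const by auto; lra].
    apply avg_le_strong; auto. intros d Hd. eapply Rle_trans; [apply H|]. unfold D.
    replace (C * (2 ^ p + 1) * th ^ j) with (C * th ^ j * (2 ^ p + 1)) by ring.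
    apply Rmult_le_compat_l; [apply Rmult_le_pos; [auto|apply pow_le; lra]|].
    apply Rplus_le_compat.
    - apply pow_incr. split; [pose proof (lenw_ge_1 (q * 0 + d)); lra|].
      pose proof (lenw_append 0 1 d) as Ha. rewrite Nat.pow_1_r, L0 in Ha. change (INR 1) with 1 in Ha. specialize (Ha Hd). lra.
    - rewrite L0, pow1. lra. }
  assert (HD : 0 <= D / (1 - th)).
  { apply Rdiv_le_0_compat; [|lra]. apply Rmult_le_pos; auto.
    assert (0 < 2 ^ p) by (apply pow_lt; lra). lra. }
  assert (Hm : mean q psi = l) by (unfold mean; rewrite (is_lim_seq_unique _ _ Hl); reflexivity).
  rewrite Hm. exists (2 * C + D / (1 - th)), p. split; [lra|]. intros j n.
  replace (avgn q j psi n - l) with ((avgn q j psi n - avgn q j psi 0%nat) + (avgn q j psi 0%nat - l)) by ring.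
  eapply Rle_trans; [apply Rabs_triang|].
  assert (Pj : 0 <= th ^ j) by (apply pow_le; lra).
  pose proof (lenw_pow_ge_1 n p) as Ln.
  replace ((2 * C + D / (1 - th)) * th ^ j * lenw q n ^ p)
    with (C * th ^ j * (2 * lenw q n ^ p) + D / (1 - th) * th ^ j * lenw q n ^ p) by ring.
  apply Rplus_le_compat.
  - eapply Rle_trans; [apply H|]. rewrite L0, pow1. apply Rmult_le_compat_l; [now apply Rmult_le_pos|lra].
  - eapply Rle_trans; [apply Hj|]. rewrite <- (Rmult_1_r (D / (1 - th) * th ^ j)) at 1.
    apply Rmult_le_compat_l; auto. now apply Rmult_le_pos.
Qed.

Lemma tame_lim (psi : nat -> R) (n : nat) :
  tame q r psi -> is_lim_seq (fun j => avgn q j psi n) (mean q psi).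
Proof.
  intros Ht. destruct (tame_mean psi Ht) as [C [p [HC H]]].
  apply is_lim_seq_ext with (fun j => mean q psi + (avgn q j psi n - mean q psi)); [intros; ring|].
  replace (Finite (mean q psi)) with (Finite (mean q psi + 0)) by (f_equal; ring).
  apply is_lim_seq_plus'; [apply is_lim_seq_const|].
  apply is_lim_seq_geometric_0 with (C * lenw q n ^ p) th; auto.
  intros j. eapply Rle_trans; [apply H|]. right; ring.
Qed.

Lemma mean_unique (psi : nat -> R) (l : R) :
  is_lim_seq (fun j => avgn q j psi 0%nat) l -> mean q psi = l.
Proof. intros H. unfold mean. now rewrite (is_lim_seq_unique _ _ H). Qed.

Lemma tame_avgn_bounded (psi : nat -> R) :
  tame q r psi -> exists C p, 0 <= C /\ forall j n, Rabs (avgn q j psi n) <= C * lenw q n ^ p.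
Proof.
  intros Ht. destruct (tame_mean psi Ht) as [C [p [HC H]]].
  exists (C + Rabs (mean q psi)), p. pose proof (Rabs_pos (mean q psi)) as Pm.
  split; [lra|]. intros j n. specialize (H j n).
  replace (avgn q j psi n) with ((avgn q j psi n - mean q psi) + mean q psi) by ring.
  eapply Rle_trans; [apply Rabs_triang|].
  pose proof (lenw_pow_ge_1 n p).
  assert (th ^ j <= 1) by (rewrite <- (pow1 j); apply pow_incr; lra).
  assert (C * th ^ j * lenw q n ^ p <= C * lenw q n ^ p).
  { apply Rmult_le_compat_r; [lra|]. rewrite <- (Rmult_1_r C) at 2. now apply Rmult_le_compat_l. }
  assert (Rabs (mean q psi) * 1 <= Rabs (mean q psi) * lenw q n ^ p) by (apply Rmult_le_compat_l; lra).
  lra.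
Qed.

(** One application of [avg] makes a pretame function tame and shifts the sequence by one index. In
    this way limits and linearity of the mean extend to pretame functions such as [beta]. *)
Lemma mean_avg (f : nat -> R) : pretame q r f -> mean q (avg q f) = mean q f.
Proof.
  intros Hf. symmetry. apply mean_unique. apply is_lim_seq_incr_1.
  apply is_lim_seq_ext with (fun j => avgn q j (avg q f) 0%nat).
  - intros j. now rewrite avgn_avg.
  - now apply tame_lim, pretame_avg.
Qed.

Lemma pretame_lim (f : nat -> R) (n : nat) :
  pretame q r f -> is_lim_seq (fun j => avgn q j f n) (mean q f).
Proof.
  intros Hf. rewrite <- mean_avg by exact Hf. apply is_lim_seq_incr_1.
  apply is_lim_seq_ext with (fun j => avgn q j (avg q f) n).
  - intros j. now rewrite avgn_avg.
  - now apply tame_lim, pretame_avg.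
Qed.

Lemma mean_plus (f g : nat -> R) :
  pretame q r f -> pretame q r g -> mean q (fun n => f n + g n) = mean q f + mean q g.
Proof.
  intros Hf Hg. apply mean_unique.
  apply is_lim_seq_ext with (fun j => avgn q j f 0%nat + avgn q j g 0%nat).
  - intros j. now rewrite avgn_plus.
  - apply is_lim_seq_plus'; now apply pretame_lim.
Qed.

Lemma mean_scal (c : R) (f : nat -> R) :
  pretame q r f -> mean q (fun n => c * f n) = c * mean q f.
Proof.
  intros Hf. apply mean_unique.
  apply is_lim_seq_ext with (fun j => c * avgn q j f 0%nat).
  - intros j. now rewrite avgn_scal.
  - apply is_lim_seq_mult'; [apply is_lim_seq_const|now apply pretame_lim].
Qed.

Lemma mean_const (c : R) : mean q (fun _ => c) = c.
Proof.
  apply mean_unique. apply is_lim_seq_ext with (fun _ => c); [|apply is_lim_seq_const].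
  intros j. now rewrite avgn_const.
Qed.

Lemma mean_ext (f g : nat -> R) : (forall n, f n = g n) -> mean q f = mean q g.
Proof. intros E. unfold mean. f_equal. apply Lim_seq_ext. intros j. now apply avgn_ext. Qed.

(** Averaging [k] times turns the Neumann series into its tail from index [k] on. The case [k = 0]
    is convergence, comparing it with [k = 1] gives the Poisson equation, and large [k] gives mean
    0. *)
Lemma corrector_is_series (psi : nat -> R) (n k : nat) :
  tame q r psi ->
  is_series (fun j => avgn q (k + j) psi n - mean q psi) (avgn q k (corrector q psi) n).
Proof.
  intros Ht. revert n. induction k as [|k IH]; intros n.
  - apply Series_correct. destruct (tame_mean psi Ht) as [C [p [HC H]]].
    apply (is_series_geometric_bound _ (C * lenw q n ^ p) th Hth).
    intros j. eapply Rle_trans; [apply H|]. cbn [Nat.add]. right; ring.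
  - cbn [avgn]. unfold avg at 1, Rdiv. rewrite Rmult_comm.
    apply is_series_ext with (fun j => / INR q * bsum (fun d => avgn q (k + j) psi (q * n + d)%nat - mean q psi) q).
    + intros j. rewrite bsum_minus, bsum_const. change (S k + j)%nat with (S (k + j)). cbn [avgn].
      unfold avg. real_eq. field. apply Rgt_not_eq, INR_q_pos; auto.
    + apply is_series_Rmult.
      apply (is_series_finite_sum (fun d j => avgn q (k + j) psi (q * n + d)%nat - mean q psi)).
      intros d Hd. apply IH.
Qed.

Lemma corrector_bound (psi : nat -> R) :
  tame q r psi -> exists C p, 0 <= C /\ forall k n,
    Rabs (avgn q k (corrector q psi) n) <= C * th ^ k * lenw q n ^ p.
Proof.
  intros Ht. destruct (tame_mean psi Ht) as [C [p [HC H]]].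
  exists (C / (1 - th)), p. split; [apply Rdiv_le_0_compat; lra|]. intros k n.
  rewrite <- (is_series_unique _ _ (corrector_is_series psi n k Ht)).
  eapply Rle_trans; [apply (is_series_geometric_bound _ (C * th ^ k * lenw q n ^ p) th Hth)|].
  - intros j. eapply Rle_trans; [apply H|]. rewrite pow_add. right; ring.
  - right. field. lra.
Qed.

Lemma corrector_tame (psi : nat -> R) : tame q r psi -> tame q r (corrector q psi).
Proof.
  intros Ht. split.
  - intros a b k Hb. apply Series_ext. intros j. f_equal.
    now apply (tame_avgn psi j Ht).
  - destruct (corrector_bound psi Ht) as [C [p [HC H]]]. exists C, p. split; auto.
    intros n. specialize (H 0%nat n). simpl in H. lra.
Qed.

Lemma corrector_poisson (psi : nat -> R) (n : nat) :
  tame q r psi -> avg q (corrector q psi) n = corrector q psi n - (psi n - mean q psi).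
Proof.
  intros Ht. pose proof (corrector_is_series psi n 0 Ht) as H0.
  pose proof (corrector_is_series psi n 1 Ht) as H1. simpl in H0, H1.
  rewrite <- (is_series_unique _ _ H0), <- (is_series_unique _ _ H1).
  rewrite (Series_incr_1 (fun j => avgn q j psi n - mean q psi)) by (eexists; exact H0).
  simpl. ring.
Qed.

Lemma mean_corrector (psi : nat -> R) : tame q r psi -> mean q (corrector q psi) = 0.
Proof.
  intros Ht. apply mean_unique. destruct (corrector_bound psi Ht) as [C [p [HC H]]].
  apply is_lim_seq_geometric_0 with (C * lenw q 0 ^ p) th; auto.
  intros j. eapply Rle_trans; [apply H|]. right; ring.
Qed.

End Tame.

(** * Completed blocks *)

Fixpoint gap_aux (q r fuel n : nat) : nat :=
  match fuel with
  | O => O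
  | S i => if Nat.eqb (n mod q ^ r) 0 then O else S (gap_aux q r i (n / q))
  end.

(* [gap q r n] is the position of the lowest block of [r] zero digits of [n]
   (padded with leading zeros), so that [low_part q r n] consists of the digits below it. *)
Definition gap (q r n : nat) : nat := gap_aux q r n n.

Definition low_part (q r n : nat) : nat := (n mod q ^ gap q r n)%nat.

(* [phi] of the block that is completed by the last digit of [m], if there is one. *)
Definition beta (q r : nat) (phi : nat -> R) (m : nat) : R :=
  if (Nat.eqb (m mod q ^ r) 0 && negb (Nat.eqb ((m / q ^ r) mod q) 0))%bool
  then phi (low_part q r (m / q ^ r)) else 0.

Section Gap.

Variables q r : nat.
Hypothesis Hq : (2 <= q)%nat.

Definition is_gap (n k : nat) : Prop :=
  ((n / q ^ k) mod q ^ r = 0 /\ forall i, (i < k)%nat -> (n / q ^ i) mod q ^ r <> 0)%nat.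

Lemma div_pow_S (n k : nat) : (n / q / q ^ k = n / q ^ S k)%nat.
Proof. now rewrite Nat.Div0.div_div. Qed.

Lemma is_gap_gap (n : nat) : is_gap n (gap q r n).
Proof.
  unfold gap. enough (H : forall fuel n, (n <= fuel)%nat -> is_gap n (gap_aux q r fuel n)) by auto.
  clear n. induction fuel as [|fuel IH]; intros n Hn; simpl.
  - replace n with 0%nat by lia. split; [|lia]. simpl. apply Nat.Div0.mod_0_l.
  - destruct (Nat.eqb_spec (n mod q ^ r) 0) as [E|E].
    + split; [|lia]. now rewrite Nat.pow_0_r, Nat.div_1_r.
    + assert (Hn0 : n <> 0%nat) by (intros ->; apply E, Nat.Div0.mod_0_l).
      assert (Hlt : (n / q < n)%nat) by (apply Nat.div_lt; lia).
      destruct (IH (n / q)%nat ltac:(lia)) as [H1 H2]. split.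
      * now rewrite <- div_pow_S.
      * intros [|i] Hi; [now rewrite Nat.pow_0_r, Nat.div_1_r|].
        rewrite <- div_pow_S. apply H2. lia.
Qed.

Lemma gap_unique (n k : nat) : is_gap n k -> gap q r n = k.
Proof.
  intros [H1 H2]. destruct (is_gap_gap n) as [G1 G2].
  destruct (Nat.lt_trichotomy (gap q r n) k) as [H|[H|H]]; auto.
  - exfalso. now apply (H2 _ H).
  - exfalso. now apply (G2 _ H).
Qed.

Lemma gap_le (n k : nat) : ((n / q ^ k) mod q ^ r = 0)%nat -> (gap q r n <= k)%nat.
Proof.
  intros H. destruct (is_gap_gap n) as [_ G2].
  destruct (Nat.le_gt_cases (gap q r n) k) as [|Hlt]; auto. now apply G2 in Hlt.
Qed.

Lemma low_part_le (n : nat) : (low_part q r n <= n)%nat.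
Proof. apply Nat.Div0.mod_le. Qed.

Lemma div_append (a b k i : nat) :
  (i <= k)%nat -> ((q ^ k * a + b) / q ^ i = q ^ (k - i) * a + b / q ^ i)%nat.
Proof.
  intros Hi. pose proof (pow_q_pos q Hq i).
  replace (q ^ k * a)%nat with (q ^ (k - i) * a * q ^ i)%nat.
  - rewrite Nat.div_add_l by lia. reflexivity.
  - replace k with ((k - i) + i)%nat at 2 by lia. rewrite Nat.pow_add_r. ring.
Qed.

Lemma mod_append (a b k i : nat) : (i <= k)%nat -> ((q ^ k * a + b) mod q ^ i = b mod q ^ i)%nat.
Proof.
  intros Hi. replace (q ^ k * a + b)%nat with (b + (q ^ (k - i) * a) * q ^ i)%nat.
  - apply Nat.Div0.mod_add.
  - replace k with ((k - i) + i)%nat at 2 by lia. rewrite Nat.pow_add_r. ring.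
Qed.

(** A window starting at [k] or lower ends below position [k + r] and does not see [a]; the padding
    zeros of [b] place its lowest run at [k] or lower. *)
Lemma low_part_local (a b k : nat) :
  (b < q ^ k)%nat -> low_part q r (q ^ (k + r) * a + b) = low_part q r b.
Proof.
  intros Hb. destruct (is_gap_gap b) as [G1 G2].
  assert (Hk : (gap q r b <= k)%nat).
  { apply gap_le. rewrite Nat.div_small by exact Hb. apply Nat.Div0.mod_0_l. }
  assert (E : forall i, (i <= k)%nat ->
    (((q ^ (k + r) * a + b) / q ^ i) mod q ^ r = (b / q ^ i) mod q ^ r)%nat).
  { intros i Hi. rewrite div_append by lia. apply mod_append. lia. }
  assert (Eg : gap q r (q ^ (k + r) * a + b) = gap q r b).
  { apply gap_unique. split; [rewrite E by lia; exact G1|].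
    intros i Hi. rewrite E by lia. auto. }
  unfold low_part. rewrite Eg. apply mod_append. lia.
Qed.

Lemma tame_low_part (phi : nat -> R) : growth q phi -> tame q r (fun n => phi (low_part q r n)).
Proof.
  intros [C [p [HC H]]]. split.
  - intros a b k Hb. now rewrite low_part_local.
  - exists C, p. split; auto. intros n. eapply Rle_trans; [apply H|].
    apply Rmult_le_compat_l; auto. apply pow_incr.
    split; [pose proof (lenw_ge_1 q (low_part q r n)); lra|].
    apply lenw_mono; auto using low_part_le.
Qed.

Hypothesis Hr : (1 <= r)%nat.

(** Whether a block closes is decided by the digit just above the [r] lowest ones; for [1 <= k] this
    digit still lies below position [k + r]. *)
Lemma beta_local (phi : nat -> R) (a b k : nat) :
  (1 <= k)%nat -> (b < q ^ k)%nat -> beta q r phi (q ^ (k + r) * a + b) = beta q r phi b.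
Proof.
  intros Hk Hb. unfold beta. rewrite mod_append by lia. rewrite div_append by lia.
  replace (k + r - r)%nat with k by lia.
  pose proof (mod_append a (b / q ^ r) k 1 Hk) as Em. rewrite Nat.pow_1_r in Em.
  rewrite Em. destruct (Nat.eqb_spec (b mod q ^ r) 0) as [E|E]; [|reflexivity].
  destruct (Nat.eqb_spec ((b / q ^ r) mod q) 0) as [E'|E']; [reflexivity|]. cbn [negb andb].
  destruct (Nat.le_gt_cases r k) as [Hrk|Hrk].
  - f_equal. replace k with ((k - r) + r)%nat by lia. apply low_part_local.
    apply Nat.Div0.div_lt_upper_bound. rewrite <- Nat.pow_add_r. now replace (r + (k - r))%nat with k by lia.
  (* Here [b] has fewer than [r] digits, so the digit above its last [r] is a padding zero. *)
  - exfalso. apply E'. rewrite Nat.div_small; [apply Nat.Div0.mod_0_l|].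
    pose proof (Nat.pow_le_mono_r q k r). lia.
Qed.

Lemma pretame_beta (phi : nat -> R) : growth q phi -> pretame q r (beta q r phi).
Proof.
  intros Hphi d Hd. split.
  - intros a b k Hb.
    replace (q * (q ^ (k + r) * a + b) + d)%nat with (q ^ (S k + r) * a + (q * b + d))%nat
      by (cbn [Nat.add Nat.pow]; ring).
    apply beta_local; [lia|]. cbn [Nat.pow]. nia.
  - apply (growth_shift q Hq (beta q r phi)); [exact Hd|].
    destruct Hphi as [C [p [HC H]]]. exists C, p. split; auto. intros n. unfold beta.
    destruct (_ && _)%bool.
    + eapply Rle_trans; [apply H|]. apply Rmult_le_compat_l; auto. apply pow_incr.
      split; [pose proof (lenw_ge_1 q (low_part q r (n / q ^ r))); lra|].
      apply lenw_mono; auto. eapply Nat.le_trans; [apply low_part_le|].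
      apply Nat.Div0.div_le_upper_bound. pose proof (pow_q_pos q Hq r). nia.
    + rewrite Rabs_R0. apply Rmult_le_pos; auto. pose proof (lenw_pow_ge_1 q n p). lra.
Qed.

(** * Quasiadditive functions and the increment of the closed part *)

Variable f : nat -> R.
Hypothesis Hf : quasiadditive q r f.

Lemma quasiadditive_0 : f 0%nat = 0.
Proof.
  pose proof (Hf 0 0 0 ltac:(simpl; lia))%nat as H. rewrite Nat.mul_0_r in H. simpl in H. lra.
Qed.

Lemma quasiadditive_pow_r (a : nat) : f (q ^ r * a)%nat = f a.
Proof.
  pose proof (Hf a 0 0 ltac:(simpl; lia))%nat as H. rewrite quasiadditive_0, Nat.add_0_r in H.
  simpl in H. lra.
Qed.

(** The case [k = 0] at [q * a] and the case [k = 1] at [a] evaluate [f] at the same integer: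
    trailing zeros are invisible to [f]. *)
Lemma quasiadditive_mul_q (a : nat) : f (q * a)%nat = f a.
Proof.
  rewrite <- quasiadditive_pow_r.
  pose proof (Hf a 0 1 ltac:(simpl; lia))%nat as H. rewrite quasiadditive_0, Nat.add_0_r in H.
  replace (q ^ r * (q * a))%nat with (q ^ (1 + r) * a)%nat by (cbn [Nat.add Nat.pow]; ring). lra.
Qed.

Lemma quasiadditive_low_part (n : nat) :
  f n = f (n / q ^ (gap q r n + r))%nat + f (low_part q r n).
Proof.
  destruct (is_gap_gap n) as [G1 _]. pose proof (pow_q_pos q Hq (gap q r n)).
  rewrite <- Hf with (k := gap q r n) by (apply Nat.mod_upper_bound; lia).
  f_equal. rewrite Nat.pow_add_r, <- Nat.Div0.div_div, <- Nat.mul_assoc.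
  rewrite <- (proj2 (Nat.Div0.div_exact (n / q ^ gap q r n) (q ^ r))) by exact G1.
  apply Nat.div_mod_eq.
Qed.

Definition closed_part (n : nat) : R := f n - f (low_part q r n).

Lemma closed_part_eq (n : nat) : closed_part n = f (n / q ^ (gap q r n + r))%nat.
Proof. unfold closed_part. rewrite quasiadditive_low_part at 1. ring. Qed.

(** Three cases. Without [r] trailing zeros the lowest run merely moves up by one place. If the new
    zero prolongs a complete run, the digits above it gain at most a trailing zero, invisible to
    [f]. Otherwise a run has just been completed, and the block between it and the next run above is
    the one that [beta] credits. *)
Lemma closed_part_append (n d : nat) :
  (d < q)%nat -> closed_part (q * n + d) = closed_part n + beta q r f (q * n + d).
Proof.
  intros Hd. destruct (is_gap_gap n) as [G1 G2].
  assert (En : ((q * n + d) / q = n)%nat).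
  { rewrite (Nat.mul_comm q), Nat.div_add_l, Nat.div_small; lia. }
  unfold beta. destruct (Nat.eqb_spec ((q * n + d) mod q ^ r) 0) as [E|E].
  - set (m := ((q * n + d) / q ^ r)%nat).
    assert (Em : (q * n + d = q ^ r * m)%nat) by now apply Nat.Div0.div_exact.
    assert (Eq : (q ^ r = q * q ^ (r - 1))%nat).
    { replace r with (S (r - 1)) at 1 by lia. reflexivity. }
    assert (En' : n = (q ^ (r - 1) * m)%nat).
    { rewrite <- En, Em, Eq, <- Nat.mul_assoc, Nat.mul_comm. apply Nat.div_mul. lia. }
    assert (C0 : closed_part (q * n + d) = f m).
    { rewrite closed_part_eq. replace (gap q r (q * n + d)) with 0%nat; [reflexivity|].
      symmetry. apply gap_unique. split; [now rewrite Nat.pow_0_r, Nat.div_1_r|lia]. }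
    rewrite C0. destruct (Nat.eqb_spec (m mod q) 0) as [E'|E']; cbn [negb andb].
    (* The digit above the run is 0, so [n] itself already ends in a complete run. *)
    + apply Nat.Div0.mod_divides in E'. destruct E' as [m' E'].
      assert (En2 : n = (q ^ r * m')%nat) by (rewrite En', E', Eq; ring).
      rewrite closed_part_eq. replace (gap q r n) with 0%nat.
      * rewrite En2, Nat.add_0_l, Nat.mul_comm, Nat.div_mul by (pose proof (pow_q_pos q Hq r); lia).
        rewrite E', quasiadditive_mul_q. ring.
      * symmetry. apply gap_unique. split; [|lia].
        rewrite Nat.pow_0_r, Nat.div_1_r, En2, Nat.mul_comm. apply Nat.Div0.mod_mul.
    + assert (Hdiv : forall i, (n / q ^ (r - 1 + i) = m / q ^ i)%nat).
      { intros i. rewrite Nat.pow_add_r, <- Nat.Div0.div_div, En', (Nat.mul_comm _ m), Nat.div_mul; auto.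
        pose proof (pow_q_pos q Hq (r - 1)). lia. }
      destruct (is_gap_gap m) as [M1 M2].
      assert (Eg : gap q r n = (r - 1 + gap q r m)%nat).
      { apply gap_unique. split; [now rewrite Hdiv|].
        intros i Hi. destruct (Nat.le_gt_cases (r - 1) i) as [Hri|Hri].
        - replace i with (r - 1 + (i - (r - 1)))%nat by lia. rewrite Hdiv. apply M2. lia.
        (* A window of [n] that starts below [r - 1] contains the lowest digit of [m], which is not
           0. *)
        - intros Ei. apply E'. apply Nat.Div0.mod_divides in Ei. destruct Ei as [c Ec].
          pose proof (pow_q_pos q Hq i) as Pi. pose proof (pow_q_pos q Hq (r - 1 - i)) as Pi'.
          assert (Ed : (n / q ^ i = q ^ (r - 1 - i) * m)%nat).
          { rewrite En'. replace (r - 1)%nat with (i + (r - 1 - i))%nat at 1 by lia.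
            rewrite Nat.pow_add_r, <- Nat.mul_assoc, Nat.mul_comm. now apply Nat.div_mul; lia. }
          rewrite Ed in Ec.
          assert (Em' : m = (q * (q ^ i * c))%nat).
          { apply Nat.mul_cancel_l with (p := (q ^ (r - 1 - i))%nat); [lia|]. rewrite Ec.
            replace r with ((r - 1 - i) + S i)%nat at 1 by lia.
            rewrite Nat.pow_add_r. cbn [Nat.pow]. ring. }
          rewrite Em', Nat.mul_comm. apply Nat.Div0.mod_mul. }
      rewrite (closed_part_eq n), Eg, <- Nat.add_assoc, Hdiv.
      apply quasiadditive_low_part.
  - cbn [andb]. rewrite Rplus_0_r, !closed_part_eq. f_equal.
    replace (gap q r (q * n + d)) with (S (gap q r n)).
    + cbn [Nat.add]. now rewrite <- div_pow_S, En.
    + symmetry. apply gap_unique. split; [now rewrite <- div_pow_S, En|].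
      intros [|i] Hi; [now rewrite Nat.pow_0_r, Nat.div_1_r|].
      rewrite <- div_pow_S, En. apply G2. lia.
Qed.

End Gap.

(** * The martingale *)

(** Since [n] is below [q ^ qlen q n], its logarithm is at most linear in the length; [B] takes care
    of the finitely many [n <= N]. *)
Lemma log_growth_linear (q : nat) (f : nat -> R) :
  (2 <= q)%nat -> log_growth f -> exists C, 0 <= C /\ forall n, Rabs (f n) <= C * lenw q n.
Proof.
  intros Hq [C [N H]].
  assert (Hln : 0 < ln (INR q)) by (rewrite <- ln_1; apply ln_increasing; [lra|]; apply (lt_INR 1); lia).
  set (B := bsum (fun n => Rabs (f n)) (S N)).
  assert (HB : 0 <= B) by (apply bsum_nonneg; intros; apply Rabs_pos).
  exists (Rabs C * ln (INR q) + B). pose proof (Rabs_pos C) as PC.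
  assert (PCq : 0 <= Rabs C * ln (INR q)) by (apply Rmult_le_pos; lra).
  split; [lra|]. intros n.
  pose proof (lenw_ge_1 q n) as Hl.
  destruct (Nat.le_gt_cases n N) as [Hn|Hn].
  - apply Rle_trans with (B * 1).
    + rewrite Rmult_1_r.
      apply (bsum_ge_term (fun n => Rabs (f n))); [lia|]. intros; apply Rabs_pos.
    + apply Rmult_le_compat; lra.
  - assert (Hn0 : 0 < INR n) by (apply lt_0_INR; lia).
    assert (Hlen : ln (INR n) <= lenw q n * ln (INR q)).
    { pose proof (lt_pow_qlen q Hq n) as Hlt. apply lt_INR in Hlt. rewrite pow_INR in Hlt.
      apply ln_increasing in Hlt; auto. rewrite ln_pow in Hlt by (apply INR_q_pos; auto).
      unfold lenw. lra. }
    assert (Hln0 : 0 <= ln (INR n)).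
    { rewrite <- ln_1. apply ln_le; [lra|]. apply (le_INR 1). lia. }
    eapply Rle_trans; [apply H; lia|].
    apply Rle_trans with (Rabs C * ln (INR n)).
    + apply Rmult_le_compat_r; auto. apply Rle_abs.
    + apply Rle_trans with (Rabs C * (lenw q n * ln (INR q))); [now apply Rmult_le_compat_l|].
      assert (0 <= B * lenw q n) by (apply Rmult_le_pos; lra). lra.
Qed.

Lemma linear_growth (q : nat) (f : nat -> R) :
  (exists C, 0 <= C /\ forall n, Rabs (f n) <= C * lenw q n) -> growth q f.
Proof. intros [C [HC H]]. exists C, 1%nat. split; auto. intros n. rewrite pow_1. auto. Qed.

Section Martingale.

Variables q r : nat.
Hypothesis Hq : (2 <= q)%nat.
Hypothesis Hr : (1 <= r)%nat.
Variable f : nat -> R.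
Hypothesis Hf : quasiadditive q r f.
Hypothesis Hg : growth q f.

(* [martingale n - mu0 * l] is a martingale when random digits are appended to [n], [l] of them
   so far; [W1] corrects the drift of the completed blocks, [W2] that of the conditional variance. *)
Definition mu0 : R := mean q (beta q r f).
Definition W1 : nat -> R := corrector q (avg q (beta q r f)).
Definition martingale (n : nat) : R := closed_part q r f n + W1 n.
Definition jump (d n : nat) : R := martingale (q * n + d) - martingale n - mu0.
Definition condvar (n : nat) : R := bsum (fun d => jump d n ^ 2) q / INR q.
Definition var0 : R := mean q condvar.
Definition W2 : nat -> R := corrector q condvar.

Let beta_pretame : pretame q r (beta q r f).
Proof. now apply pretame_beta. Qed.

Lemma tame_W1 : tame q r W1.
Proof.
  destruct (avoid_decay q r Hq Hr) as [th [Hth Hd]].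
  apply (corrector_tame q r Hq th Hth Hd). now apply pretame_avg.
Qed.

Lemma avg_W1 (n : nat) : avg q W1 n = W1 n - (avg q (beta q r f) n - mu0).
Proof.
  destruct (avoid_decay q r Hq Hr) as [th [Hth Hd]].
  unfold W1. rewrite (corrector_poisson q r Hq th Hth Hd) by now apply pretame_avg.
  unfold mu0. now rewrite (mean_avg q r Hq th Hth Hd).
Qed.

Lemma jump_eq (d n : nat) :
  (d < q)%nat -> jump d n = beta q r f (q * n + d) - mu0 + W1 (q * n + d)%nat - W1 n.
Proof. intros Hd. unfold jump, martingale. rewrite (closed_part_append q r Hq Hr f Hf) by exact Hd. ring. Qed.

Lemma tame_jump (d : nat) : (d < q)%nat -> tame q r (jump d).
Proof.
  intros Hd. eapply tame_ext; [intros n; symmetry; now apply jump_eq|].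
  apply tame_minus; [|exact tame_W1]. apply (tame_plus q r (fun n => beta q r f (q * n + d) - mu0)).
  - apply (tame_minus q r (fun n => beta q r f (q * n + d))); [now apply beta_pretame|apply tame_const].
  - apply tame_shift; auto. exact tame_W1.
Qed.

Lemma bsum_jump (n : nat) : bsum (fun d => jump d n) q = 0.
Proof.
  rewrite (bsum_ext _ (fun d => beta q r f (q * n + d) - mu0 + W1 (q * n + d)%nat - W1 n))
    by (intros; now apply jump_eq).
  rewrite bsum_minus, bsum_plus, bsum_minus, !bsum_const.
  pose proof (avg_W1 n) as H. unfold avg in H. pose proof (INR_q_pos q Hq) as Pq.
  apply (f_equal (Rmult (INR q))) in H.
  replace (INR q * (bsum (fun d => W1 (q * n + d)%nat) q / INR q)) with (bsum (fun d => W1 (q * n + d)%nat) q) in H by (field; lra).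
  replace (INR q * (W1 n - (bsum (fun d => beta q r f (q * n + d)) q / INR q - mu0)))
    with (INR q * W1 n - bsum (fun d => beta q r f (q * n + d)) q + INR q * mu0) in H by (field; lra).
  lra.
Qed.

Lemma tame_condvar : tame q r condvar.
Proof.
  apply tame_mult; [|apply tame_const]. apply tame_bsum. intros d Hd.
  apply (tame_mult q r (jump d)); [now apply tame_jump|].
  apply (tame_mult q r (jump d)); [now apply tame_jump|apply tame_const].
Qed.

Lemma condvar_nonneg (n : nat) : 0 <= condvar n.
Proof.
  apply Rdiv_le_0_compat; [|apply INR_q_pos; auto]. apply bsum_nonneg. intros; apply pow2_ge_0.
Qed.

Lemma tame_W2 : tame q r W2.
Proof.
  destruct (avoid_decay q r Hq Hr) as [th [Hth Hd]].
  apply (corrector_tame q r Hq th Hth Hd). exact tame_condvar.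
Qed.

Lemma avg_W2 (n : nat) : avg q W2 n = W2 n - (condvar n - var0).
Proof.
  destruct (avoid_decay q r Hq Hr) as [th [Hth Hd]].
  apply (corrector_poisson q r Hq th Hth Hd). exact tame_condvar.
Qed.

Lemma beta_W1 (m : nat) : beta q r f m * W1 m = W1 0%nat * beta q r f m.
Proof.
  unfold beta. destruct (Nat.eqb_spec (m mod q ^ r) 0) as [E|E]; cbn [andb]; [|ring].
  rewrite Rmult_comm. f_equal.
  apply (proj2 (Nat.Div0.div_exact m (q ^ r))) in E. rewrite E.
  pose proof (proj1 tame_W1 (m / q ^ r) 0 0)%nat as H. rewrite Nat.add_0_r in H.
  apply H. simpl; lia.
Qed.

(** The jump is [b - mu0 + W1] at the new point minus [W1] at the old one, and the former averages
    to the latter. Hence [condvar] is the average of a square minus [W1 ^ 2]; in the mean the two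
    copies of [W1 ^ 2] cancel, and [W1] has mean 0. *)
Lemma var0_eq :
  var0 = mean q (fun n => beta q r f n ^ 2) - mu0 ^ 2 + 2 * mu0 * W1 0%nat.
Proof.
  destruct (avoid_decay q r Hq Hr) as [th [Hth Hd]].
  set (b := beta q r f). set (w0 := W1 0%nat).
  (* [K2] is the square of [b - mu0 + W1] with the product [b * W1] replaced by [w0 * b], so that
     every remaining mean is known or cancels. *)
  set (K2 := fun n => b n ^ 2 + ((2 * w0 - 2 * mu0) * b n + (mu0 ^ 2 + (W1 n * W1 n + (- 2 * mu0) * W1 n)))).
  assert (PW : pretame q r W1) by (apply tame_pretame; auto; exact tame_W1).
  assert (Pc : forall c, pretame q r (fun _ => c)) by (intros c; apply tame_pretame; auto; apply tame_const).
  assert (PWW : pretame q r (fun n => W1 n * W1 n)) by now apply pretame_mult.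
  assert (Psc : forall (c : R) g, pretame q r g -> pretame q r (fun n => c * g n)).
  { intros c g Hg'. apply (pretame_mult q r (fun _ => c)); auto. }
  assert (Pb2 : pretame q r (fun n => b n ^ 2)).
  { apply (pretame_mult q r b); [exact beta_pretame|]. apply (pretame_mult q r b); [exact beta_pretame|auto]. }
  assert (P1 : pretame q r (fun n => W1 n * W1 n + (-2 * mu0) * W1 n)) by (apply pretame_plus; auto).
  assert (P2 : pretame q r (fun n => mu0 ^ 2 + (W1 n * W1 n + (-2 * mu0) * W1 n)))
    by (apply (pretame_plus q r (fun _ => mu0 ^ 2)); auto).
  assert (P3 : pretame q r (fun n => (2 * w0 - 2 * mu0) * b n + (mu0 ^ 2 + (W1 n * W1 n + (-2 * mu0) * W1 n)))).
  { apply pretame_plus; auto. }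
  assert (PK : pretame q r K2) by (apply pretame_plus; auto).
  assert (E : forall n, condvar n = avg q K2 n + (-1) * (W1 n * W1 n)).
  { intros n.
    rewrite <- (avg_const q Hq (-1 * (W1 n * W1 n)) n), <- avg_plus.
    assert (E1 : avg q (fun m => b m - mu0 + W1 m) n = W1 n).
    { rewrite avg_plus, avg_minus, avg_const by auto. rewrite avg_W1. fold b. ring. }
    unfold condvar. transitivity (avg q (fun m => (b m - mu0 + W1 m - W1 n) ^ 2) n).
    - unfold avg. f_equal. apply bsum_ext. intros d Hd'. now rewrite jump_eq.
    - transitivity (avg q (fun m => (K2 m + W1 n * W1 n) + (- 2 * W1 n) * (b m - mu0 + W1 m)) n).
      + apply avg_ext. intros m. unfold K2.
        replace ((2 * w0 - 2 * mu0) * b m) with (2 * (w0 * b m) - 2 * mu0 * b m) by ring.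
        unfold w0, b at 3. rewrite <- beta_W1. fold b. ring.
      + rewrite avg_plus, avg_scal, E1, !avg_plus, !avg_const by auto. ring. }
  unfold var0. rewrite (mean_ext q _ _ E).
  rewrite (mean_plus q r Hq th Hth Hd);
    [|apply tame_pretame; auto; now apply pretame_avg|apply Psc; exact PWW].
  rewrite (mean_avg q r Hq th Hth Hd), (mean_scal q r Hq th Hth Hd) by auto.
  unfold K2.
  rewrite (mean_plus q r Hq th Hth Hd) by auto.
  rewrite (mean_plus q r Hq th Hth Hd) by auto.
  rewrite (mean_plus q r Hq th Hth Hd (fun _ => mu0 ^ 2)) by auto.
  rewrite (mean_plus q r Hq th Hth Hd (fun n => W1 n * W1 n)) by auto.
  rewrite !(mean_scal q r Hq th Hth Hd) by auto. rewrite mean_const by auto.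
  assert (M0 : mean q W1 = 0).
  { apply (mean_corrector q r Hq th Hth Hd). now apply pretame_avg. }
  rewrite M0. unfold b at 2. fold mu0. ring.
Qed.

Lemma var0_pos : (exists n, f n <> 0) -> 0 < var0.
Proof.
  intros [n0 Hn0]. destruct (avoid_decay q r Hq Hr) as [th [Hth Hd]].
  destruct (Rlt_le_dec 0 var0) as [H|H]; auto. exfalso. apply Hn0.
  assert (HV : forall n, condvar n = 0).
  { intros n. apply Rle_antisym; [|apply condvar_nonneg].
    set (k := (qlen q n + r)%nat). pose proof (INR_pow_pos q Hq k) as Pk.
    (* From every [m], appending [r] zeros and then the digits of [n] has probability [/ q ^ k] and,
       by locality, restores the value at [n]. A positive [condvar n] would therefore force a
       positive mean. *)
    assert (Hlow : forall m, condvar n / INR q ^ k <= avgn q k condvar m).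
    { intros m. rewrite avgn_explicit by exact Hq. unfold Rdiv. apply Rmult_le_compat_r;
        [apply Rlt_le, Rinv_0_lt_compat; lra|].
      pose proof (lt_pow_qlen q Hq n) as Hn.
      rewrite <- (proj1 tame_condvar m n (qlen q n) Hn). fold k.
      apply (bsum_ge_term (fun u => condvar (q ^ k * m + u)%nat)); [|intros; apply condvar_nonneg].
      eapply Nat.lt_le_trans; [exact Hn|]. apply Nat.pow_le_mono_r; lia. }
    assert (Hle : condvar n / INR q ^ k <= var0).
    { apply (is_lim_seq_le (fun _ => condvar n / INR q ^ k) (fun j => avgn q (j + k) condvar 0%nat)
        (condvar n / INR q ^ k) var0).
      - intros j. rewrite avgn_add. rewrite <- (avgn_const q Hq j (condvar n / INR q ^ k) 0).
        now apply avgn_le.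
      - apply is_lim_seq_const.
      - apply (is_lim_seq_incr_n (fun j => avgn q j condvar 0%nat)).
        apply (tame_lim q r Hq th Hth Hd). exact tame_condvar. }
    replace (condvar n) with (condvar n / INR q ^ k * INR q ^ k) by (field; lra).
    nra. }
  assert (Hincr : forall d n, (d < q)%nat -> jump d n = 0).
  { intros d n Hd'. specialize (HV n). unfold condvar in HV.
    pose proof (INR_q_pos q Hq) as Pq.
    assert (Hs : bsum (fun d => jump d n ^ 2) q = 0).
    { replace (bsum (fun d => jump d n ^ 2) q) with (bsum (fun d => jump d n ^ 2) q / INR q * INR q) by (field; lra).
      rewrite HV. ring. }
    pose proof (bsum_ge_term (fun d => jump d n ^ 2) q d Hd' (fun i _ => pow2_ge_0 _)) as Hp.
    cbv beta in Hp. rewrite Hs in Hp. apply Rsqr_0_uniq. unfold Rsqr.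
    pose proof (pow2_ge_0 (jump d n)). lra. }
  (* Appending the digit 0 to 0 changes nothing, so this jump is [- mu0]. *)
  assert (Hmu : mu0 = 0).
  { pose proof (Hincr 0%nat 0%nat ltac:(lia)) as H0. unfold jump in H0.
    rewrite Nat.mul_0_r in H0. simpl in H0. lra. }
  assert (HG : forall n, martingale n = martingale 0%nat).
  { intros n. induction n as [n IH] using lt_wf_ind. destruct (Nat.eq_dec n 0) as [->|Hn]; auto.
    rewrite <- (IH (n / q)%nat) by (apply Nat.div_lt; lia).
    pose proof (Hincr (n mod q) (n / q)%nat ltac:(apply Nat.mod_upper_bound; lia)) as Hi.
    unfold jump in Hi. rewrite <- Nat.div_mod_eq in Hi. lra. }
  (* At [q ^ r * n] the local functions [W1] and [low_part] take their values at 0, while [f] still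
     has the value [f n]. So [f] is constant. *)
  assert (Hfr : forall n, f n = martingale 0%nat - W1 0%nat + f (low_part q r 0)).
  { intros n. rewrite <- (quasiadditive_pow_r q r Hq Hr f Hf n).
    pose proof (proj1 tame_W1 n 0%nat 0%nat ltac:(simpl; lia)) as HW.
    pose proof (low_part_local q r Hq n 0 0 ltac:(simpl; lia)) as HT.
    rewrite Nat.add_0_r in HW, HT. simpl in HW, HT.
    pose proof (HG (q ^ r * n)%nat) as E. unfold martingale at 1, closed_part in E. rewrite HW, HT in E. lra. }
  rewrite Hfr, <- (Hfr 0%nat). apply (quasiadditive_0 q r Hq Hr f Hf).
Qed.

End Martingale.

(** * Blocks *)

(* For [b < q ^ l], the test for membership of [b] in the set B of the theorem with length [l]. *)
Definition blockb (q r l b : nat) : bool :=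
  (Nat.eqb (gap q r b) l && negb (Nat.eqb (b mod q) 0))%bool.

(** The coefficient of [x ^ l] when [phi] is summed over B with weight [x] to the length; for
    [phi = f] it belongs to the t-derivative of [Bhat] at t = 0. *)
Definition block_sum (q r : nat) (phi : nat -> R) (l : nat) : R :=
  bsum (fun b => if blockb q r l b then phi b else 0) (q ^ l).

Lemma bsum_restrict (h : nat -> R) (m n : nat) :
  (m <= n)%nat -> bsum (fun i => if Nat.ltb i m then h i else 0) n = bsum h m.
Proof.
  intros Hmn. replace n with (m + (n - m))%nat by lia. rewrite bsum_add.
  rewrite (bsum_zero (fun i => if Nat.ltb (m + i) m then h (m + i)%nat else 0)).
  - rewrite Rplus_0_r. apply bsum_ext. intros i Hi. destruct (Nat.ltb_spec i m); [reflexivity|lia].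
  - intros i _. destruct (Nat.ltb_spec (m + i) m); [lia|reflexivity].
Qed.

Lemma bsum_tail_vanishes (z : nat -> R) (m : nat) :
  ex_series z -> is_lim_seq (fun n => bsum z (n + m) - bsum z n) 0.
Proof.
  intros [l Hl]. apply is_series_bsum in Hl.
  replace (Finite 0) with (Finite (l - l)) by (f_equal; ring).
  apply is_lim_seq_minus'; auto. now apply (is_lim_seq_incr_n (bsum z)).
Qed.

(** Dominated convergence in a special form: the weights [y n] differ from their limit only at the
    last [m] indices, and there [z] bounds the error by a vanishing piece of a convergent series. *)
Lemma bsum_eventually_constant_weights (x z : nat -> R) (y : nat -> nat -> R) (y' : nat -> R) (m : nat) (l : R) :
  ex_series z -> is_series (fun i => x i * y' i) l ->
  (forall n i, (i < n)%nat -> Rabs (x i * (y n i - y' i)) <= z i) ->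
  (forall n i, (i + m <= n)%nat -> y n i = y' i) ->
  is_lim_seq (fun n => bsum (fun i => x i * y n i) n) l.
Proof.
  intros Hz Hl Hb He. apply is_series_bsum in Hl. apply (is_lim_seq_incr_n _ m).
  apply is_lim_seq_ext with (fun n => bsum (fun i => x i * y' i) (n + m)
    + bsum (fun i => x i * (y (n + m)%nat i - y' i)) (n + m)).
  - intros n. rewrite <- bsum_plus. apply bsum_ext. intros; ring.
  - replace (Finite l) with (Finite (l + 0)) by (f_equal; ring).
    apply is_lim_seq_plus'; [now apply (is_lim_seq_incr_n (bsum (fun i => x i * y' i)))|].
    apply is_lim_seq_squeeze_0 with (fun n => bsum z (n + m) - bsum z n); [|now apply bsum_tail_vanishes].
    intros n. eapply Rle_trans; [apply bsum_Rabs|].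
    rewrite !bsum_add.
    rewrite (bsum_zero (fun i => Rabs (x i * (y (n + m)%nat i - y' i))) n).
    + replace (bsum z n + bsum (fun i => z (n + i)%nat) m - bsum z n)
        with (0 + bsum (fun i => z (n + i)%nat) m) by ring.
      apply Rplus_le_compat_l, bsum_le. intros i Hi. apply Hb. lia.
    + intros i Hi. rewrite He by lia. rewrite Rminus_diag, Rmult_0_r. apply Rabs_R0.
Qed.

Section Blocks.

Variables q r : nat.
Hypothesis Hq : (2 <= q)%nat.
Hypothesis Hr : (1 <= r)%nat.

Lemma blockb_0 (b : nat) : (b < q ^ 0)%nat -> blockb q r 0 b = false.
Proof.
  intros Hb. replace b with 0%nat by (simpl in Hb; lia). unfold blockb.
  rewrite Nat.Div0.mod_0_l. apply Bool.andb_false_r.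
Qed.

Lemma block_sum_0 (phi : nat -> R) : block_sum q r phi 0 = 0.
Proof. apply bsum_zero. intros b Hb. now rewrite blockb_0. Qed.

Lemma gap_mul_add (l a b : nat) :
  (b < q ^ l)%nat ->
  (gap q r (q ^ l * a + b) = l <-> (a mod q ^ r = 0)%nat /\ gap q r b = l).
Proof.
  intros Hb.
  assert (Ed : ((q ^ l * a + b) / q ^ l = a)%nat).
  { rewrite Nat.mul_comm, Nat.div_add_l, Nat.div_small; lia. }
  assert (E : (a mod q ^ r = 0)%nat -> forall i, (i <= l)%nat ->
    (((q ^ l * a + b) / q ^ i) mod q ^ r = (b / q ^ i) mod q ^ r)%nat).
  { intros Ha i Hi. rewrite (div_append q Hq) by exact Hi.
    apply Nat.Div0.mod_divides in Ha. destruct Ha as [c ->].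
    replace (q ^ (l - i) * (q ^ r * c))%nat with (q ^ r * (q ^ (l - i) * c))%nat by ring.
    now apply mod_append. }
  split.
  - intros Hg. destruct (is_gap_gap q r Hq (q ^ l * a + b)) as [G1 G2]. rewrite Hg in G1, G2.
    rewrite Ed in G1. split; auto. apply gap_unique; auto. split.
    + rewrite <- E by auto. now rewrite Ed.
    + intros i Hi. rewrite <- E by (auto; lia). auto.
  - intros [Ha Hg]. destruct (is_gap_gap q r Hq b) as [G1 G2]. rewrite Hg in G1, G2.
    apply gap_unique; auto. split.
    + rewrite E by auto. auto.
    + intros i Hi. rewrite E by (auto; lia). auto.
Qed.

(** For [s < r] only [a = 0] counts, in accordance with the truncated exponent [s - r = 0]. *)
Lemma count_multiples (s : nat) :
  bsum (fun a => if Nat.eqb (a mod q ^ r) 0 then 1 else 0) (q ^ s) = INR q ^ (s - r).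
Proof.
  pose proof (pow_q_pos q Hq r) as Pr.
  assert (D : forall n, bsum (fun a => if Nat.eqb a 0 then 1 else 0) n = if Nat.ltb 0 n then 1 else 0)
    by (intros; apply bsum_delta).
  destruct (Nat.le_gt_cases r s) as [H|H].
  - replace s with ((s - r) + r)%nat at 1 by lia. rewrite Nat.pow_add_r, bsum_mul.
    rewrite (bsum_ext _ (fun _ => 1)).
    + rewrite bsum_const, pow_INR. ring.
    + intros i _. rewrite (bsum_ext _ (fun c => if Nat.eqb c 0 then 1 else 0)).
      * rewrite D. destruct (Nat.ltb_spec 0 (q ^ r)); [reflexivity|lia].
      * intros c Hc. rewrite Nat.add_comm, (Nat.mul_comm (q ^ r)), Nat.Div0.mod_add, Nat.mod_small; auto.
  - rewrite (bsum_ext _ (fun c => if Nat.eqb c 0 then 1 else 0)).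
    + rewrite D. pose proof (pow_q_pos q Hq s). destruct (Nat.ltb_spec 0 (q ^ s)); [|lia].
      replace (s - r)%nat with 0%nat by lia. reflexivity.
    + intros c Hc. rewrite Nat.mod_small; auto.
      pose proof (Nat.pow_le_mono_r q s r). lia.
Qed.

(** Sort [m] by its gap [l] and write it as [q ^ l * a + b]: then [b] runs over the blocks of length
    [l] and [a] over multiples of [q ^ r], counted by [count_multiples]. Gap 0 contributes nothing
    because the last digit would be 0. *)
Lemma low_part_sum (phi : nat -> R) (i : nat) :
  bsum (fun m => if Nat.eqb (m mod q) 0 then 0 else phi (low_part q r m)) (q ^ i)
  = bsum (fun l => INR q ^ (i - l - r) * block_sum q r phi l) (S i).
Proof.
  set (term := fun m => if Nat.eqb (m mod q) 0 then 0 else phi (low_part q r m)).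
  transitivity (bsum (fun m => bsum (fun l => if Nat.eqb l (gap q r m) then term m else 0) (S i)) (q ^ i)).
  - apply bsum_ext. intros m Hm. rewrite bsum_delta.
    assert (gap q r m <= i)%nat.
    { apply gap_le; auto. rewrite Nat.div_small by exact Hm. apply Nat.Div0.mod_0_l. }
    destruct (Nat.ltb_spec (gap q r m) (S i)); [reflexivity|lia].
  - rewrite bsum_swap. apply bsum_ext. intros l Hl.
    replace (i - l - r)%nat with ((i - l) - r)%nat by lia.
    rewrite <- count_multiples. replace i with ((i - l) + l)%nat at 1 by lia.
    rewrite Nat.pow_add_r, bsum_mul, Rmult_comm, <- bsum_scal.
    apply bsum_ext. intros a _.
    transitivity (bsum (fun b => (if Nat.eqb (a mod q ^ r) 0 then 1 else 0) * (if blockb q r l b then phi b else 0)) (q ^ l)).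
    2:{ rewrite bsum_scal. apply Rmult_comm. }
    apply bsum_ext. intros b Hb. pose proof (gap_mul_add l a b Hb) as Hgap.
    destruct l as [|l].
    + rewrite blockb_0 by exact Hb. rewrite Rmult_0_r.
      destruct (Nat.eqb_spec 0 (gap q r (q ^ 0 * a + b))) as [E|]; auto.
      symmetry in E. apply Hgap in E. destruct E as [E _].
      unfold term. replace ((q ^ 0 * a + b) mod q)%nat with 0%nat; [reflexivity|].
      replace b with 0%nat by (simpl in Hb; lia). simpl. rewrite !Nat.add_0_r.
      apply Nat.Div0.mod_divides in E. destruct E as [c ->].
      destruct r as [|r']; [lia|]. cbn [Nat.pow].
      replace (q * q ^ r' * c)%nat with (q ^ r' * c * q)%nat by ring. symmetry. apply Nat.Div0.mod_mul.
    + assert (Em : ((q ^ S l * a + b) mod q = b mod q)%nat).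
      { pose proof (mod_append q Hq a b (S l) 1 ltac:(lia)) as Em. now rewrite Nat.pow_1_r in Em. }
      unfold blockb.
      destruct (Nat.eqb_spec (S l) (gap q r (q ^ S l * a + b))) as [E|E].
      * symmetry in E. pose proof E as E'. apply Hgap in E'. destruct E' as [E1 E2].
        rewrite E1, E2, !Nat.eqb_refl. cbn [andb]. unfold term. rewrite Em.
        unfold low_part. rewrite E.
        replace ((q ^ S l * a + b) mod q ^ S l)%nat with b.
        -- destruct (Nat.eqb (b mod q) 0); cbn [negb]; ring.
        -- rewrite (mod_append q Hq a b (S l) (S l)) by lia. now rewrite Nat.mod_small.
      * destruct (Nat.eqb_spec (a mod q ^ r) 0) as [E1|E1]; [|ring].
        destruct (Nat.eqb_spec (gap q r b) (S l)) as [E2|E2]; [|cbn [andb]; ring].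
        exfalso. apply E. symmetry. now apply Hgap.
Qed.

(** Only multiples of [q ^ r] contribute; removing their trailing run leaves [low_part_sum] with
    [j - r] digits. For [j < r] both sides vanish. *)
Lemma avgn_beta (phi : nat -> R) (j : nat) :
  avgn q j (beta q r phi) 0
  = bsum (fun l => INR q ^ (j - r - l - r) * block_sum q r phi l) (S (j - r)) / INR q ^ j.
Proof.
  rewrite avgn_explicit by exact Hq. f_equal. pose proof (pow_q_pos q Hq r) as Pr.
  rewrite (bsum_ext _ (beta q r phi)) by (intros; f_equal; lia).
  destruct (Nat.le_gt_cases r j) as [H|H].
  - rewrite <- low_part_sum.
    replace j with ((j - r) + r)%nat at 1 by lia. rewrite Nat.pow_add_r, bsum_mul.
    apply bsum_ext. intros i _.
    set (t := if Nat.eqb (i mod q) 0 then 0 else phi (low_part q r i)).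
    rewrite (bsum_ext _ (fun c => if Nat.eqb c 0 then t else 0)).
    + rewrite bsum_delta. destruct (Nat.ltb_spec 0 (q ^ r)); [reflexivity|lia].
    + intros c Hc. unfold beta. rewrite (Nat.mul_comm (q ^ r)), Nat.div_add_l by lia.
      rewrite Nat.add_comm, Nat.Div0.mod_add, Nat.div_small, Nat.mod_small, Nat.add_0_r by lia.
      unfold t. destruct (Nat.eqb c 0), (Nat.eqb (i mod q) 0); reflexivity.
  - replace (j - r)%nat with 0%nat by lia. simpl bsum. rewrite block_sum_0.
    rewrite bsum_zero; [ring|]. intros u Hu.
    assert (Hu' : (u < q ^ r)%nat) by (pose proof (Nat.pow_le_mono_r q j r); lia).
    unfold beta. rewrite (Nat.div_small u) by exact Hu'. rewrite Nat.Div0.mod_0_l.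
    now rewrite Bool.andb_false_r.
Qed.

(** The term of index [l] in the power series with coefficients [block_sum], taken at x = 1/q. *)
Definition bweight (phi : nat -> R) (l : nat) : R := block_sum q r phi l / INR q ^ l.

(* Among [l + k] random digits, a given block of length [l] is the one completed by the last
   digit with probability [gam k / q ^ l]: there are [r] zeros below it, and [r] zeros above
   it or only zeros if fewer digits remain. *)
Definition gam (k : nat) : R :=
  if Nat.ltb k r then 0 else / INR q ^ (Nat.min k (2 * r)).

Lemma avgn_beta_convolution (phi : nat -> R) (j : nat) :
  avgn q j (beta q r phi) 0 = bsum (fun l => bweight phi l * gam (j - l)) (S j).
Proof.
  rewrite avgn_beta. unfold Rdiv. rewrite Rmult_comm, <- bsum_scal.
  rewrite <- (bsum_restrict _ (S (j - r)) (S j)) by lia.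
  apply bsum_ext. intros l Hl. unfold gam, bweight.
  pose proof (INR_pow_pos q Hq) as Pp.
  destruct (Nat.ltb_spec l (S (j - r))) as [H1|H1]; destruct (Nat.ltb_spec (j - l) r) as [H2|H2]; try lia.
  (* This case is produced by truncated subtraction: it means [j < r], and only [l = 0] is left. *)
  - assert (l = 0)%nat by lia. subst l. rewrite block_sum_0. unfold Rdiv. ring.
  - destruct (Nat.le_gt_cases (2 * r) (j - l)) as [H3|H3].
    + rewrite Nat.min_r by lia. replace j with (l + 2 * r + (j - r - l - r))%nat at 1 by lia.
      rewrite !pow_add. field. repeat split; apply Rgt_not_eq, Pp.
    + rewrite Nat.min_l by lia. replace (j - r - l - r)%nat with 0%nat by lia.
      replace j with (l + (j - l))%nat at 1 by lia.
      rewrite pow_add. simpl. field. split; apply Rgt_not_eq, Pp.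
  - ring.
Qed.

End Blocks.

(** * Limits of the block convolutions *)

Lemma bsum_S_l (h : nat -> R) (n : nat) : bsum h (S n) = h 0%nat + bsum (fun i => h (S i)) n.
Proof. change (S n) with (1 + n)%nat. rewrite bsum_add. simpl. ring. Qed.

(** Interchange of summation over a triangle; in [W1_0] it replaces the weights [gam] by their
    partial sums. *)
Lemma bsum_convolution (F : nat -> nat -> R) (n : nat) :
  bsum (fun j => bsum (fun l => F l (j - l)%nat) (S j)) n = bsum (fun l => bsum (F l) (n - l)) n.
Proof.
  induction n as [|n IH]; [reflexivity|].
  change (bsum (fun j => bsum (fun l => F l (j - l)%nat) (S j)) (S n))
    with (bsum (fun j => bsum (fun l => F l (j - l)%nat) (S j)) n
      + (bsum (fun l => F l (n - l)%nat) n + F n (n - n)%nat)).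
  change (bsum (fun l => bsum (F l) (S n - l)) (S n))
    with (bsum (fun l => bsum (F l) (S n - l)) n + bsum (F n) (S n - n)).
  rewrite IH. replace (S n - n)%nat with 1%nat by lia. rewrite Nat.sub_diag. simpl (bsum (F n) 1).
  rewrite (bsum_ext (fun l => bsum (F l) (S n - l)) (fun l => bsum (F l) (n - l) + F l (n - l)%nat)).
  - rewrite bsum_plus. ring.
  - intros l Hl. replace (S n - l)%nat with (S (n - l)) by lia. reflexivity.
Qed.

Lemma geometric_weight_lim (C th : R) :
  0 < th < 1 -> is_lim_seq (fun n => INR n * (C * th ^ n)) 0.
Proof.
  intros Hth. set (s := (1 + th) / 2).
  destruct (pow_absorbed 1 (s / th)) as [C' [HC' H]]; [unfold s; apply Rlt_div_r; lra|].
  apply is_lim_seq_geometric_0 with (Rabs C * C') s; [unfold s; lra|].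
  intros n. specialize (H n). rewrite pow_1 in H.
  pose proof (pos_INR n). assert (Pt : 0 < th ^ n) by (apply pow_lt; lra).
  rewrite !Rabs_mult, (Rabs_pos_eq (INR n)), (Rabs_pos_eq (th ^ n)) by lra.
  replace (s ^ n) with ((s / th) ^ n * th ^ n) by (rewrite <- Rpow_mult_distr; f_equal; field; lra).
  pose proof (Rabs_pos C).
  replace (INR n * (Rabs C * th ^ n)) with (Rabs C * (INR n * th ^ n)) by ring.
  rewrite Rmult_assoc, <- (Rmult_assoc C'). apply Rmult_le_compat_l; auto.
  apply Rmult_le_compat_r; lra.
Qed.

Lemma bsum_geometric (x : R) (n : nat) : (1 - x) * bsum (fun i => x ^ i) n = 1 - x ^ n.
Proof. induction n as [|n IH]; simpl; [ring|]. rewrite Rmult_plus_distr_l, IH. ring. Qed.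

Section BlockMeans.

Variables q r : nat.
Hypothesis Hq : (2 <= q)%nat.
Hypothesis Hr : (1 <= r)%nat.

Lemma blockb_avoidb (l b : nat) : blockb q r l b = true -> avoidb q r l b = true.
Proof.
  unfold blockb. intros H. apply andb_prop in H. destruct H as [H _]. apply Nat.eqb_eq in H.
  apply avoidb_spec. intros k Hk. apply (is_gap_gap q r Hq b). lia.
Qed.

Lemma lenw_le (l b : nat) : (b < q ^ l)%nat -> lenw q b <= 1 + INR l.
Proof. intros Hb. apply Rplus_le_compat_l, le_INR. now apply qlen_le_iff. Qed.

Lemma block_sum_bound (phi : nat -> R) (C : R) (l : nat) :
  (forall b, (b < q ^ l)%nat -> Rabs (phi b) <= C) ->
  Rabs (block_sum q r phi l) <= C * (pavoid q r l * INR q ^ l).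
Proof.
  intros H. pose proof (INR_pow_pos q Hq l). unfold block_sum, pavoid, Rdiv.
  rewrite Rmult_assoc, Rinv_l, Rmult_1_r by lra.
  eapply Rle_trans; [apply bsum_Rabs|]. rewrite <- bsum_scal. apply bsum_le.
  intros b Hb. destruct (blockb q r l b) eqn:E.
  - rewrite (blockb_avoidb l b E), Rmult_1_r. auto.
  - rewrite Rabs_R0. apply Rmult_le_pos.
    + eapply Rle_trans; [apply Rabs_pos|apply (H b Hb)].
    + destruct avoidb; lra.
Qed.

(** A block contains no run of [r] zeros, so [block_sum] inherits the decay of [pavoid]. The extra
    factor [1 + INR l] also yields the first moment that enters the mixed derivative. *)
Lemma bweight_decay (phi : nat -> R) :
  growth q phi -> exists th C, 0 < th < 1 /\ 0 <= C /\
    forall l, (1 + INR l) * Rabs (bweight q r phi l) <= C * th ^ l.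
Proof.
  intros [C [p [HC H]]]. destruct (avoid_decay q r Hq Hr) as [th [Hth Hd]].
  destruct (Hd (S p)) as [C' [HC' Hd']].
  exists th, (C * C'). split; auto. split; [apply Rmult_le_pos; lra|]. intros l.
  pose proof (INR_pow_pos q Hq l) as Pl. pose proof (pos_INR l).
  unfold bweight, Rdiv. rewrite Rabs_mult, (Rabs_pos_eq (/ _)) by (apply Rlt_le, Rinv_0_lt_compat; lra).
  apply Rle_trans with ((1 + INR l) * (C * (1 + INR l) ^ p * (pavoid q r l * INR q ^ l) * / INR q ^ l)).
  - apply Rmult_le_compat_l; [lra|]. apply Rmult_le_compat_r; [apply Rlt_le, Rinv_0_lt_compat; lra|].
    apply block_sum_bound. intros b Hb. eapply Rle_trans; [apply H|].
    apply Rmult_le_compat_l; auto. apply pow_incr. split; [pose proof (lenw_ge_1 q b); lra|].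
    now apply lenw_le.
  - replace ((1 + INR l) * (C * (1 + INR l) ^ p * (pavoid q r l * INR q ^ l) * / INR q ^ l))
      with (C * (pavoid q r l * (1 + INR l) ^ S p)) by (simpl; field; lra).
    rewrite Rmult_assoc. apply Rmult_le_compat_l; auto.
Qed.

Lemma bweight_le_decay (phi : nat -> R) (C th : R) :
  (forall l, (1 + INR l) * Rabs (bweight q r phi l) <= C * th ^ l) ->
  forall l, Rabs (bweight q r phi l) <= C * th ^ l.
Proof.
  intros H l. eapply Rle_trans; [|apply H]. pose proof (pos_INR l).
  pose proof (Rabs_pos (bweight q r phi l)).
  assert (0 <= INR l * Rabs (bweight q r phi l)) by now apply Rmult_le_pos. lra.
Qed.

Lemma ex_series_bweight (phi : nat -> R) :
  growth q phi ->
  ex_series (fun l => Rabs (bweight q r phi l)) /\ ex_series (bweight q r phi)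
  /\ ex_series (fun l => INR l * bweight q r phi l).
Proof.
  intros Hphi. destruct (bweight_decay phi Hphi) as [th [C [Hth [HC H]]]].
  pose proof (bweight_le_decay phi C th H) as H'.
  repeat split.
  - apply (is_series_geometric_bound _ C th Hth). intros l. rewrite Rabs_Rabsolu. auto.
  - now apply (is_series_geometric_bound _ C th Hth).
  - apply (is_series_geometric_bound _ C th Hth). intros l. pose proof (pos_INR l).
    rewrite Rabs_mult, (Rabs_pos_eq (INR l)) by auto.
    eapply Rle_trans; [|apply H]. apply Rmult_le_compat_r; [apply Rabs_pos|lra].
Qed.

Let Q : R := / INR q ^ (2 * r).

Lemma gam_bounds (k : nat) : 0 <= gam q r k <= 1.
Proof.
  unfold gam. destruct (Nat.ltb k r); [lra|].
  pose proof (INR_pow_pos q Hq (Nat.min k (2 * r))) as P.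
  split; [apply Rlt_le, Rinv_0_lt_compat, P|].
  rewrite <- Rinv_1. apply Rinv_le_contravar; [lra|]. apply pow_R1_Rle.
  pose proof (INR_q_ge2 q Hq). lra.
Qed.

Lemma gam_far (k : nat) : (2 * r <= k)%nat -> gam q r k = Q.
Proof.
  intros H. unfold gam. destruct (Nat.ltb_spec k r); [lia|]. now rewrite Nat.min_r.
Qed.

Lemma gam_diff_bound (k : nat) : Rabs (gam q r k - Q) <= 1.
Proof.
  pose proof (gam_bounds k). pose proof (gam_bounds (2 * r)) as H'.
  rewrite gam_far in H' by auto. apply Rabs_le. lra.
Qed.

(** For a fixed block length the weight [gam] reaches its final value [Q] once [2 * r] further
    digits are available, so the convolution tends to [Q] times the full series. *)
Lemma mean_beta (phi : nat -> R) :
  growth q phi -> mean q (beta q r phi) = Q * Series (bweight q r phi).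
Proof.
  intros Hphi. destruct (ex_series_bweight phi Hphi) as [Ha [He _]].
  apply mean_unique.
  (* [S j - 1 - i] is [j - i], expressed through the number [S j] of summands. *)
  apply is_lim_seq_ext with (fun j => bsum (fun i => bweight q r phi i * gam q r (S j - 1 - i)) (S j)).
  - intros j. rewrite avgn_beta_convolution by auto. apply bsum_ext. intros i _.
    do 2 f_equal. lia.
  - apply (is_lim_seq_incr_1 (fun n => bsum (fun i => bweight q r phi i * gam q r (n - 1 - i)) n)).
    apply (bsum_eventually_constant_weights (bweight q r phi) (fun l => Rabs (bweight q r phi l))
      (fun n i => gam q r (n - 1 - i)) (fun _ => Q) (2 * r + 1)); auto.
    + apply is_series_ext with (fun i => Q * bweight q r phi i); [intros; apply Rmult_comm|].
      apply is_series_Rmult. now apply Series_correct.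
    + intros n i _. rewrite Rabs_mult. rewrite <- (Rmult_1_r (Rabs (bweight q r phi i))) at 2.
      apply Rmult_le_compat_l; [apply Rabs_pos|apply gam_diff_bound].
    + intros n i Hi. apply gam_far. lia.
Qed.

Lemma gam_sum : bsum (gam q r) (2 * r)
  = (/ INR q ^ r - / INR q ^ (2 * r)) * INR q / (INR q - 1).
Proof.
  pose proof (INR_q_ge2 q Hq). pose proof (INR_pow_pos q Hq) as Pp.
  replace (2 * r)%nat with (r + r)%nat at 1 by lia. rewrite bsum_add.
  rewrite (bsum_zero (gam q r)).
  2:{ intros i Hi. unfold gam. destruct (Nat.ltb_spec i r); [reflexivity|lia]. }
  rewrite (bsum_ext _ (fun i => / INR q ^ r * (/ INR q) ^ i)).
  2:{ intros i Hi. unfold gam. destruct (Nat.ltb_spec (r + i) r); [lia|].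
      rewrite Nat.min_l by lia. rewrite pow_add, Rinv_mult, pow_inv. reflexivity. }
  rewrite bsum_scal. pose proof (bsum_geometric (/ INR q) r) as Hs.
  set (S := bsum (fun i => (/ INR q) ^ i) r) in *. rewrite pow_inv in Hs.
  replace S with ((1 - / INR q ^ r) * INR q / (INR q - 1)).
  - replace (2 * r)%nat with (r + r)%nat by lia. rewrite pow_add.
    field. split; first [lra|apply Rgt_not_eq, Pp].
  - rewrite <- Hs. field. lra.
Qed.

(** The constant by which the partial sums of [gam] deviate from linear growth with slope [Q]. It is
    the origin of the denominator q - 1 and of the term with factor r in the variance. *)
Definition kappa : R := bsum (gam q r) (2 * r) - INR (2 * r) * Q.

Lemma gam_partial_sum (n : nat) : (2 * r <= n)%nat -> bsum (gam q r) n = INR n * Q + kappa.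
Proof.
  intros H. replace n with (2 * r + (n - 2 * r))%nat at 1 by lia. rewrite bsum_add.
  rewrite (bsum_ext (fun i => gam q r (2 * r + i)) (fun _ => Q)) by (intros; apply gam_far; lia).
  rewrite bsum_const. unfold kappa. rewrite minus_INR by exact H. ring.
Qed.

Lemma gam_partial_sum_bound (n : nat) :
  Rabs (bsum (gam q r) n - INR n * Q - kappa) <= INR (2 * r) + INR (2 * r).
Proof.
  pose proof (pos_INR (2 * r)).
  assert (B : forall k, Rabs (bsum (gam q r) k - INR k * Q) <= INR k).
  { intros k. rewrite <- bsum_const, <- bsum_minus. eapply Rle_trans; [apply bsum_Rabs|].
    apply Rle_trans with (bsum (fun _ => 1) k); [|rewrite bsum_const; lra].
    apply bsum_le. intros; apply gam_diff_bound. }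
  destruct (Nat.le_gt_cases (2 * r) n) as [Hn|Hn].
  - rewrite gam_partial_sum by exact Hn.
    replace (INR n * Q + kappa - INR n * Q - kappa) with 0 by ring. rewrite Rabs_R0. lra.
  - unfold Rminus at 1. eapply Rle_trans; [apply Rabs_triang|]. rewrite Rabs_Ropp.
    apply Rplus_le_compat; [|apply B]. eapply Rle_trans; [apply B|]. apply le_INR. lia.
Qed.

(** Summing [a j - mu0] over [j < n] gives each [x l] the partial sum of [gam] of length [n - l],
    minus its share of [n * mu0]. By [gam_partial_sum] this weight becomes [kappa - l * Q], and
    replacing the partial sum of [x] by [b] costs [n] times a geometric tail. *)
Lemma W1_0 (f : nat -> R) :
  growth q f ->
  W1 q r f 0 = Q * Series (bweight q r f) + kappa * Series (bweight q r f)
    - Q * Series (fun l => INR l * bweight q r f l).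
Proof.
  intros Hf. destruct (ex_series_bweight f Hf) as [Ha [He He1]].
  set (x := bweight q r f) in *. set (b := Series x). set (b1 := Series (fun l => INR l * x l)).
  destruct (bweight_decay f Hf) as [th [C [Hth [HC Hx]]]].
  pose proof (bweight_le_decay f C th Hx) as Hx'. fold x in Hx'.
  pose proof (mean_beta f Hf) as Hmu. fold x b in Hmu. fold (mu0 q r f) in Hmu.
  set (a := fun j => avgn q j (beta q r f) 0%nat).
  assert (Ea : forall j, a j = bsum (fun l => x l * gam q r (j - l)) (S j))
    by (intros j; now apply avgn_beta_convolution).
  assert (L1 : is_lim_seq (fun n => bsum (fun i => x i * (bsum (gam q r) (n - i) - INR n * Q)) n)
     (kappa * b - Q * b1)).
  { apply (bsum_eventually_constant_weights x (fun l => (INR (2 * r) + INR (2 * r)) * Rabs (x l))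
      (fun n i => bsum (gam q r) (n - i) - INR n * Q) (fun i => kappa - INR i * Q) (2 * r)).
    - destruct Ha as [la Hla]. eexists. apply is_series_Rmult, Hla.
    - apply is_series_ext with (fun i => kappa * x i - Q * (INR i * x i)).
      + intros i. real_eq. ring.
      + apply (is_series_minus (fun i => kappa * x i) (fun i => Q * (INR i * x i)));
          apply is_series_Rmult, Series_correct; auto.
    - intros n i Hi. rewrite Rabs_mult, Rmult_comm. apply Rmult_le_compat_r; [apply Rabs_pos|].
      replace (bsum (gam q r) (n - i) - INR n * Q - (kappa - INR i * Q))
        with (bsum (gam q r) (n - i) - INR (n - i) * Q - kappa).
      + apply gam_partial_sum_bound.
      + rewrite minus_INR by lia. ring.
    - intros n i Hi. rewrite gam_partial_sum by lia. rewrite minus_INR by lia. ring. }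
  assert (L2 : is_lim_seq (fun n => INR n * (bsum x n - b)) 0).
  { destruct (geometric_cauchy (bsum x) C th Hth) as [l [Hl Hb]].
    { intros j. simpl. replace (bsum x j + x j - bsum x j) with (x j) by ring. auto. }
    assert (El : l = b) by (symmetry; apply is_series_unique, is_series_bsum; exact Hl).
    subst l. apply is_lim_seq_squeeze_0 with (2 := geometric_weight_lim (C / (1 - th)) th Hth).
    intros n. pose proof (pos_INR n).
    rewrite Rabs_mult, (Rabs_pos_eq (INR n)) by auto. apply Rmult_le_compat_l; auto. }
  assert (L3 : is_lim_seq (bsum (fun j => a j - mu0 q r f)) (kappa * b - Q * b1)).
  { apply is_lim_seq_ext with (fun n =>
      bsum (fun i => x i * (bsum (gam q r) (n - i) - INR n * Q)) n + Q * (INR n * (bsum x n - b))).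
    - intros n. rewrite bsum_minus, bsum_const, Hmu.
      rewrite (bsum_ext a (fun j => bsum (fun l => x l * gam q r (j - l)) (S j))) by auto.
      rewrite (bsum_convolution (fun l k => x l * gam q r k)).
      rewrite (bsum_ext (fun i => x i * (bsum (gam q r) (n - i) - INR n * Q))
        (fun i => bsum (fun k => x i * gam q r k) (n - i) - (INR n * Q) * x i)).
      + rewrite bsum_minus, bsum_scal. ring.
      + intros i _. rewrite bsum_scal. ring.
    - replace (Finite (kappa * b - Q * b1)) with (Finite (kappa * b - Q * b1 + Q * 0)) by (f_equal; ring).
      apply is_lim_seq_plus'; auto. apply is_lim_seq_mult'; auto. apply is_lim_seq_const. }
  destruct (avoid_decay q r Hq Hr) as [th' [Hth' Hd]].
  assert (TA : tame q r (avg q (beta q r f))) by (apply pretame_avg; now apply pretame_beta).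
  pose proof (corrector_is_series q r Hq th' Hth' Hd (avg q (beta q r f)) 0 0 TA) as HW.
  apply is_series_bsum in HW. cbn [avgn] in HW. fold (W1 q r f) in HW.
  rewrite (mean_avg q r Hq th' Hth' Hd) in HW by now apply pretame_beta.
  (* [W1] corrects [avg beta], so its series begins with [a 1]. The extra term at [j = 0] is
     [- mu0], since [a 0 = 0]; this is the source of the first summand of the result. *)
  assert (HW' : is_lim_seq (fun n => bsum (fun j => a j - mu0 q r f) (S n)) (- mu0 q r f + W1 q r f 0)).
  { apply is_lim_seq_ext with (fun n => - mu0 q r f
      + bsum (fun j => avgn q (0 + j) (avg q (beta q r f)) 0 - mean q (beta q r f)) n).
    - intros n. rewrite bsum_S_l. f_equal.
      + rewrite Ea. simpl. unfold gam. destruct (Nat.ltb_spec 0 r); [ring|lia].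
      + apply bsum_ext. intros j _. unfold a, mu0. now rewrite <- avgn_avg.
    - apply is_lim_seq_plus'; [apply is_lim_seq_const|exact HW]. }
  apply is_lim_seq_incr_1 in L3. pose proof (is_lim_seq_unique _ _ L3) as U1.
  rewrite (is_lim_seq_unique _ _ HW') in U1. injection U1 as U1. lra.
Qed.

End BlockMeans.

(** * The generating function *)

Lemma exp_monotone (x y : R) : x <= y -> exp x <= exp y.
Proof. intros [H| ->]; [apply Rlt_le, exp_increasing, H|lra]. Qed.

Lemma exp_taylor_1 (z : R) : Rabs (exp z - 1 - z) <= z ^ 2 * exp (Rabs z).
Proof.
  pose proof (exp_ineq1_le z) as H1.
  rewrite Rabs_pos_eq by lra.
  destruct (Rle_lt_dec 0 z) as [Hz|Hz].
  - rewrite Rabs_pos_eq by exact Hz.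
    assert (H : exp z - 1 <= z * exp z).
    { pose proof (exp_ineq1_le (- z)) as H2. rewrite exp_Ropp in H2.
      apply (Rmult_le_compat_r (exp z)) in H2; [|lra]. rewrite Rinv_l in H2 by lra. lra. }
    assert (z * (exp z - 1) <= z * (z * exp z)) by (apply Rmult_le_compat_l; auto).
    lra.
  - rewrite Rabs_left by exact Hz.
    assert (H : exp z - 1 - z <= z ^ 2).
    { pose proof (exp_ineq1_le (- z)) as H2.
      assert (exp z <= / (1 - z)).
      { replace (exp z) with (/ exp (- z)) by (rewrite exp_Ropp, Rinv_inv; reflexivity).
        apply Rinv_le_contravar; lra. }
      assert (/ (1 - z) <= 1 + z + z ^ 2).
      { apply Rmult_le_reg_l with (1 - z); [lra|]. rewrite Rinv_r by lra.
        replace ((1 - z) * (1 + z + z ^ 2)) with (1 - z ^ 3) by ring.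
        assert (z ^ 3 <= 0) by (simpl in *; nra). lra. }
      lra. }
    assert (1 <= exp (- z)) by (rewrite <- exp_0; apply Rlt_le, exp_increasing; lra).
    nra.
Qed.

Lemma sqr_le_exp (c y : R) : 0 < c -> y ^ 2 <= 4 / c ^ 2 * exp (c * Rabs y).
Proof.
  intros Hc. pose proof (exp_ineq1_le (c * Rabs y / 2)) as H.
  pose proof (Rabs_pos y) as Py.
  assert (0 <= c * Rabs y / 2) by (apply Rmult_le_pos; [apply Rmult_le_pos; lra|lra]).
  replace (exp (c * Rabs y)) with (exp (c * Rabs y / 2) * exp (c * Rabs y / 2)) by (rewrite <- exp_plus; f_equal; field).
  assert (H2 : (c * Rabs y / 2) * (c * Rabs y / 2) <= exp (c * Rabs y / 2) * exp (c * Rabs y / 2))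
    by (apply Rmult_le_compat; lra).
  rewrite <- pow2_abs. apply Rle_trans with (4 / c ^ 2 * ((c * Rabs y / 2) * (c * Rabs y / 2))).
  - right. field. lra.
  - apply Rmult_le_compat_l; auto. apply Rlt_le, Rdiv_lt_0_compat; [lra|apply pow_lt; lra].
Qed.

Lemma ex_series_le_R (a b : nat -> R) :
  (forall n, Rabs (a n) <= b n) -> ex_series b -> ex_series a.
Proof.
  intros H Hb. apply (@ex_series_le R_AbsRing R_CompleteNormedModule a b); auto.
Qed.

(** A part [c] of the exponential room pays for one factor [f n], because [c * Rabs (f n)] is below
    its exponential. *)
Lemma ex_series_exp_weaken (a f : nat -> R) (d c : R) :
  0 < c <= d -> ex_series (fun n => Rabs (a n) * exp (d * Rabs (f n))) ->
  ex_series (fun n => Rabs (a n * f n) * exp ((d - c) * Rabs (f n))).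
Proof.
  intros Hc H.
  apply ex_series_le_R with (fun n => / c * (Rabs (a n) * exp (d * Rabs (f n)))).
  - intros n. pose proof (Rabs_pos (a n)).
    pose proof (exp_pos ((d - c) * Rabs (f n))).
    rewrite Rabs_mult, Rabs_Rabsolu, (Rabs_pos_eq (exp _)), Rabs_mult by lra.
    replace (exp (d * Rabs (f n))) with (exp (c * Rabs (f n)) * exp ((d - c) * Rabs (f n)))
      by (rewrite <- exp_plus; f_equal; ring).
    replace (/ c * (Rabs (a n) * (exp (c * Rabs (f n)) * exp ((d - c) * Rabs (f n)))))
      with (Rabs (a n) * (/ c * exp (c * Rabs (f n))) * exp ((d - c) * Rabs (f n))) by ring.
    apply Rmult_le_compat_r; [lra|]. apply Rmult_le_compat_l; auto.
    pose proof (exp_ineq1_le (c * Rabs (f n))).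
    apply Rmult_le_reg_l with c; [lra|]. rewrite <- Rmult_assoc, Rinv_r, Rmult_1_l by lra. lra.
  - destruct H as [l Hl]. eexists. apply is_series_Rmult, Hl.
Qed.

Lemma ex_series_exp_at (a f : nat -> R) (d t : R) :
  Rabs t <= d -> ex_series (fun n => Rabs (a n) * exp (d * Rabs (f n))) ->
  ex_series (fun n => a n * exp (f n * t)).
Proof.
  intros Ht H. apply ex_series_le_R with (2 := H). intros n.
  rewrite Rabs_mult, (Rabs_pos_eq (exp _)) by (apply Rlt_le, exp_pos).
  apply Rmult_le_compat_l; [apply Rabs_pos|].
  apply exp_monotone. eapply Rle_trans; [apply Rle_abs|]. rewrite Rabs_mult, Rmult_comm.
  apply Rmult_le_compat_r; auto using Rabs_pos.
Qed.

Lemma is_derive_quadratic (F : R -> R) (t l M d : R) :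
  0 < d -> (forall h, Rabs h < d -> Rabs (F (t + h) - F t - h * l) <= M * h ^ 2) ->
  is_derive F t l.
Proof.
  intros Hd H. apply is_derive_Reals. intros eps Heps.
  assert (HM : 0 <= Rabs M) by apply Rabs_pos.
  assert (Hm : 0 < Rmin d (eps / (Rabs M + 1))).
  { apply Rmin_pos; auto. apply Rdiv_lt_0_compat; lra. }
  exists (mkposreal _ Hm). intros h Hh0 Hh. simpl in Hh.
  assert (Hh1 : Rabs h < d) by (eapply Rlt_le_trans; [exact Hh|apply Rmin_l]).
  assert (Hh2 : Rabs h < eps / (Rabs M + 1)) by (eapply Rlt_le_trans; [exact Hh|apply Rmin_r]).
  replace ((F (t + h) - F t) / h - l) with ((F (t + h) - F t - h * l) / h) by (field; auto).
  unfold Rdiv. rewrite Rabs_mult, Rabs_inv.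
  pose proof (Rabs_pos_lt h Hh0) as Ph.
  apply Rle_lt_trans with (Rabs M * Rabs h).
  - apply Rmult_le_reg_r with (Rabs h); auto. rewrite Rmult_assoc, Rinv_l, Rmult_1_r by lra.
    eapply Rle_trans; [apply H; auto|]. rewrite <- pow2_abs.
    replace (Rabs M * Rabs h * Rabs h) with (Rabs M * Rabs h ^ 2) by ring.
    apply Rmult_le_compat_r; [apply pow2_ge_0|apply Rle_abs].
  - apply Rle_lt_trans with ((Rabs M + 1) * Rabs h); [lra|].
    apply Rmult_lt_compat_l with (r := Rabs M + 1) in Hh2; [|lra].
    replace ((Rabs M + 1) * (eps / (Rabs M + 1))) with eps in Hh2 by (field; lra). lra.
Qed.

Lemma is_derive_exp_series (a f : nat -> R) (d t : R) :
  Rabs t < d -> ex_series (fun n => Rabs (a n) * exp (d * Rabs (f n))) ->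
  is_derive (fun s => Series (fun n => a n * exp (f n * s))) t
    (Series (fun n => a n * f n * exp (f n * t))).
Proof.
  intros Ht H. pose proof (Rabs_pos t) as Pt.
  (* The room [d] is spent as [Rabs t + c + c]: one [c] goes to the Taylor remainder of
     [exp (f n * h)], the other to the factor [f n ^ 2] through [sqr_le_exp]. *)
  set (c := (d - Rabs t) / 2). assert (Hc : 0 < c) by (unfold c; lra).
  assert (Hd : Rabs t + c + c = d) by (unfold c; lra).
  pose proof (ex_series_exp_weaken a f d c ltac:(lra) H) as H1.
  set (M := 4 / c ^ 2 * Series (fun n => Rabs (a n) * exp (d * Rabs (f n)))).
  apply is_derive_quadratic with M c; auto. intros h Hh.
  assert (Eth : Rabs (t + h) <= d) by (eapply Rle_trans; [apply Rabs_triang|]; lra).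
  pose proof (ex_series_exp_at a f d (t + h) Eth H) as E1.
  pose proof (ex_series_exp_at a f d t ltac:(lra) H) as E2.
  pose proof (ex_series_exp_at (fun n => a n * f n) f (d - c) t ltac:(lra) H1) as E3.
  rewrite <- Series_minus by auto. rewrite <- Series_scal_l. rewrite <- Series_minus; auto.
  2:{ destruct E1 as [l1 L1], E2 as [l2 L2]. eexists. apply (is_series_minus _ _ _ _ L1 L2). }
  2:{ destruct E3 as [l3 L3]. eexists. apply is_series_Rmult, L3. }
  assert (Hb : forall n, Rabs (a n * exp (f n * (t + h)) - a n * exp (f n * t) - h * (a n * f n * exp (f n * t)))
    <= 4 / c ^ 2 * h ^ 2 * (Rabs (a n) * exp (d * Rabs (f n)))).
  { intros n. replace (f n * (t + h)) with (f n * t + f n * h) by ring. rewrite exp_plus.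
    replace (a n * (exp (f n * t) * exp (f n * h)) - a n * exp (f n * t) - h * (a n * f n * exp (f n * t)))
      with (a n * (exp (f n * t) * (exp (f n * h) - 1 - f n * h))) by ring.
    rewrite !Rabs_mult, (Rabs_pos_eq (exp (f n * t))) by (apply Rlt_le, exp_pos).
    replace (4 / c ^ 2 * h ^ 2 * (Rabs (a n) * exp (d * Rabs (f n))))
      with (Rabs (a n) * (4 / c ^ 2 * h ^ 2 * exp (d * Rabs (f n)))) by ring.
    apply Rmult_le_compat_l; [apply Rabs_pos|].
    pose proof (Rabs_pos (f n)) as Pf.
    assert (B1 : exp (f n * t) <= exp (Rabs t * Rabs (f n))).
    { apply exp_monotone. eapply Rle_trans; [apply Rle_abs|]. rewrite Rabs_mult. lra. }
    assert (B2 : Rabs (exp (f n * h) - 1 - f n * h) <= h ^ 2 * (f n ^ 2 * exp (c * Rabs (f n)))).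
    { eapply Rle_trans; [apply exp_taylor_1|].
      replace ((f n * h) ^ 2) with (h ^ 2 * f n ^ 2) by ring. rewrite Rmult_assoc.
      apply Rmult_le_compat_l; [apply pow2_ge_0|]. apply Rmult_le_compat_l; [apply pow2_ge_0|].
      apply exp_monotone. rewrite Rabs_mult, Rmult_comm. apply Rmult_le_compat_r; lra. }
    pose proof (sqr_le_exp c (f n) Hc) as B3.
    apply Rle_trans with (exp (Rabs t * Rabs (f n)) * (h ^ 2 * ((4 / c ^ 2 * exp (c * Rabs (f n))) * exp (c * Rabs (f n))))).
    - apply Rmult_le_compat; auto using Rabs_pos. apply Rlt_le, exp_pos.
      eapply Rle_trans; [exact B2|]. apply Rmult_le_compat_l; [apply pow2_ge_0|].
      apply Rmult_le_compat_r; [apply Rlt_le, exp_pos|auto].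
    - right. rewrite <- Hd, !Rmult_plus_distr_r, !exp_plus. ring. }
  eapply Rle_trans; [apply Series_Rabs|].
  - apply ex_series_le_R with (fun n => 4 / c ^ 2 * h ^ 2 * (Rabs (a n) * exp (d * Rabs (f n)))).
    + intros n. rewrite Rabs_Rabsolu. auto.
    + destruct H as [l L]. eexists. apply is_series_Rmult, L.
  - unfold M. rewrite Rmult_assoc, (Rmult_comm (Series _)), <- Rmult_assoc, <- Series_scal_l.
    apply Series_le.
    + intros n. split; [apply Rabs_pos|auto].
    + destruct H as [l L]. eexists. apply is_series_Rmult, L.
Qed.

(** * Membership in B through gaps, and the series grouped by length *)

Section Digits.

Variables q r : nat.
Hypothesis Hq : (2 <= q)%nat.
Hypothesis Hr : (1 <= r)%nat.

Lemma digits_skip (l1 l2 : list nat) (n : nat) :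
  digits q n = l1 ++ l2 -> l2 = digits q (n / q ^ length l1).
Proof.
  revert n. induction l1 as [|x l1 IH]; intros n H.
  - cbn [app length Nat.pow] in *. now rewrite Nat.div_1_r.
  - rewrite digits_eq in H by exact Hq. destruct (Nat.eqb n 0); [discriminate|].
    simpl in H. injection H as _ H. simpl length. rewrite <- (div_pow_S q). auto.
Qed.

Lemma digits_zeros (k m : nat) (l : list nat) :
  digits q m = repeat 0%nat k ++ l -> (m mod q ^ k = 0)%nat.
Proof.
  revert m. induction k as [|k IH]; intros m H; [cbn [Nat.pow]; now rewrite Nat.mod_1_r|].
  rewrite digits_eq in H by exact Hq. destruct (Nat.eqb m 0); [discriminate|].
  simpl in H. injection H as E H. apply IH in H.
  apply Nat.Div0.mod_divides in H. destruct H as [c H].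
  rewrite (Nat.div_mod_eq m q), E, H. cbn [Nat.pow].
  replace (q * (q ^ k * c) + 0)%nat with (c * (q * q ^ k))%nat by ring.
  apply Nat.Div0.mod_mul.
Qed.

Lemma zeros_digits (k m : nat) :
  m <> 0%nat -> (m mod q ^ k = 0)%nat -> exists l, digits q m = repeat 0%nat k ++ l.
Proof.
  revert m. induction k as [|k IH]; intros m Hm H; [now exists (digits q m)|].
  rewrite digits_eq by exact Hq. destruct (Nat.eqb_spec m 0) as [|_]; [contradiction|].
  apply Nat.Div0.mod_divides in H. destruct H as [c H].
  assert (E : (m = q ^ k * c * q)%nat) by (rewrite H; cbn [Nat.pow]; ring).
  assert (Ed : (m / q = q ^ k * c)%nat) by (rewrite E; apply Nat.div_mul; lia).
  destruct (IH (m / q)%nat) as [l Hl].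
  - rewrite Ed. intros E0. rewrite E0 in E. lia.
  - rewrite Ed, Nat.mul_comm. apply Nat.Div0.mod_mul.
  - exists l. rewrite Hl. replace (m mod q)%nat with 0%nat; [reflexivity|].
    rewrite E. symmetry. apply Nat.Div0.mod_mul.
Qed.

(** [gap] reads digits padded with leading zeros, [inB] the plain digit list. They agree because a
    window of zeros that starts below the leading digit also ends below it, and the first window of
    padding starts exactly at the length. *)
Lemma blockb_inB (l n : nat) :
  (n < q ^ l)%nat -> (blockb q r l n = true <-> inB q r n /\ qlen q n = l).
Proof.
  intros Hn. unfold blockb. rewrite Bool.andb_true_iff, Nat.eqb_eq, Bool.negb_true_iff, Nat.eqb_neq.
  split.
  - intros [Hg Hm]. destruct (is_gap_gap q r Hq n) as [_ G2]. rewrite Hg in G2.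
    assert (Hl : qlen q n = l).
    { destruct l as [|l].
      - exfalso. apply Hm. replace n with 0%nat by (simpl in Hn; lia). apply Nat.Div0.mod_0_l.
      - apply Nat.le_antisymm; [now apply qlen_le_iff|].
        apply Nat.nlt_ge. intros Hlt.
        assert (Hlt' : (qlen q n <= l)%nat) by lia. apply qlen_le_iff in Hlt'; auto.
        apply (G2 l); [lia|]. rewrite Nat.div_small by exact Hlt'. apply Nat.Div0.mod_0_l. }
    split; auto. split; [destruct n; [now rewrite Nat.Div0.mod_0_l in Hm|lia]|].
    split; auto. intros [l1 [l2 E]].
    assert (Hlen : (length l1 + r <= l)%nat).
    { rewrite <- Hl. unfold qlen. rewrite E, !length_app, repeat_length. lia. }
    apply (G2 (length l1)); [lia|]. apply digits_skip in E. symmetry in E.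
    now apply digits_zeros in E.
  - intros [[Hpos [Hm HB]] Hl]. split; auto. apply gap_unique; auto. split.
    + rewrite Nat.div_small by exact Hn. apply Nat.Div0.mod_0_l.
    + intros i Hi E. apply HB.
      assert (Hne : (n / q ^ i)%nat <> 0%nat).
      { intros E0. apply Nat.div_small_iff in E0; [|pose proof (pow_q_pos q Hq i); lia].
        apply qlen_le_iff in E0; auto. lia. }
      destruct (zeros_digits r _ Hne E) as [l2 E2].
      exists (firstn i (digits q n)), l2.
      rewrite <- E2, <- (firstn_skipn i (digits q n)) at 1. f_equal.
      pose proof (digits_skip (firstn i (digits q n)) (skipn i (digits q n)) n) as E3.
      rewrite firstn_skipn in E3. rewrite E3 at 1 by reflexivity.
      rewrite length_firstn. do 2 f_equal. f_equal. unfold qlen in Hl. lia.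
Qed.

Definition block_term (h : nat -> R) (x : R) (n : nat) : R :=
  (if excluded_middle_informative (inB q r n) then x ^ qlen q n else 0) * h n.

(** Regroups a series over integers, the form of [Bhat], into a power series indexed by the
    length. *)
Lemma block_term_partial_sum (h : nat -> R) (x : R) (L : nat) :
  bsum (block_term h x) (q ^ L) = bsum (fun l => x ^ l * block_sum q r h l) (S L).
Proof.
  transitivity (bsum (fun n => bsum (fun l => if Nat.eqb l (qlen q n) then block_term h x n else 0) (S L)) (q ^ L)).
  - apply bsum_ext. intros n Hn. rewrite bsum_delta. apply qlen_le_iff in Hn; auto.
    destruct (Nat.ltb_spec (qlen q n) (S L)); [reflexivity|lia].
  - rewrite bsum_swap. apply bsum_ext. intros l Hl.
    unfold block_sum. rewrite <- bsum_scal.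
    rewrite <- (bsum_restrict _ (q ^ l) (q ^ L)) by (apply Nat.pow_le_mono_r; lia).
    apply bsum_ext. intros n Hn. unfold block_term.
    destruct (Nat.ltb_spec n (q ^ l)) as [H|H].
    + pose proof (blockb_inB l n H) as Hb.
      destruct (Nat.eqb_spec l (qlen q n)) as [E|E].
      * destruct (excluded_middle_informative (inB q r n)) as [HB|HB].
        -- rewrite (proj2 Hb) by auto. now rewrite <- E.
        -- destruct (blockb q r l n); [exfalso; apply HB, Hb; reflexivity|ring].
      * destruct (blockb q r l n); [|ring]. exfalso. apply E. symmetry. now apply Hb.
    + destruct (Nat.eqb_spec l (qlen q n)) as [E|E]; auto.
      exfalso. assert (Hle : (qlen q n <= l)%nat) by lia. apply qlen_le_iff in Hle; auto. lia.
Qed.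

Lemma Rabs_block_term (h : nat -> R) (x : R) (n : nat) :
  Rabs (block_term h x n) = block_term (fun m => Rabs (h m)) (Rabs x) n.
Proof.
  unfold block_term. rewrite Rabs_mult. destruct excluded_middle_informative.
  - now rewrite RPow_abs.
  - now rewrite Rabs_R0.
Qed.

Lemma ex_series_block_term (h : nat -> R) (x : R) :
  ex_series (fun l => Rabs x ^ l * block_sum q r (fun m => Rabs (h m)) l) ->
  ex_series (fun n => Rabs (block_term h x n)).
Proof.
  intros [M HM]. apply is_series_bsum in HM.
  assert (Pos : forall n, 0 <= block_term (fun m => Rabs (h m)) (Rabs x) n).
  { intros n. rewrite <- Rabs_block_term. apply Rabs_pos. }
  assert (Incr : forall n, bsum (fun l => Rabs x ^ l * block_sum q r (fun m => Rabs (h m)) l) n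
    <= bsum (fun l => Rabs x ^ l * block_sum q r (fun m => Rabs (h m)) l) (S n)).
  { intros n. simpl. assert (0 <= Rabs x ^ n * block_sum q r (fun m => Rabs (h m)) n); [|lra].
    apply Rmult_le_pos; [apply pow_le, Rabs_pos|]. apply bsum_nonneg. intros i _.
    destruct blockb; [apply Rabs_pos|lra]. }
  destruct (ex_finite_lim_seq_incr (bsum (fun n => Rabs (block_term h x n))) M) as [l Hl].
  - intros n. simpl. pose proof (Rabs_pos (block_term h x n)). lra.
  - intros n. apply Rle_trans with (bsum (fun n => Rabs (block_term h x n)) (q ^ n)).
    + assert (Hn : (n <= q ^ n)%nat) by (apply Nat.lt_le_incl, Nat.pow_gt_lin_r; lia).
      replace (q ^ n)%nat with (n + (q ^ n - n))%nat by lia. rewrite bsum_add.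
      assert (0 <= bsum (fun i => Rabs (block_term h x (n + i))) (q ^ n - n))
        by (apply bsum_nonneg; intros; apply Rabs_pos). lra.
    + rewrite (bsum_ext _ (block_term (fun m => Rabs (h m)) (Rabs x))) by (intros; apply Rabs_block_term).
      rewrite block_term_partial_sum.
      exact (is_lim_seq_incr_compare _ _ HM Incr (S n)).
  - exists l. now apply is_series_bsum.
Qed.

Lemma Series_block_term (h : nat -> R) (x : R) :
  ex_series (fun l => Rabs x ^ l * block_sum q r (fun m => Rabs (h m)) l) ->
  is_series (fun l => x ^ l * block_sum q r h l) (Series (block_term h x)).
Proof.
  intros H. apply ex_series_block_term, ex_series_Rabs in H.
  apply Series_correct, is_series_bsum in H. apply is_series_bsum, is_lim_seq_incr_1.
  apply is_lim_seq_ext with (fun L => bsum (block_term h x) (q ^ L)); [apply block_term_partial_sum|].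
  apply (is_lim_seq_subseq (bsum (block_term h x)) _ (fun L => q ^ L)%nat); auto.
  apply eventually_subseq. intros n. cbn [Nat.pow]. pose proof (pow_q_pos q Hq n). nia.
Qed.

End Digits.

Lemma exp_pow (x : R) (n : nat) : exp x ^ n = exp (x * INR n).
Proof.
  induction n as [|n IH]; [now rewrite Rmult_0_r, exp_0|].
  cbn [pow]. rewrite IH, S_INR, <- exp_plus. f_equal. ring.
Qed.

Section GeneratingFunction.

Variables q r : nat.
Hypothesis Hq : (2 <= q)%nat.
Hypothesis Hr : (1 <= r)%nat.
Variable f : nat -> R.
Hypothesis Hf : exists C, 0 <= C /\ forall n, Rabs (f n) <= C * lenw q n.

(** The decay rate [rho] leaves room for two factors [1 + eta] per digit. One lets [x] exceed 1/q,
    the other bounds [exp (d * Rabs (f m))], since [f] is at most linear in the length. Hence the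
    series can be differentiated in a neighbourhood of (1/q, 0). *)
Lemma block_series_summable :
  exists x1 d, / INR q < x1 /\ 0 < d /\ forall phi D x,
    (forall m, Rabs (phi m) <= D * exp (d * Rabs (f m))) -> Rabs x <= x1 ->
    ex_series (fun l => Rabs x ^ l * block_sum q r (fun m => Rabs (phi m)) l).
Proof.
  destruct Hf as [C [HC H]]. destruct (pavoid_geometric q r Hq Hr) as [rho [C' [Hrho [HC' Hp]]]].
  pose proof (INR_q_pos q Hq) as Pq.
  (* Small enough to keep [rho * (1 + eta) ^ 2], at most [rho * (1 + 3 * eta)], below 1. *)
  set (eta := (1 - rho) / 4). assert (Heta : 0 < eta < 1) by (unfold eta; lra).
  set (lam := rho * (1 + eta) ^ 2).
  assert (Hlam : 0 < lam < 1).
  { unfold lam. split; [apply Rmult_lt_0_compat; [lra|apply pow_lt; lra]|].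
    replace ((1 + eta) ^ 2) with (1 + 2 * eta + eta * eta) by ring.
    assert (eta * eta <= eta * 1) by (apply Rmult_le_compat_l; lra).
    apply Rle_lt_trans with (rho * (1 + 3 * eta)); [apply Rmult_le_compat_l; lra|].
    assert (rho * eta <= 1 * eta) by (apply Rmult_le_compat_r; lra).
    unfold eta in *. lra. }
  assert (Hln : 0 < ln (1 + eta)) by (rewrite <- ln_1; apply ln_increasing; lra).
  set (d := ln (1 + eta) / (C + 1)). assert (Hd : 0 < d) by (apply Rdiv_lt_0_compat; lra).
  assert (HdC : exp (d * C) <= 1 + eta).
  { rewrite <- (exp_ln (1 + eta)) by lra. apply exp_monotone.
    apply Rle_trans with (d * (C + 1)); [apply Rmult_le_compat_l; lra|].
    right. unfold d. field. lra. }
  exists ((1 + eta) / INR q), d. split.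
  { unfold Rdiv. rewrite <- (Rmult_1_l (/ INR q)) at 1. apply Rmult_lt_compat_r; [|lra].
    now apply Rinv_0_lt_compat. }
  split; auto. intros phi D x Hphi Hx.
  assert (HD : 0 <= D).
  { specialize (Hphi 0%nat). pose proof (Rabs_pos (phi 0%nat)). pose proof (exp_pos (d * Rabs (f 0%nat))).
    destruct (Rle_lt_dec 0 D); auto. exfalso.
    assert (D * exp (d * Rabs (f 0%nat)) < 0) by nra. lra. }
  apply (is_series_geometric_bound _ (D * exp (d * C) * C') lam Hlam). intros l.
  assert (Hbs : Rabs (block_sum q r (fun m => Rabs (phi m)) l)
     <= D * exp (d * C) * exp (d * C) ^ l * (pavoid q r l * INR q ^ l)).
  { apply block_sum_bound; auto. intros b Hb. rewrite Rabs_Rabsolu.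
    eapply Rle_trans; [apply Hphi|]. rewrite Rmult_assoc. apply Rmult_le_compat_l; auto.
    rewrite exp_pow, <- exp_plus. apply exp_monotone.
    replace (d * C + d * C * INR l) with (d * (C * (1 + INR l))) by ring.
    apply Rmult_le_compat_l; [lra|]. eapply Rle_trans; [apply H|].
    apply Rmult_le_compat_l; auto. now apply lenw_le. }
  rewrite Rabs_mult, <- RPow_abs, Rabs_Rabsolu.
  pose proof (INR_pow_pos q Hq l) as Pl. pose proof (exp_pos (d * C)) as Pe.
  apply Rle_trans with (((1 + eta) / INR q) ^ l * (D * exp (d * C) * (1 + eta) ^ l * (C' * rho ^ l * INR q ^ l))).
  - apply Rmult_le_compat; auto using Rabs_pos.
    + apply pow_le, Rabs_pos.
    + apply pow_incr. split; [apply Rabs_pos|auto].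
    + eapply Rle_trans; [exact Hbs|].
      assert (0 <= D * exp (d * C)) by (apply Rmult_le_pos; lra).
      pose proof (pavoid_nonneg q r Hq l).
      apply Rmult_le_compat.
      * apply Rmult_le_pos; auto. apply pow_le; lra.
      * apply Rmult_le_pos; lra.
      * apply Rmult_le_compat_l; auto. apply pow_incr. lra.
      * apply Rmult_le_compat_r; [lra|auto].
  - right. unfold lam, Rdiv. rewrite !Rpow_mult_distr, pow_inv, <- pow_mult, Nat.mul_comm, pow_mult.
    simpl. field. lra.
Qed.

Definition block_coef (x : R) (n : nat) : R := block_term q r (fun _ => 1) x n.

Lemma block_term_coef (h : nat -> R) (x : R) (n : nat) :
  block_term q r h x n = block_coef x n * h n.
Proof. unfold block_coef, block_term. ring. Qed.

Lemma Bhat_coef (x t : R) : Bhat q r f x t = Series (fun n => block_coef x n * exp (f n * t)).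
Proof.
  apply Series_ext. intros n. unfold block_coef, block_term.
  destruct excluded_middle_informative; ring.
Qed.

Section Values.

Variables x1 d : R.
Hypothesis Hx1 : / INR q < x1.
Hypothesis Hd : 0 < d.
Hypothesis Hsum : forall phi D x,
  (forall m, Rabs (phi m) <= D * exp (d * Rabs (f m))) -> Rabs x <= x1 ->
  ex_series (fun l => Rabs x ^ l * block_sum q r (fun m => Rabs (phi m)) l).

Lemma ex_series_coef_exp (x : R) :
  Rabs x <= x1 -> ex_series (fun n => Rabs (block_coef x n) * exp (d * Rabs (f n))).
Proof.
  intros Hx.
  apply ex_series_ext with (fun n => Rabs (block_term q r (fun m => exp (d * Rabs (f m))) x n)).
  - intros n. rewrite block_term_coef, Rabs_mult, (Rabs_pos_eq (exp _)); auto.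
    apply Rlt_le, exp_pos.
  - apply ex_series_block_term; auto. apply Hsum with 1; auto.
    intros m. rewrite Rabs_pos_eq, Rmult_1_l; [lra|]. apply Rlt_le, exp_pos.
Qed.

Lemma Rabs_inv_q_le : Rabs (/ INR q) <= x1.
Proof.
  rewrite Rabs_pos_eq; [lra|]. apply Rlt_le, Rinv_0_lt_compat, INR_q_pos; auto.
Qed.

Lemma f_le_exp (m : nat) : Rabs (f m) <= / d * exp (d * Rabs (f m)).
Proof.
  pose proof (exp_ineq1_le (d * Rabs (f m))).
  apply Rmult_le_reg_l with d; auto. rewrite <- Rmult_assoc, Rinv_r, Rmult_1_l by lra. lra.
Qed.

(** Stated for all [x] up to [x1], beyond 1/q, so that it can be differentiated once more in [x]. *)
Lemma Bhat_derive_t_0 (x : R) :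
  Rabs x <= x1 -> Derive (fun t => Bhat q r f x t) 0 = PSeries (block_sum q r f) x.
Proof.
  intros Hx.
  rewrite (Derive_ext _ (fun t => Series (fun n => block_coef x n * exp (f n * t)))) by (intros; apply Bhat_coef).
  etransitivity.
  { apply is_derive_unique, (is_derive_exp_series (block_coef x) f d); [rewrite Rabs_R0; lra|].
    now apply ex_series_coef_exp. }
  rewrite (Series_ext _ (block_term q r f x)).
  2:{ intros n. rewrite block_term_coef, Rmult_0_r, exp_0. ring. }
  rewrite <- (is_series_unique _ _ (Series_block_term q r Hq Hr f x (Hsum f (/ d) x f_le_exp Hx))).
  apply Series_ext. intros l. apply Rmult_comm.
Qed.

Lemma PSeries_inv_q (phi : nat -> R) :
  PSeries (block_sum q r phi) (/ INR q) = Series (bweight q r phi).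
Proof. apply Series_ext. intros l. unfold bweight. rewrite pow_inv. reflexivity. Qed.

Lemma Bt_eq : Bt q r f = Series (bweight q r f).
Proof. unfold Bt. rewrite Bhat_derive_t_0 by apply Rabs_inv_q_le. apply PSeries_inv_q. Qed.

Lemma Btt_eq : Btt q r f = Series (bweight q r (fun n => f n ^ 2)).
Proof.
  unfold Btt. set (a := block_coef (/ INR q)).
  pose proof (ex_series_coef_exp _ Rabs_inv_q_le) as H. fold a in H.
  rewrite (Derive_ext_loc _ (fun t => Series (fun n => a n * f n * exp (f n * t)))).
  2:{ exists (mkposreal d Hd). intros t Ht.
      change (Rabs (t - 0) < d) in Ht. rewrite Rminus_0_r in Ht.
      rewrite (Derive_ext _ (fun t => Series (fun n => a n * exp (f n * t)))) by (intros; apply Bhat_coef).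
      apply is_derive_unique. now apply is_derive_exp_series with d. }
  (* Half of the exponential room is kept for the second differentiation. *)
  pose proof (ex_series_exp_weaken a f d (d / 2) ltac:(lra) H) as H1.
  etransitivity.
  { apply is_derive_unique, (is_derive_exp_series (fun n => a n * f n) f (d - d / 2));
      [rewrite Rabs_R0; lra|exact H1]. }
  rewrite (Series_ext _ (block_term q r (fun n => f n ^ 2) (/ INR q))).
  2:{ intros n. rewrite block_term_coef, Rmult_0_r, exp_0. fold (a n). ring. }
  assert (Hs : forall m, Rabs (f m ^ 2) <= 4 / d ^ 2 * exp (d * Rabs (f m))).
  { intros m. rewrite Rabs_pos_eq by apply pow2_ge_0. now apply sqr_le_exp. }
  rewrite <- (is_series_unique _ _ (Series_block_term q r Hq Hr _ _ (Hsum _ _ _ Hs Rabs_inv_q_le))).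
  rewrite <- PSeries_inv_q. apply Series_ext. intros l. apply Rmult_comm.
Qed.

Lemma Btx_eq : Btx q r f = INR q * Series (fun l => INR l * bweight q r f l).
Proof.
  unfold Btx. pose proof (INR_q_pos q Hq) as Pq. pose proof (Rinv_0_lt_compat _ Pq) as Pi.
  rewrite (Derive_ext_loc _ (PSeries (block_sum q r f))).
  (* This radius keeps [x] between 0 and [x1]. *)
  2:{ assert (He : 0 < Rmin (/ INR q) (x1 - / INR q)) by (apply Rmin_pos; lra).
      exists (mkposreal _ He). intros x Hx. change (Rabs (x - / INR q) < Rmin (/ INR q) (x1 - / INR q)) in Hx.
      pose proof (Rmin_r (/ INR q) (x1 - / INR q)).
      apply Rabs_def2 in Hx. apply Bhat_derive_t_0. apply Rabs_le. lra. }
  rewrite Derive_PSeries.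
  - unfold PSeries, PS_derive.
    rewrite (Series_incr_1_aux (fun l => INR l * bweight q r f l)) by (simpl; ring).
    rewrite <- Series_scal_l. apply Series_ext. intros l. unfold bweight.
    rewrite <- tech_pow_Rmult, pow_inv. pose proof (INR_pow_pos q Hq l). field. lra.
  (* Convergence at [x1] bounds the radius of convergence from below by [x1], so 1/q lies inside the
     open disk. *)
  - apply Rbar_lt_le_trans with x1; [simpl; rewrite Rabs_pos_eq; lra|].
    apply Rbar_not_lt_le. intros Hlt.
    assert (Px : Rabs x1 = x1) by (apply Rabs_pos_eq; lra).
    rewrite <- Px in Hlt. apply CV_disk_outside in Hlt. apply Hlt.
    apply is_lim_seq_ext with (fun l => x1 ^ l * block_sum q r f l); [intros; apply Rmult_comm|].
    apply ex_series_lim_0. eexists. apply Series_block_term; auto.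
    apply Hsum with (/ d); [exact f_le_exp|lra].
Qed.

End Values.

Hypothesis Hqa : quasiadditive q r f.

Lemma mu0_eq : mu0 q r f = mu_hat q r f.
Proof.
  destruct block_series_summable as [x1 [d [Hx1 [Hd Hs]]]].
  pose proof (linear_growth q f Hf) as Hg.
  unfold mu0, mu_hat. rewrite (mean_beta q r Hq Hr f Hg), (Bt_eq x1 d Hx1 Hd Hs).
  unfold Rdiv. apply Rmult_comm.
Qed.

(** [var0_eq] needs the means of [beta] and its square and the value of [W1] at 0. The factor
    [INR q] in [Btx_eq] accounts for the exponent -4r-1 in the last term of the formula. *)
Lemma var0_eq_sigma2_hat : var0 q r f = sigma2_hat q r f.
Proof.
  destruct block_series_summable as [x1 [d [Hx1 [Hd Hs]]]].
  pose proof (linear_growth q f Hf) as Hg.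
  assert (Hg2 : growth q (fun n => f n ^ 2)).
  { destruct (growth_mult q f f Hg Hg) as [C [p [HC H]]]. exists C, p. split; auto.
    intros n. simpl. rewrite Rmult_1_r. auto. }
  rewrite (var0_eq q r Hq Hr f Hqa Hg).
  rewrite (mean_ext q _ (beta q r (fun n => f n ^ 2))).
  2:{ intros n. unfold beta. destruct (_ && _)%bool; [reflexivity|ring]. }
  rewrite (mean_beta q r Hq Hr _ Hg2), (W1_0 q r Hq Hr f Hg). unfold mu0.
  rewrite (mean_beta q r Hq Hr f Hg). unfold kappa. rewrite (gam_sum q r Hq) by exact Hr.
  unfold sigma2_hat. cbv zeta.
  rewrite (Bt_eq x1 d Hx1 Hd Hs), (Btt_eq x1 d Hx1 Hd Hs), (Btx_eq x1 d Hx1 Hd Hs).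
  set (b := Series (bweight q r f)). set (c := Series (bweight q r (fun n => f n ^ 2))).
  set (e := Series (fun l => INR l * bweight q r f l)).
  (* Here [Q] stands for [q ^ r]; once all integer powers are written in [Q], the claim is a
     rational identity. *)
  pose proof (INR_q_ge2 q Hq) as Hq2. set (Q := INR q ^ r).
  assert (PQ : 0 < Q) by (apply INR_pow_pos; auto).
  assert (E2 : INR q ^ (2 * r) = Q * Q) by (replace (2 * r)%nat with (r + r)%nat by lia; apply pow_add).
  assert (Z2 : qpow q (-2 * Z.of_nat r) = / (Q * Q)).
  { unfold qpow. replace (-2 * Z.of_nat r)%Z with (- Z.of_nat (2 * r))%Z by lia.
    now rewrite powerRZ_neg', <- pow_powerRZ, E2. }
  assert (Z1 : forall (k : nat), qpow q (- Z.of_nat k * Z.of_nat r) = / Q ^ k).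
  { intros k. unfold qpow, Q. replace (- Z.of_nat k * Z.of_nat r)%Z with (- Z.of_nat (r * k))%Z by lia.
    now rewrite powerRZ_neg', <- pow_powerRZ, pow_mult. }
  pose proof (Z1 4%nat) as Z4. pose proof (Z1 3%nat) as Z3. simpl Z.of_nat in Z4, Z3.
  change (- (4))%Z with (-4)%Z in Z4. change (- (3))%Z with (-3)%Z in Z3.
  assert (Z4p : qpow q (-4 * Z.of_nat r + 1) = INR q / Q ^ 4).
  { unfold qpow in *. rewrite powerRZ_add, Z4, powerRZ_1 by lra. unfold Rdiv. ring. }
  assert (Z3p : qpow q (-3 * Z.of_nat r + 1) = INR q / Q ^ 3).
  { unfold qpow in *. rewrite powerRZ_add, Z3, powerRZ_1 by lra. unfold Rdiv. ring. }
  assert (Z4m : qpow q (-4 * Z.of_nat r - 1) = / INR q / Q ^ 4).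
  { unfold qpow in *. unfold Z.sub. rewrite powerRZ_add, Z4 by lra. simpl (powerRZ _ (- (1))).
    unfold Rdiv. rewrite Rmult_1_r. ring. }
  rewrite Z2, Z4, Z4p, Z3p, Z4m, E2, mult_INR. simpl (INR 2). field. lra.
Qed.

End GeneratingFunction.

(** * The heat kernel *)

(* [kern t] is the centred Gaussian density with variance [t]; [/ sqrt t] is written
   [exp (- ln t / 2)], and [kernj t] is the [j]-th space derivative. *)
Definition kern (t x : R) : R := exp (- x ^ 2 / (2 * t) - ln t / 2) / sqrt (2 * PI).
Definition kern1 (t x : R) : R := - (x / t) * kern t x.
Definition kern2 (t x : R) : R := (x ^ 2 / t ^ 2 - / t) * kern t x.
Definition kern3 (t x : R) : R := (- (x ^ 3) / t ^ 3 + 3 * x / t ^ 2) * kern t x.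
Definition kern4 (t x : R) : R := (x ^ 4 / t ^ 4 - 6 * x ^ 2 / t ^ 3 + 3 / t ^ 2) * kern t x.

(** Bounds [kern] and its first four space derivatives at all times from [s] on. The constant is 10
    times 16: 10 covers the coefficients 1, 6, 3 of [kern4], and 16 bounds
    [(1 + z) ^ 2 * exp (- (z / 2))] for [z = x ^ 2 / t]. *)
Definition kern_bound (s : R) : R := 160 * (1 + / s) ^ 2 * exp (- ln s / 2) / sqrt (2 * PI).

Lemma sqrt_2PI_pos : 0 < sqrt (2 * PI).
Proof. apply sqrt_lt_R0. pose proof PI_RGT_0. lra. Qed.

Lemma kern_1 (x : R) : kern 1 x = gauss_density x.
Proof. unfold kern, gauss_density. rewrite ln_1. do 2 f_equal. field. Qed.

Lemma kern_pos (t x : R) : 0 < kern t x.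
Proof. apply Rdiv_lt_0_compat; [apply exp_pos|apply sqrt_2PI_pos]. Qed.

Lemma kern_even (t x : R) : kern t (- x) = kern t x.
Proof. unfold kern. now rewrite <- Rsqr_pow2, <- Rsqr_neg, Rsqr_pow2. Qed.

Ltac normalize_kern_exponent t x :=
  match goal with |- context [exp (?e1 + ?e2)] =>
    replace (e1 + e2) with (- x ^ 2 / (2 * t) - ln t / 2) by (simpl; field; lra)
  end.

Lemma kern_derive_x (t x : R) : 0 < t -> is_derive (kern t) x (kern1 t x).
Proof.
  intros Ht. pose proof sqrt_2PI_pos as Ps. unfold kern1, kern. auto_derive; [auto|].
  normalize_kern_exponent t x. field. lra.
Qed.

Lemma kern1_derive_x (t x : R) : 0 < t -> is_derive (kern1 t) x (kern2 t x).
Proof.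
  intros Ht. pose proof sqrt_2PI_pos as Ps. unfold kern1, kern2, kern. auto_derive; [auto|].
  normalize_kern_exponent t x. field. lra.
Qed.

Lemma kern2_derive_x (t x : R) : 0 < t -> is_derive (kern2 t) x (kern3 t x).
Proof.
  intros Ht. pose proof sqrt_2PI_pos as Ps. unfold kern2, kern3, kern. auto_derive; [auto|].
  normalize_kern_exponent t x. field. lra.
Qed.

(** The heat equation. It makes a step in time match the second-order term of a step in space. *)
Lemma kern_derive_t (t x : R) : 0 < t -> is_derive (fun s => kern s x) t (kern2 t x / 2).
Proof.
  intros Ht. pose proof sqrt_2PI_pos as Ps. unfold kern2, kern. auto_derive; [lra|].
  normalize_kern_exponent t x. field. lra.
Qed.

Lemma kern2_derive_t (t x : R) : 0 < t -> is_derive (fun s => kern2 s x) t (kern4 t x / 2).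
Proof.
  intros Ht. pose proof sqrt_2PI_pos as Ps. unfold kern2, kern4, kern. 
  auto_derive; [repeat split; nra|]. normalize_kern_exponent t x. field. lra.
Qed.

Lemma kern_poly_bound (s t x : R) :
  0 < s <= t -> 10 * ((1 + / t) * (1 + x ^ 2 / t)) ^ 2 * kern t x <= kern_bound s.
Proof.
  intros Hs. pose proof sqrt_2PI_pos as Ps. unfold kern_bound, kern.
  set (z := x ^ 2 / t). assert (Hz : 0 <= z) by (apply Rdiv_le_0_compat; [apply pow2_ge_0|lra]).
  assert (Hi : 0 < / t <= / s) by (split; [apply Rinv_0_lt_compat|apply Rinv_le_contravar]; lra).
  replace (- x ^ 2 / (2 * t) - ln t / 2) with (- (z / 2) + - ln t / 2) by (unfold z; field; lra).
  rewrite exp_plus.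
  assert (E1 : exp (- ln t / 2) <= exp (- ln s / 2)).
  { apply exp_monotone. pose proof (ln_le s t). lra. }
  assert (E2 : (1 + z) ^ 2 * exp (- (z / 2)) <= 16).
  { replace (- (z / 2)) with (- (z / 4) + - (z / 4)) by field. rewrite exp_plus, exp_Ropp.
    pose proof (exp_ineq1_le (z / 4)) as H. pose proof (exp_pos (z / 4)) as Pe.
    assert (H1 : (1 + z) * / exp (z / 4) <= 4).
    { apply Rmult_le_reg_r with (exp (z / 4)); auto. rewrite Rmult_assoc, Rinv_l by lra. lra. }
    assert (H2 : 0 <= (1 + z) * / exp (z / 4)).
    { apply Rmult_le_pos; [lra|]. apply Rlt_le, Rinv_0_lt_compat; auto. }
    replace ((1 + z) ^ 2 * (/ exp (z / 4) * / exp (z / 4)))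
      with (((1 + z) * / exp (z / 4)) * ((1 + z) * / exp (z / 4))) by ring.
    replace 16 with (4 * 4) by ring. now apply Rmult_le_compat. }
  replace (10 * ((1 + / t) * (1 + z)) ^ 2 * (exp (- (z / 2)) * exp (- ln t / 2) / sqrt (2 * PI)))
    with (10 * (1 + / t) ^ 2 * ((1 + z) ^ 2 * exp (- (z / 2))) * exp (- ln t / 2) / sqrt (2 * PI))
    by (field; lra).
  apply Rmult_le_compat_r; [apply Rlt_le, Rinv_0_lt_compat; auto|].
  pose proof (exp_pos (- (z / 2))). pose proof (exp_pos (- ln t / 2)).
  assert (0 <= (1 + / t) ^ 2) by (apply pow_le; lra).
  assert (0 <= (1 + z) ^ 2) by (apply pow_le; lra).
  apply Rmult_le_compat; auto; try lra.
  - repeat apply Rmult_le_pos; lra.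
  - replace 160 with (10 * 16) by ring.
    replace (10 * 16 * (1 + / s) ^ 2) with (10 * (1 + / s) ^ 2 * 16) by ring.
    apply Rmult_le_compat; auto.
    + apply Rmult_le_pos; lra.
    + apply Rmult_le_pos; lra.
    + apply Rmult_le_compat_l; [lra|]. apply pow_incr. lra.
Qed.

(** The prefactors are polynomials in [y = x / t] and [p = / t]. With [y ^ 2 = p * z], each of [y],
    [y ^ 2] and [p] is at most [A] in absolute value, and no prefactor needs more than two such
    factors; [kern_poly_bound] controls [A ^ 2]. *)
Lemma kern_bounds (s t x : R) :
  0 < s <= t ->
  Rabs (kern t x) <= kern_bound s /\ Rabs (kern1 t x) <= kern_bound s /\
  Rabs (kern2 t x) <= kern_bound s /\ Rabs (kern3 t x) <= kern_bound s /\
  Rabs (kern4 t x) <= kern_bound s.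
Proof.
  intros Hs. pose proof (kern_poly_bound s t x Hs) as HB. pose proof (kern_pos t x) as Pk.
  set (z := x ^ 2 / t) in *. set (p := / t) in *. set (y := x / t).
  assert (Hz : 0 <= z) by (apply Rdiv_le_0_compat; [apply pow2_ge_0|lra]).
  assert (Hp : 0 < p) by (apply Rinv_0_lt_compat; lra).
  set (A := (1 + p) * (1 + z)) in *.
  assert (Hpz : 0 <= p * z) by (apply Rmult_le_pos; lra).
  assert (EA : A = 1 + p + z + p * z) by (unfold A; ring).
  assert (Ey2 : y ^ 2 = p * z) by (unfold y, p, z; field; lra).
  assert (Hy : Rabs y <= A).
  { rewrite <- pow2_abs in Ey2. simpl in Ey2. nra. }
  assert (HAA : A <= A ^ 2) by (simpl; rewrite Rmult_1_r; nra).
  assert (HM : forall c, Rabs c <= 10 * A ^ 2 -> Rabs (c * kern t x) <= kern_bound s).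
  { intros c Hc. rewrite Rabs_mult, (Rabs_pos_eq (kern t x)) by lra.
    eapply Rle_trans; [|exact HB]. apply Rmult_le_compat_r; lra. }
  assert (Hprod : forall a b, Rabs a <= A -> Rabs b <= A -> Rabs (a * b) <= A ^ 2).
  { intros a b Ha Hb. rewrite Rabs_mult. simpl. rewrite Rmult_1_r.
    apply Rmult_le_compat; auto using Rabs_pos. }
  assert (Hy2A : Rabs (y ^ 2) <= A) by (rewrite Rabs_pos_eq; lra).
  assert (HpA' : Rabs p <= A) by (rewrite Rabs_pos_eq; lra).
  repeat split.
  - rewrite <- (Rmult_1_l (kern t x)). apply HM. rewrite Rabs_R1. lra.
  - apply HM. fold y. rewrite Rabs_Ropp. lra.
  - unfold kern2. replace (x ^ 2 / t ^ 2 - / t) with (y ^ 2 - p) by (unfold y, p; field; lra).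
    apply HM. apply Rabs_le. lra.
  - unfold kern3. replace (- (x ^ 3) / t ^ 3 + 3 * x / t ^ 2) with (- (y * y ^ 2) + 3 * (y * p)) by (unfold y, p; field; lra).
    apply HM. pose proof (Hprod _ _ Hy Hy2A) as H1. pose proof (Hprod _ _ Hy HpA') as H2.
    apply Rabs_le_between in H1, H2. apply Rabs_le. lra.
  - unfold kern4.
    replace (x ^ 4 / t ^ 4 - 6 * x ^ 2 / t ^ 3 + 3 / t ^ 2) with (y ^ 2 * y ^ 2 - 6 * (y ^ 2 * p) + 3 * (p * p))
      by (unfold y, p; field; lra).
    apply HM. pose proof (Hprod _ _ Hy2A Hy2A) as H1. pose proof (Hprod _ _ Hy2A HpA') as H2.
    pose proof (Hprod _ _ HpA' HpA') as H3.
    apply Rabs_le_between in H1, H2, H3. apply Rabs_le. lra.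
Qed.

Lemma kern_bound_pos (s : R) : 0 < s -> 0 < kern_bound s.
Proof.
  intros Hs. eapply Rlt_le_trans; [apply (kern_pos s 0)|].
  eapply Rle_trans; [apply Rle_abs|]. apply kern_bounds. lra.
Qed.

(** Applied repeatedly it yields Taylor estimates of any order; the factorials are given away, which
    only affects constants. *)
Lemma mvt_pow (g g' : R -> R) (B a b : R) (n : nat) :
  0 <= B ->
  (forall x, Rmin a b <= x <= Rmax a b -> is_derive g x (g' x)) ->
  (forall x, Rmin a b <= x <= Rmax a b -> Rabs (g' x) <= B * Rabs (x - a) ^ n) ->
  Rabs (g b - g a) <= B * Rabs (b - a) ^ S n.
Proof.
  intros HB Hd Hb.
  destruct (MVT_gen g a b g') as [c [Hc E]].
  - intros x Hx. apply Hd. lra.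
  - intros x Hx. apply derivable_continuous_pt. exists (g' x). apply is_derive_Reals, Hd, Hx.
  - rewrite E, Rabs_mult. specialize (Hb c Hc).
    assert (Hca : Rabs (c - a) <= Rabs (b - a)).
    { unfold Rmin, Rmax in Hc. destruct (Rle_dec a b).
      - rewrite !Rabs_pos_eq; lra.
      - rewrite !Rabs_left1; lra. }
    assert (Hpow : Rabs (c - a) ^ n <= Rabs (b - a) ^ n) by (apply pow_incr; split; [apply Rabs_pos|auto]).
    simpl. rewrite <- (Rmult_comm (Rabs (b - a) ^ n)), <- Rmult_assoc.
    apply Rmult_le_compat_r; [apply Rabs_pos|].
    eapply Rle_trans; [exact Hb|]. now apply Rmult_le_compat_l.
Qed.

Lemma mvt_lipschitz (g g' : R -> R) (B a b : R) :
  0 <= B ->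
  (forall x, Rmin a b <= x <= Rmax a b -> is_derive g x (g' x)) ->
  (forall x, Rmin a b <= x <= Rmax a b -> Rabs (g' x) <= B) ->
  Rabs (g b - g a) <= B * Rabs (b - a).
Proof.
  intros HB Hd Hb. rewrite <- (pow_1 (Rabs (b - a))). apply (mvt_pow g g' B a b 0); auto.
  intros x Hx. simpl. rewrite Rmult_1_r. auto.
Qed.

Section KernelIncrements.

Variable s : R.
Hypothesis Hs : 0 < s.

Let B := kern_bound s.

Let B_nonneg : 0 <= B.
Proof. apply Rlt_le, kern_bound_pos, Hs. Qed.

Lemma kern_lipschitz_x (t x y : R) : s <= t -> Rabs (kern t y - kern t x) <= B * Rabs (y - x).
Proof.
  intros Ht. apply (mvt_lipschitz (kern t) (kern1 t)); auto; intros u _.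
  - apply kern_derive_x; lra.
  - apply kern_bounds; lra.
Qed.

Lemma kern2_lipschitz_x (t x y : R) : s <= t -> Rabs (kern2 t y - kern2 t x) <= B * Rabs (y - x).
Proof.
  intros Ht. apply (mvt_lipschitz (kern2 t) (kern3 t)); auto; intros u _.
  - apply kern2_derive_x; lra.
  - apply kern_bounds; lra.
Qed.

Lemma kern1_taylor_x (t x y : R) :
  s <= t -> Rabs (kern1 t y - kern1 t x - (y - x) * kern2 t x) <= B * Rabs (y - x) ^ 2.
Proof.
  intros Ht.
  replace (kern1 t y - kern1 t x - (y - x) * kern2 t x)
    with ((kern1 t y - y * kern2 t x) - (kern1 t x - x * kern2 t x)) by ring.
  apply (mvt_pow (fun u => kern1 t u - u * kern2 t x) (fun u => kern2 t u - kern2 t x)); auto; intros u _.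
  - apply (is_derive_minus (kern1 t) (fun u => u * kern2 t x)); [apply kern1_derive_x; lra|].
    auto_derive; [auto|ring].
  - rewrite pow_1. now apply kern2_lipschitz_x.
Qed.

Lemma kern_taylor_x (t x y : R) :
  s <= t ->
  Rabs (kern t y - kern t x - (y - x) * kern1 t x - (y - x) ^ 2 / 2 * kern2 t x) <= B * Rabs (y - x) ^ 3.
Proof.
  intros Ht. set (g := fun u => kern t u - ((u - x) * kern1 t x + (u - x) ^ 2 / 2 * kern2 t x)).
  replace (kern t y - kern t x - (y - x) * kern1 t x - (y - x) ^ 2 / 2 * kern2 t x)
    with (g y - g x) by (unfold g; field).
  apply (mvt_pow g (fun u => kern1 t u - (kern1 t x + (u - x) * kern2 t x))); auto; intros u _.
  - apply (is_derive_minus (kern t)); [apply kern_derive_x; lra|].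
    auto_derive; [auto|field].
  - replace (kern1 t u - (kern1 t x + (u - x) * kern2 t x))
      with (kern1 t u - kern1 t x - (u - x) * kern2 t x) by ring.
    now apply kern1_taylor_x.
Qed.

Lemma kern_lipschitz_t (t t' x : R) : s <= t -> s <= t' -> Rabs (kern t' x - kern t x) <= B * Rabs (t' - t).
Proof.
  intros Ht Ht'. apply (mvt_lipschitz (fun u => kern u x) (fun u => kern2 u x / 2)); auto; intros u Hu;
    assert (Hsu : s <= u) by (pose proof (Rmin_glb t t' s); lra).
  - apply kern_derive_t; lra.
  - unfold Rdiv. rewrite Rabs_mult, (Rabs_pos_eq (/ 2)) by lra.
    destruct (kern_bounds s u x) as [_ [_ [H _]]]; [lra|]. fold B in H. lra.
Qed.

Lemma kern2_lipschitz_t (t t' x : R) : s <= t -> s <= t' -> Rabs (kern2 t' x - kern2 t x) <= B * Rabs (t' - t).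
Proof.
  intros Ht Ht'. apply (mvt_lipschitz (fun u => kern2 u x) (fun u => kern4 u x / 2)); auto; intros u Hu;
    assert (Hsu : s <= u) by (pose proof (Rmin_glb t t' s); lra).
  - apply kern2_derive_t; lra.
  - unfold Rdiv. rewrite Rabs_mult, (Rabs_pos_eq (/ 2)) by lra.
    destruct (kern_bounds s u x) as [_ [_ [_ [_ H]]]]; [lra|]. fold B in H. lra.
Qed.

Lemma kern_taylor_t (t t' x : R) :
  s <= t -> s <= t' -> Rabs (kern t' x - kern t x - (t' - t) / 2 * kern2 t x) <= B * Rabs (t' - t) ^ 2.
Proof.
  intros Ht Ht'. set (g := fun u => kern u x - (u - t) / 2 * kern2 t x).
  replace (kern t' x - kern t x - (t' - t) / 2 * kern2 t x) with (g t' - g t) by (unfold g; field).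
  apply (mvt_pow g (fun u => kern2 u x / 2 - kern2 t x / 2)); auto; intros u Hu;
    assert (Hsu : s <= u) by (pose proof (Rmin_glb t t' s); lra).
  - apply (is_derive_minus (fun u => kern u x)); [apply kern_derive_t; lra|].
    auto_derive; [auto|field].
  - rewrite pow_1. replace (kern2 u x / 2 - kern2 t x / 2) with ((kern2 u x - kern2 t x) * / 2) by field.
    rewrite Rabs_mult, (Rabs_pos_eq (/ 2)) by lra.
    pose proof (kern2_lipschitz_t t u x Ht Hsu). pose proof (Rabs_pos (kern2 u x - kern2 t x)). lra.
Qed.

End KernelIncrements.

(** * Telescoping along the heat flow *)

Ltac nonneg_product :=
  repeat match goal with |- 0 <= _ * _ => apply Rmult_le_pos end.

Lemma avg_bsum (q : nat) (F : nat -> nat -> R) (n k : nat) :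
  avg q (fun m => bsum (fun i => F i m) k) n = bsum (fun i => avg q (F i) n) k.
Proof.
  unfold avg, Rdiv. rewrite (bsum_swap (fun d i => F i (q * n + d)%nat)).
  rewrite (bsum_ext (fun i => _ * / INR q) (fun i => / INR q * bsum (fun d => F i (q * n + d)%nat) q))
    by (intros; apply Rmult_comm).
  rewrite bsum_scal. apply Rmult_comm.
Qed.

Section Telescoping.

Variables q r : nat.
Hypothesis Hq : (2 <= q)%nat.
Hypothesis Hr : (1 <= r)%nat.
Variable f : nat -> R.
Hypothesis Hf : quasiadditive q r f.
Hypothesis Hg : growth q f.

Let G := martingale q r f.
Let D := jump q r f.
Let mu := mu0 q r f.
Let v := var0 q r f.
Let W := W2 q r f.

Lemma var0_nonneg : 0 <= v.
Proof.
  destruct (avoid_decay q r Hq Hr) as [th [Hth Hd]].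
  apply (is_lim_seq_le (fun _ => 0) (fun j => avgn q j (condvar q r f) 0%nat) 0 v).
  - intros j. rewrite <- (avgn_const q Hq j 0 0). apply avgn_le; auto.
    intros m. now apply condvar_nonneg.
  - apply is_lim_seq_const.
  - apply (tame_lim q r Hq th Hth Hd). now apply tame_condvar.
Qed.

(** The coefficient of [eta ^ 3] in the error of one step. The sum comes from moving in space, with
    its cubic Taylor term and the shift inside the second corrector; the last two terms come from
    moving in time. *)
Definition remainder (n : nat) : R :=
  bsum (fun d => Rabs (D d n) ^ 3 + Rabs (W (q * n + d)%nat) * Rabs (D d n)) q / INR q
  + (v ^ 2 + v * Rabs (W n)).

Lemma tame_remainder : tame q r remainder.
Proof.
  assert (TW : tame q r W) by now apply tame_W2.
  apply tame_plus.
  - apply tame_mult; [|apply tame_const]. apply tame_bsum; auto. intros d Hd.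
    assert (TD : tame q r (fun n => Rabs (D d n))) by (apply tame_Rabs; now apply tame_jump).
    apply (tame_plus q r (fun n => Rabs (D d n) ^ 3)).
    + apply tame_ext with (fun n => Rabs (D d n) * (Rabs (D d n) * Rabs (D d n))); [intros; ring|].
      repeat apply tame_mult; auto.
    + apply tame_mult; auto. apply (tame_shift q r Hq (fun n => Rabs (W n))); auto. now apply tame_Rabs.
  - apply (tame_plus q r (fun _ => v ^ 2)); [apply tame_const|].
    apply (tame_mult q r (fun _ => v)); [apply tame_const|now apply tame_Rabs].
Qed.

Section Scale.

Variables s eta y a : R.
Hypothesis Hs : 0 < s.
Hypothesis Heta : 0 < eta <= 1.

Let B := kern_bound s.

(** [k] counts the digits still to be appended: [time k] is the variance yet to come plus [s], so
    the kernel never becomes narrower than [s]. Likewise [position] contains the drift still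
    expected, and at [k = 0] both describe the end of the path. *)
Definition time (k : nat) : R := s + v * eta ^ 2 * INR k.
Definition position (k n : nat) : R := eta * (G n + mu * INR k - y) - a.

(* The second term cancels the fluctuations of the conditional variance of the jumps. *)
Definition Phi (k n : nat) : R :=
  kern (time k) (position k n) + eta ^ 2 / 2 * W n * kern2 (time k) (position k n).

Lemma time_ge (k : nat) : s <= time k.
Proof.
  unfold time. pose proof var0_nonneg. pose proof (pos_INR k). pose proof (pow2_ge_0 eta).
  assert (0 <= v * eta ^ 2 * INR k) by (apply Rmult_le_pos; auto; apply Rmult_le_pos; auto). lra.
Qed.

(** All [q] successors are expanded around the common point [x] and time [t]. The linear term
    averages to 0 by [bsum_jump]. In the second-order term the average of [W] over the successors
    replaces the conditional variance by the constant [v], which is exactly what the heat equation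
    gives for the step in time. *)
Lemma Phi_step (k n : nat) :
  Rabs (avg q (Phi k) n - Phi (S k) n) <= B * eta ^ 3 * remainder n.
Proof.
  set (t := time k). set (x := position (S k) n).
  pose proof (time_ge k) as Ht. fold t in Ht. pose proof (time_ge (S k)) as Ht'.
  pose proof var0_nonneg as Hv. pose proof (INR_q_pos q Hq) as Pq.
  assert (HB : 0 < B) by (apply kern_bound_pos; lra).
  assert (E3 : 0 < eta ^ 3) by (apply pow_lt; lra).
  assert (E2 : 0 <= eta ^ 2) by apply pow2_ge_0.
  assert (E4 : eta ^ 4 <= eta ^ 3).
  { replace (eta ^ 4) with (eta ^ 3 * eta) by ring. rewrite <- (Rmult_1_r (eta ^ 3)) at 2.
    apply Rmult_le_compat_l; lra. }
  (* The drift is already contained in [position], so a step moves it by the centred jump alone. *)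
  assert (Epos : forall d, position k (q * n + d) = x + eta * D d n).
  { intros d. unfold x, position, D, jump. fold G mu. rewrite S_INR. ring. }
  assert (Etime : time (S k) = t + v * eta ^ 2).
  { unfold t, time. rewrite S_INR. ring. }
  set (main := fun d => kern t x + eta * kern1 t x * D d n + eta ^ 2 / 2 * kern2 t x * (D d n ^ 2)
    + eta ^ 2 / 2 * kern2 t x * W (q * n + d)%nat).
  assert (Emain : bsum main q / INR q
    = kern t x + eta ^ 2 / 2 * v * kern2 t x + eta ^ 2 / 2 * W n * kern2 t x).
  { unfold main. rewrite !bsum_plus, !bsum_scal, bsum_const.
    unfold D. rewrite (bsum_jump q r Hq Hr f Hf Hg).
    pose proof (avg_W2 q r Hq Hr f Hf Hg n) as HW. unfold avg, condvar in HW. fold W D v in HW.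
    set (S1 := bsum (fun d => W (q * n + d)%nat) q) in *.
    fold D. set (S2 := bsum (fun i => D i n ^ 2) q) in *.
    replace S1 with (INR q * (W n - (S2 / INR q - v))) by (rewrite <- HW; field; lra).
    field. lra. }
  assert (Hterm : forall d, Rabs (Phi k (q * n + d) - main d)
    <= B * eta ^ 3 * (Rabs (D d n) ^ 3 + Rabs (W (q * n + d)%nat) * Rabs (D d n))).
  { intros d. unfold Phi. rewrite Epos. fold t.
    set (z := x + eta * D d n). set (w := W (q * n + d)%nat). set (dd := D d n).
    replace (kern t z + eta ^ 2 / 2 * w * kern2 t z - main d)
      with ((kern t z - kern t x - (z - x) * kern1 t x - (z - x) ^ 2 / 2 * kern2 t x)
        + eta ^ 2 / 2 * w * (kern2 t z - kern2 t x)) by (unfold main, z; fold w dd; field).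
    assert (Ezx : Rabs (z - x) = eta * Rabs dd).
    { unfold z. fold dd. replace (x + eta * dd - x) with (eta * dd) by ring.
      rewrite Rabs_mult, Rabs_pos_eq; lra. }
    eapply Rle_trans; [apply Rabs_triang|].
    pose proof (kern_taylor_x s Hs t x z Ht) as T1. pose proof (kern2_lipschitz_x s Hs t x z Ht) as T2.
    rewrite Ezx in T1, T2. fold B in T1, T2.
    rewrite Rmult_plus_distr_l. apply Rplus_le_compat.
    - eapply Rle_trans; [exact T1|]. right. ring.
    - rewrite !Rabs_mult, (Rabs_pos_eq (eta ^ 2 / 2)) by lra.
      pose proof (Rabs_pos w). pose proof (Rabs_pos dd).
      apply Rle_trans with (eta ^ 2 / 2 * Rabs w * (B * (eta * Rabs dd))).
      + apply Rmult_le_compat_l; [apply Rmult_le_pos; lra|exact T2].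
      + replace (eta ^ 2 / 2 * Rabs w * (B * (eta * Rabs dd)))
          with (/ 2 * (B * eta ^ 3 * (Rabs w * Rabs dd))) by field.
        assert (0 <= B * eta ^ 3 * (Rabs w * Rabs dd)) by (nonneg_product; lra). lra. }
  assert (Htime : Rabs (Phi (S k) n - bsum main q / INR q) <= B * eta ^ 3 * (v ^ 2 + v * Rabs (W n))).
  { rewrite Emain. unfold Phi. fold x. rewrite Etime.
    assert (Ht2 : s <= t + v * eta ^ 2) by (rewrite <- Etime; exact Ht').
    pose proof (kern_taylor_t s Hs t (t + v * eta ^ 2) x Ht Ht2) as T1.
    pose proof (kern2_lipschitz_t s Hs t (t + v * eta ^ 2) x Ht Ht2) as T2.
    replace (t + v * eta ^ 2 - t) with (v * eta ^ 2) in T1, T2 by ring.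
    assert (Pve : 0 <= v * eta ^ 2) by now apply Rmult_le_pos.
    rewrite (Rabs_pos_eq (v * eta ^ 2)) in T1, T2 by exact Pve. fold B in T1, T2.
    replace (kern (t + v * eta ^ 2) x + eta ^ 2 / 2 * W n * kern2 (t + v * eta ^ 2) x -
      (kern t x + eta ^ 2 / 2 * v * kern2 t x + eta ^ 2 / 2 * W n * kern2 t x))
      with ((kern (t + v * eta ^ 2) x - kern t x - v * eta ^ 2 / 2 * kern2 t x)
        + eta ^ 2 / 2 * W n * (kern2 (t + v * eta ^ 2) x - kern2 t x)) by field.
    eapply Rle_trans; [apply Rabs_triang|]. rewrite Rmult_plus_distr_l. apply Rplus_le_compat.
    - eapply Rle_trans; [exact T1|].
      replace (B * (v * eta ^ 2) ^ 2) with (B * v ^ 2 * eta ^ 4) by ring.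
      replace (B * eta ^ 3 * v ^ 2) with (B * v ^ 2 * eta ^ 3) by ring.
      apply Rmult_le_compat_l; auto. apply Rmult_le_pos; [lra|apply pow2_ge_0].
    - rewrite !Rabs_mult, (Rabs_pos_eq (eta ^ 2 / 2)) by lra. pose proof (Rabs_pos (W n)).
      apply Rle_trans with (eta ^ 2 / 2 * Rabs (W n) * (B * (v * eta ^ 2))).
      + apply Rmult_le_compat_l; [apply Rmult_le_pos; lra|exact T2].
      + replace (eta ^ 2 / 2 * Rabs (W n) * (B * (v * eta ^ 2)))
          with (/ 2 * (B * (v * Rabs (W n)) * eta ^ 4)) by field.
        replace (B * eta ^ 3 * (v * Rabs (W n))) with (B * (v * Rabs (W n)) * eta ^ 3) by ring.
        assert (P : 0 <= B * (v * Rabs (W n))) by (nonneg_product; lra).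
        assert (B * (v * Rabs (W n)) * eta ^ 4 <= B * (v * Rabs (W n)) * eta ^ 3)
          by now apply Rmult_le_compat_l.
        assert (0 <= B * (v * Rabs (W n)) * eta ^ 3) by (apply Rmult_le_pos; lra). lra. }
  replace (avg q (Phi k) n - Phi (S k) n)
    with ((avg q (Phi k) n - bsum main q / INR q) - (Phi (S k) n - bsum main q / INR q)) by ring.
  unfold Rminus at 1. eapply Rle_trans; [apply Rabs_triang|]. rewrite Rabs_Ropp.
  unfold remainder. rewrite Rmult_plus_distr_l. apply Rplus_le_compat; [|exact Htime].
  unfold avg, Rdiv. rewrite <- Rmult_minus_distr_r, <- bsum_minus, Rabs_mult.
  rewrite (Rabs_pos_eq (/ INR q)) by (apply Rlt_le, Rinv_0_lt_compat; auto).
  rewrite <- Rmult_assoc. apply Rmult_le_compat_r; [apply Rlt_le, Rinv_0_lt_compat; auto|].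
  eapply Rle_trans; [apply bsum_Rabs|]. rewrite <- bsum_scal. apply bsum_le. intros; apply Hterm.
Qed.

(** The errors of single steps are averaged along the path. As [remainder] is tame, these averages
    are bounded in the number of steps, which makes the total of order [eta ^ 3 * k]. *)
Lemma Phi_telescope (k n : nat) :
  Rabs (avgn q k (Phi 0) n - Phi k n) <= B * eta ^ 3 * bsum (fun i => avgn q i remainder n) k.
Proof.
  revert n. induction k as [|k IH]; intros n.
  - simpl. rewrite Rminus_diag, Rabs_R0. lra.
  - cbn [avgn].
    replace (avg q (avgn q k (Phi 0)) n - Phi (S k) n)
      with (avg q (fun m => avgn q k (Phi 0) m - Phi k m) n + (avg q (Phi k) n - Phi (S k) n))
      by (rewrite avg_minus; ring).
    eapply Rle_trans; [apply Rabs_triang|].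
    rewrite bsum_S_l, Rmult_plus_distr_l, Rplus_comm. apply Rplus_le_compat; [apply Phi_step|].
    eapply Rle_trans; [now apply avg_Rabs|].
    eapply Rle_trans; [apply avg_le; [exact Hq|exact IH]|].
    rewrite avg_scal, (avg_bsum q (fun i => avgn q i remainder)). apply Rle_refl.
Qed.

End Scale.

(** Four errors: replacing [f] by the corrected martingale at the end of the path, the telescoping,
    the second corrector at the start, and the position at the start. The centring [y] is free
    because it will be the drift times log_q K, which is not the drift times a number of digits. *)
Lemma kernel_clt (s : R) :
  0 < s -> exists C p, 0 <= C /\ forall eta y a k n, 0 < eta <= 1 ->
    Rabs (avgn q k (fun m => kern s (eta * (f m - y) - a)) n - kern (s + v * eta ^ 2 * INR k) (- a))
    <= C * (lenw q n ^ p * (eta ^ 3 * INR k + eta) + eta * Rabs (mu * INR k - y)).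
Proof.
  intros Hs. destruct (avoid_decay q r Hq Hr) as [th [Hth Hd]].
  set (E := fun m => f (low_part q r m) - W1 q r f m).
  assert (TW : tame q r W) by now apply tame_W2.
  assert (TE : tame q r E).
  { apply tame_minus; [apply (tame_low_part q r Hq f Hg)|now apply tame_W1]. }
  assert (EG : forall m, f m = G m + E m).
  { intros m. unfold G, martingale, E, closed_part. ring. }
  assert (TS : tame q r (fun m => Rabs (E m) + Rabs (W m))) by (apply tame_plus; now apply tame_Rabs).
  destruct (tame_avgn_bounded q r Hq th Hth Hd _ TS) as [C1 [p1 [HC1 H1]]].
  destruct (tame_avgn_bounded q r Hq th Hth Hd _ tame_remainder) as [C2 [p2 [HC2 H2]]].
  destruct (tame_Rabs q r W TW) as [_ [C3 [p3 [HC3 H3]]]].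
  assert (GG : growth q G).
  { destruct (growth_plus q f (fun m => (-1) * E m)) as [C [p [HC H]]]; auto.
    - apply (growth_mult q (fun _ => -1)); [apply growth_const|apply TE].
    - exists C, p. split; auto. intros m. replace (G m) with (f m + -1 * E m) by (rewrite EG; ring). auto. }
  destruct GG as [C4 [p4 [HC4 H4]]].
  set (B := kern_bound s). assert (HB : 0 < B) by now apply kern_bound_pos.
  exists (B * (1 + C1 + C2 + C3 + C4)), (p1 + p2 + p3 + p4)%nat.
  split; [apply Rmult_le_pos; lra|]. intros eta y a k n Heta.
  set (L := lenw q n ^ (p1 + p2 + p3 + p4)).
  assert (HL : forall p, (p <= p1 + p2 + p3 + p4)%nat -> lenw q n ^ p <= L)
    by (intros p Hp; apply Rle_pow; [apply lenw_ge_1|exact Hp]).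
  assert (HL1 : 1 <= L) by apply lenw_pow_ge_1.
  assert (E3 : 0 < eta ^ 3) by (apply pow_lt; lra). pose proof (pos_INR k) as Pk.
  assert (E2 : 0 <= eta ^ 2 <= eta) by (simpl; rewrite Rmult_1_r; nra).
  set (u := fun m => kern s (eta * (f m - y) - a)).
  set (P0 := Phi s eta y a 0). set (Pk' := Phi s eta y a k n).
  set (x := position eta y a k n). set (t := time s eta k).
  assert (Ht : s <= t) by now apply time_ge.
  assert (S1 : Rabs (avgn q k u n - avgn q k P0 n) <= B * eta * (C1 * L)).
  { rewrite <- avgn_minus. eapply Rle_trans; [now apply avgn_Rabs|].
    apply Rle_trans with (avgn q k (fun m => B * eta * (Rabs (E m) + Rabs (W m))) n).
    - apply avgn_le; auto. intros m. unfold u, P0, Phi, time, position. simpl INR.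
      rewrite !Rmult_0_r, !Rplus_0_r.
      replace (kern s (eta * (f m - y) - a) - (kern s (eta * (G m - y) - a) + eta ^ 2 / 2 * W m * kern2 s (eta * (G m - y) - a)))
        with ((kern s (eta * (f m - y) - a) - kern s (eta * (G m - y) - a)) - eta ^ 2 / 2 * W m * kern2 s (eta * (G m - y) - a)) by ring.
      unfold Rminus at 1. eapply Rle_trans; [apply Rabs_triang|]. rewrite Rabs_Ropp, Rmult_plus_distr_l.
      apply Rplus_le_compat.
      + eapply Rle_trans; [apply kern_lipschitz_x; [exact Hs|lra]|]. fold B.
        rewrite EG. replace (eta * (G m + E m - y) - a - (eta * (G m - y) - a)) with (eta * E m) by ring.
        rewrite Rabs_mult, (Rabs_pos_eq eta) by lra. right; ring.
      + destruct (kern_bounds s s (eta * (G m - y) - a)) as [_ [_ [Hb _]]]; [lra|]. fold B in Hb.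
        rewrite !Rabs_mult, (Rabs_pos_eq (eta ^ 2 / 2)) by lra.
        pose proof (Rabs_pos (W m)). pose proof (Rabs_pos (kern2 s (eta * (G m - y) - a))).
        apply Rle_trans with (eta * Rabs (W m) * B); [|right; ring].
        apply Rmult_le_compat; auto; [apply Rmult_le_pos; lra|]. apply Rmult_le_compat_r; lra.
    - rewrite avgn_scal. apply Rmult_le_compat_l; [apply Rmult_le_pos; lra|].
      eapply Rle_trans; [apply Rle_abs|]. eapply Rle_trans; [apply H1|].
      apply Rmult_le_compat_l; auto. apply HL. lia. }
  assert (S2 : Rabs (avgn q k P0 n - Pk') <= B * (eta ^ 3 * INR k) * (C2 * L)).
  { eapply Rle_trans; [now apply Phi_telescope|]. fold B.
    replace (B * (eta ^ 3 * INR k) * (C2 * L)) with (B * eta ^ 3 * (INR k * (C2 * L))) by ring.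
    apply Rmult_le_compat_l; [apply Rmult_le_pos; lra|].
    rewrite <- bsum_const. apply bsum_le. intros i _. eapply Rle_trans; [apply Rle_abs|].
    eapply Rle_trans; [apply H2|]. apply Rmult_le_compat_l; auto. apply HL. lia. }
  assert (S3 : Rabs (Pk' - kern t x) <= B * eta * (C3 * L)).
  { unfold Pk', Phi. fold x t. 
    replace (kern t x + eta ^ 2 / 2 * W n * kern2 t x - kern t x) with (eta ^ 2 / 2 * W n * kern2 t x) by ring.
    destruct (kern_bounds s t x) as [_ [_ [Hb _]]]; [lra|]. fold B in Hb.
    rewrite !Rabs_mult, (Rabs_pos_eq (eta ^ 2 / 2)) by lra.
    specialize (H3 n). cbv beta in H3. rewrite Rabs_Rabsolu in H3.
    assert (H3' : Rabs (W n) <= C3 * L).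
    { eapply Rle_trans; [exact H3|]. apply Rmult_le_compat_l; auto. apply HL. lia. }
    pose proof (Rabs_pos (W n)). pose proof (Rabs_pos (kern2 t x)).
    apply Rle_trans with (eta * (C3 * L) * B); [|right; ring].
    apply Rmult_le_compat; auto; [apply Rmult_le_pos; lra|]. apply Rmult_le_compat; lra. }
  assert (S4 : Rabs (kern t x - kern t (- a)) <= B * eta * (C4 * L) + B * (eta * Rabs (mu * INR k - y))).
  { eapply Rle_trans; [now apply (kern_lipschitz_x s)|]. fold B. unfold x, position.
    replace (eta * (G n + mu * INR k - y) - a - - a) with (eta * (G n + (mu * INR k - y))) by ring.
    rewrite Rabs_mult, (Rabs_pos_eq eta) by lra.
    assert (H4' : Rabs (G n) <= C4 * L).
    { eapply Rle_trans; [apply H4|]. apply Rmult_le_compat_l; auto. apply HL. lia. }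
    pose proof (Rabs_triang (G n) (mu * INR k - y)).
    rewrite Rmult_assoc, <- Rmult_plus_distr_l. apply Rmult_le_compat_l; [lra|].
    rewrite <- Rmult_plus_distr_l. apply Rmult_le_compat_l; lra. }
  change (s + v * eta ^ 2 * INR k) with t.
  replace (avgn q k u n - kern t (- a)) with ((avgn q k u n - avgn q k P0 n) + ((avgn q k P0 n - Pk')
    + ((Pk' - kern t x) + (kern t x - kern t (- a))))) by ring.
  eapply Rle_trans; [apply Rabs_triang|].
  eapply Rle_trans; [apply Rplus_le_compat_l, Rabs_triang|].
  eapply Rle_trans; [apply Rplus_le_compat_l, Rplus_le_compat_l, Rabs_triang|].
  set (z := eta * Rabs (mu * INR k - y)) in *.
  assert (Pz : 0 <= z) by (apply Rmult_le_pos; [lra|apply Rabs_pos]).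
  set (e3k := eta ^ 3 * INR k) in *. assert (Pe : 0 <= e3k) by (apply Rmult_le_pos; lra).
  apply Rle_trans with (B * ((1 + C1 + C2 + C3 + C4) * (L * (e3k + eta) + z))); [|right; ring].
  apply Rle_trans with (B * (eta * (C1 * L) + e3k * (C2 * L) + eta * (C3 * L) + eta * (C4 * L) + z)); [lra|].
  apply Rmult_le_compat_l; [lra|].
  assert (Q1 : 0 <= e3k * L) by (apply Rmult_le_pos; lra).
  assert (Q2 : 0 <= eta * L) by (apply Rmult_le_pos; lra).
  assert (0 <= C1 * (e3k * L)) by (apply Rmult_le_pos; lra).
  assert (0 <= C3 * (e3k * L)) by (apply Rmult_le_pos; lra).
  assert (0 <= C4 * (e3k * L)) by (apply Rmult_le_pos; lra).
  assert (0 <= C2 * (eta * L)) by (apply Rmult_le_pos; lra).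
  assert (0 <= C1 * z) by (apply Rmult_le_pos; lra).
  assert (0 <= C2 * z) by (apply Rmult_le_pos; lra).
  assert (0 <= C3 * z) by (apply Rmult_le_pos; lra).
  assert (0 <= C4 * z) by (apply Rmult_le_pos; lra).
  lra.
Qed.

End Telescoping.

(** * Uniform random integers *)

Lemma unif_expect_bsum (K : nat) (h : nat -> R) : unif_expect K h = bsum h K / INR K.
Proof. unfold unif_expect. rewrite fold_right_bsum. apply Rmult_comm. Qed.

Lemma nat_above (x : R) : exists n : nat, x <= INR n.
Proof.
  destruct (INR_unbounded x) as [n Hn]. exists n. lra.
Qed.

Lemma logq_bounds (q K j : nat) :
  (2 <= q)%nat -> (q ^ j <= K < q ^ S j)%nat -> INR j <= logq q (INR K) <= INR j + 1.
Proof.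
  intros Hq [H1 H2]. pose proof (INR_q_ge2 q Hq) as Hq2.
  assert (Hln : 0 < ln (INR q)) by (rewrite <- ln_1; apply ln_increasing; lra).
  apply le_INR in H1. apply lt_INR in H2. rewrite pow_INR in H1, H2.
  pose proof (INR_pow_pos q Hq j). unfold logq. split.
  - apply Rle_div_r; auto. rewrite <- ln_pow by lra. now apply ln_le.
  - apply Rle_div_l; auto. rewrite <- S_INR, <- ln_pow by lra. apply ln_le; lra.
Qed.

(** The integers below [K] form [c] full intervals of length [q ^ i], on each of which the
    expectation is an [avgn], and a shorter rest, whose share of [K] is at most 1/c. *)
Lemma unif_expect_split (q i c K : nat) (h : nat -> R) (T M e : R) :
  (2 <= q)%nat -> (0 < c)%nat -> (q ^ i * c <= K < q ^ i * c + q ^ i)%nat ->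
  (forall m, Rabs (h m - T) <= M) ->
  (forall n, (n < c)%nat -> Rabs (avgn q i h n - T) <= e) ->
  Rabs (unif_expect K h - T) <= e + M / INR c.
Proof.
  intros Hq Hc HK HM He.
  pose proof (INR_pow_pos q Hq i) as Pri.
  assert (PK : 0 < INR K) by (apply lt_0_INR; nia).
  assert (Pc : 0 < INR c) by (apply lt_0_INR; lia).
  assert (HM0 : 0 <= M) by (eapply Rle_trans; [apply Rabs_pos|apply (HM 0%nat)]).
  assert (He0 : 0 <= e) by (eapply Rle_trans; [apply Rabs_pos|apply (He 0%nat); lia]).
  rewrite unif_expect_bsum.
  replace (bsum h K / INR K - T) with (bsum (fun m => h m - T) K / INR K)
    by (rewrite bsum_minus, bsum_const; field; lra).
  set (rem := (K - c * q ^ i)%nat).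
  assert (EK : (K = c * q ^ i + rem)%nat) by (unfold rem; lia).
  assert (Hrem : (rem <= q ^ i)%nat) by (unfold rem; lia).
  unfold Rdiv at 1. rewrite Rabs_mult, (Rabs_pos_eq (/ INR K)) by (apply Rlt_le, Rinv_0_lt_compat; auto).
  apply Rle_div_l; auto.
  rewrite EK at 1. rewrite bsum_add, bsum_mul. eapply Rle_trans; [apply Rabs_triang|].
  assert (B1 : Rabs (bsum (fun n => bsum (fun j => h (q ^ i * n + j)%nat - T) (q ^ i)) c)
    <= INR c * (INR q ^ i * e)).
  { eapply Rle_trans; [apply bsum_Rabs|]. rewrite <- bsum_const. apply bsum_le. intros n Hn.
    rewrite bsum_minus, bsum_const, pow_INR.
    replace (bsum (fun u => h (q ^ i * n + u)%nat) (q ^ i)) with (INR q ^ i * avgn q i h n)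
      by (rewrite avgn_explicit by auto; field; lra).
    rewrite <- Rmult_minus_distr_l, Rabs_mult, (Rabs_pos_eq (INR q ^ i)) by lra.
    apply Rmult_le_compat_l; [lra|auto]. }
  assert (B2 : Rabs (bsum (fun j => h (c * q ^ i + j)%nat - T) rem) <= INR q ^ i * M).
  { eapply Rle_trans; [apply bsum_Rabs|]. apply Rle_trans with (INR rem * M).
    - rewrite <- bsum_const. apply bsum_le. intros; apply HM.
    - apply Rmult_le_compat_r; auto. rewrite <- pow_INR. now apply le_INR. }
  assert (HcK : INR c * INR q ^ i <= INR K).
  { rewrite <- pow_INR, <- mult_INR. apply le_INR. lia. }
  rewrite Rmult_plus_distr_r. apply Rplus_le_compat.
  - eapply Rle_trans; [exact B1|]. replace (INR c * (INR q ^ i * e)) with (e * (INR c * INR q ^ i)) by ring.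
    now apply Rmult_le_compat_l.
  - eapply Rle_trans; [exact B2|]. replace (INR q ^ i * M) with (M / INR c * (INR c * INR q ^ i)) by (field; lra).
    apply Rmult_le_compat_l; auto. now apply Rdiv_le_0_compat.
Qed.

Section Uniform.

Variables q r : nat.
Hypothesis Hq : (2 <= q)%nat.
Hypothesis Hr : (1 <= r)%nat.
Variable f : nat -> R.
Hypothesis Hf : quasiadditive q r f.
Hypothesis Hlog : log_growth f.
Hypothesis Hne : exists n, f n <> 0.

Lemma sigma2_hat_pos : 0 < sigma2_hat q r f.
Proof.
  pose proof (log_growth_linear q f Hq Hlog) as Hlin.
  rewrite <- (var0_eq_sigma2_hat q r Hq Hr f Hlin Hf).
  apply var0_pos; auto. now apply linear_growth.
Qed.

Lemma kernel_limit (s eps : R) :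
  0 < s -> 0 < eps -> exists K0, forall K a, (K0 <= K)%nat ->
    Rabs (unif_expect K (fun m => kern s (Znorm q r f K m - a)) - kern (s + 1) (- a)) <= eps.
Proof.
  intros Hs Heps.
  pose proof (log_growth_linear q f Hq Hlog) as Hlin.
  pose proof (linear_growth q f Hlin) as Hg.
  destruct (kernel_clt q r Hq Hr f Hf Hg s Hs) as [C [p [HC H]]].
  rewrite (var0_eq_sigma2_hat q r Hq Hr f Hlin Hf), (mu0_eq q r Hq Hr f Hlin) in H.
  pose proof sigma2_hat_pos as Hv.
  set (v := sigma2_hat q r f) in *. set (mu := mu_hat q r f) in *.
  set (sg := sqrt v). assert (Hsg : 0 < sg) by now apply sqrt_lt_R0.
  assert (Esg : sg * sg = v) by (apply sqrt_sqrt; lra).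
  set (B := kern_bound s). assert (HB : 0 < B) by now apply kern_bound_pos.
  (* [J] determines how many leading digits form [c]. It is chosen before [K], large enough that the
     incomplete interval costs at most [eps / 2]. *)
  destruct (nat_above (4 * B / eps)) as [J HJ].
  assert (HqJ : 2 * B / INR q ^ J <= eps / 2).
  { pose proof (INR_pow_pos q Hq J) as PJ. apply Rle_div_l; auto.
    assert (HJq : INR J <= INR q ^ J).
    { rewrite <- pow_INR. apply le_INR, Nat.lt_le_incl, Nat.pow_gt_lin_r. lia. }
    apply Rle_trans with (eps / 2 * (4 * B / eps)); [right; field; lra|].
    apply Rmult_le_compat_l; lra. }
  (* Collects everything that will multiply [eta]: a start [n < q ^ S J] has weight at most
     [2 + INR J], and log_q K differs from the number [i] of random digits by at most
     [1 + INR J]. *)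
  set (C' := C * ((2 + INR J) ^ p * (/ v + 1) + Rabs mu * (1 + INR J)) + B * (1 + INR J) * sg).
  pose proof (pos_INR J) as PJ. pose proof (Rinv_0_lt_compat v Hv) as Piv.
  assert (HC' : 0 <= C').
  { pose proof (Rabs_pos mu). apply Rplus_le_le_0_compat.
    - apply Rmult_le_pos; auto. apply Rplus_le_le_0_compat; apply Rmult_le_pos; try lra.
      apply pow_le; lra.
    - apply Rmult_le_pos; [apply Rmult_le_pos|]; lra. }
  (* [N1] will give [C' * eta <= eps / 2], and [N2] will give [eta <= 1]. *)
  destruct (nat_above ((2 * C' / (eps * sg)) ^ 2)) as [N1 HN1].
  destruct (nat_above (/ v)) as [N2 HN2].
  exists (q ^ (1 + J + N1 + N2))%nat. intros K a HK.
  set (j := (qlen q K - 1)%nat).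
  assert (Hj : (1 + J + N1 + N2 <= j)%nat).
  { apply Nat.nlt_ge. intros Hlt. assert (Hle : (qlen q K <= 1 + J + N1 + N2)%nat) by lia.
    apply qlen_le_iff in Hle; auto. lia. }
  assert (HKj : (q ^ j <= K < q ^ S j)%nat).
  { split.
    - apply Nat.nlt_ge. intros Hlt. apply qlen_le_iff in Hlt; auto. lia.
    - replace (S j) with (qlen q K) by lia. now apply lt_pow_qlen. }
  pose proof (logq_bounds q K j Hq HKj) as HL. set (L := logq q (INR K)) in *.
  set (i := (j - J)%nat). assert (Ej : j = (i + J)%nat) by lia.
  assert (Hjr : INR (1 + J + N1 + N2) <= INR j) by now apply le_INR.
  rewrite !plus_INR in Hjr. simpl (INR 1) in Hjr.
  pose proof (pos_INR N1) as PN1.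
  set (sL := sqrt L). assert (HsL : 1 <= sL) by (rewrite <- sqrt_1; apply sqrt_le_1; lra).
  assert (EsL : sL * sL = L) by (apply sqrt_sqrt; lra).
  set (eta := / (sg * sL)).
  assert (PsgL : 0 < sg * sL) by (apply Rmult_lt_0_compat; lra).
  assert (Heta0 : 0 < eta) by now apply Rinv_0_lt_compat.
  (* With this scale the variance accumulated over [i] digits is [INR i / L], which is close to
     1. *)
  assert (Eeta2 : v * eta ^ 2 = / L).
  { unfold eta. rewrite <- Esg, <- EsL. field. lra. }
  assert (Heta1 : eta <= 1).
  { unfold eta. rewrite <- Rinv_1. apply Rinv_le_contravar; [lra|].
    apply Rsqr_incr_0_var; [|lra]. unfold Rsqr.
    replace (sg * sL * (sg * sL)) with (v * L) by (rewrite <- Esg, <- EsL; ring).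
    apply Rle_trans with (v * / v); [rewrite Rinv_r; lra|]. apply Rmult_le_compat_l; lra. }
  assert (HetaC : C' * eta <= eps / 2).
  { unfold eta. apply Rle_div_l; auto.
    assert (Hs' : 2 * C' / (eps * sg) <= sL).
    { apply Rsqr_incr_0_var; [|lra]. unfold Rsqr. rewrite EsL.
      apply Rle_trans with ((2 * C' / (eps * sg)) ^ 2); [right; ring|]. lra. }
    replace C' with (eps / 2 * (sg * (2 * C' / (eps * sg)))) at 1 by (field; lra).
    apply Rmult_le_compat_l; [lra|]. apply Rmult_le_compat_l; lra. }
  assert (EL : / L <= sg * eta).
  { unfold eta. replace (sg * / (sg * sL)) with (/ sL) by (field; lra).
    apply Rinv_le_contravar; [lra|]. rewrite <- EsL. rewrite <- (Rmult_1_r sL) at 1.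
    apply Rmult_le_compat_l; lra. }
  set (c := (K / q ^ i)%nat). pose proof (pow_q_pos q Hq i) as Pi.
  assert (HcK : (q ^ i * c <= K < q ^ i * c + q ^ i)%nat).
  { pose proof (Nat.div_mod_eq K (q ^ i)) as E. fold c in E.
    pose proof (Nat.mod_upper_bound K (q ^ i) ltac:(lia)). lia. }
  assert (HcJ : (q ^ J <= c < q ^ S J)%nat).
  { rewrite Ej in HKj. change (S (i + J)) with (S i + J)%nat in HKj.
    cbn [Nat.pow Nat.add] in *. rewrite Nat.pow_add_r in HKj. split; nia. }
  pose proof (pow_q_pos q Hq J) as PqJ.
  eapply Rle_trans; [apply (unif_expect_split q i c K _ (kern (s + 1) (- a)) (2 * B) (C' * eta)); auto; try lia|].
  - intros m. unfold Rminus at 1. eapply Rle_trans; [apply Rabs_triang|]. rewrite Rabs_Ropp.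
    destruct (kern_bounds s s (Znorm q r f K m - a)) as [H1 _]; [lra|].
    destruct (kern_bounds s (s + 1) (- a)) as [H2 _]; [lra|]. fold B in H1, H2. lra.
  - intros n Hn. specialize (H eta (mu * L) a i n (conj Heta0 Heta1)).
    rewrite (avgn_ext q i _ (fun m => kern s (eta * (f m - mu * L) - a))).
    2:{ intros m. unfold Znorm, sigma_hat. fold v mu L sg sL. do 2 f_equal. unfold eta, Rdiv. ring. }
    assert (Hi : INR i = INR j - INR J) by (unfold i; rewrite minus_INR by lia; ring).
    assert (Hdiff : Rabs (INR i - L) <= 1 + INR J) by (apply Rabs_le; lra).
    assert (Pin : 0 <= INR i) by apply pos_INR.
    assert (T1 : Rabs (kern (s + v * eta ^ 2 * INR i) (- a) - kern (s + 1) (- a)) <= B * ((1 + INR J) * sg) * eta).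
    { assert (PiL : 0 <= / L) by (apply Rlt_le, Rinv_0_lt_compat; lra).
      eapply Rle_trans; [apply (kern_lipschitz_t s Hs)|].
      - lra.
      - rewrite Eeta2. assert (0 <= / L * INR i) by now apply Rmult_le_pos. lra.
      - fold B. rewrite Eeta2. rewrite Rmult_assoc. apply Rmult_le_compat_l; [lra|].
        replace (s + / L * INR i - (s + 1)) with ((INR i - L) * / L) by (field; lra).
        rewrite Rabs_mult, (Rabs_pos_eq (/ L)) by exact PiL.
        replace ((1 + INR J) * sg * eta) with ((1 + INR J) * (sg * eta)) by ring.
        apply Rmult_le_compat; auto using Rabs_pos. }
    assert (T2 : lenw q n ^ p * (eta ^ 3 * INR i + eta) <= (2 + INR J) ^ p * (/ v + 1) * eta).
    { rewrite Rmult_assoc. apply Rmult_le_compat.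
      - apply pow_le. pose proof (lenw_ge_1 q n). lra.
      - assert (0 < eta ^ 3) by (apply pow_lt; lra).
        assert (0 <= eta ^ 3 * INR i) by (apply Rmult_le_pos; lra). lra.
      - apply pow_incr. split; [pose proof (lenw_ge_1 q n); lra|].
        pose proof (lenw_le q Hq (S J) n ltac:(lia)) as Hl. rewrite S_INR in Hl. lra.
      - assert (He : eta ^ 3 * INR i <= / v * eta).
        { replace (eta ^ 3 * INR i) with (/ v * eta * (v * eta ^ 2 * INR i)) by (field; lra).
          rewrite <- (Rmult_1_r (/ v * eta)) at 2. apply Rmult_le_compat_l; [apply Rmult_le_pos; lra|].
          rewrite Eeta2. apply Rmult_le_reg_l with L; [lra|]. rewrite <- Rmult_assoc, Rinv_r by lra. lra. }
        lra. }
    assert (T3 : eta * Rabs (mu * INR i - mu * L) <= Rabs mu * (1 + INR J) * eta).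
    { rewrite <- Rmult_minus_distr_l, Rabs_mult, Rmult_comm. apply Rmult_le_compat_r; [lra|].
      apply Rmult_le_compat_l; auto. apply Rabs_pos. }
    replace (avgn q i (fun m => kern s (eta * (f m - mu * L) - a)) n - kern (s + 1) (- a))
      with ((avgn q i (fun m => kern s (eta * (f m - mu * L) - a)) n - kern (s + v * eta ^ 2 * INR i) (- a))
        + (kern (s + v * eta ^ 2 * INR i) (- a) - kern (s + 1) (- a))) by ring.
    eapply Rle_trans; [apply Rabs_triang|].
    apply Rle_trans with (C * ((2 + INR J) ^ p * (/ v + 1) * eta + Rabs mu * (1 + INR J) * eta)
      + B * ((1 + INR J) * sg) * eta); [|right; unfold C'; ring].
    apply Rplus_le_compat; [|exact T1]. eapply Rle_trans; [exact H|].
    apply Rmult_le_compat_l; auto. lra.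
  - assert (Hc : 2 * B / INR c <= 2 * B / INR q ^ J).
    { apply Rmult_le_compat_l; [lra|]. apply Rinv_le_contravar; [now apply INR_pow_pos|].
      rewrite <- pow_INR. apply le_INR. lia. }
    lra.
Qed.

End Uniform.

(** * The Gaussian integral *)

Definition gexp (x : R) : R := exp (- x ^ 2 / 2).
Definition gint (t : R) : R := RInt gexp 0 t.
(** The classical companion of the Gaussian integral: [gint t ^ 2 + 2 * hint t] has derivative 0,
    and at [t = 0] it reduces to an arctangent integral. *)
Definition hint (t : R) : R := RInt (fun x => exp (- (t ^ 2 * (1 + x ^ 2) / 2)) / (1 + x ^ 2)) 0 1.

Lemma one_plus_sqr_pos (x : R) : 0 < 1 + x ^ 2.
Proof. pose proof (pow2_ge_0 x). lra. Qed.

Lemma continuous_gexp (x : R) : continuous gexp x.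
Proof. apply (ex_derive_continuous gexp). unfold gexp. auto_derive. auto. Qed.

Lemma ex_RInt_cont (g : R -> R) (a b : R) :
  (forall x, continuous g x) -> ex_RInt g a b.
Proof. intros H. apply (ex_RInt_continuous (V := R_CompleteNormedModule)). auto. Qed.

Lemma gint_derive (t : R) : is_derive gint t (gexp t).
Proof.
  apply (is_derive_RInt gexp gint 0 t); [|apply continuous_gexp].
  exists (mkposreal 1 Rlt_0_1). intros y _. apply (RInt_correct (V := R_CompleteNormedModule)).
  apply ex_RInt_cont, continuous_gexp.
Qed.

Lemma continuous_hint_integrand (t x : R) :
  continuous (fun x => exp (- (t ^ 2 * (1 + x ^ 2) / 2)) / (1 + x ^ 2)) x.
Proof.
  apply (ex_derive_continuous (fun x => exp (- (t ^ 2 * (1 + x ^ 2) / 2)) / (1 + x ^ 2))).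
  auto_derive. pose proof (one_plus_sqr_pos x). simpl in *. lra.
Qed.

Lemma hint_integrand_derive (t x : R) :
  is_derive (fun u => exp (- (u ^ 2 * (1 + x ^ 2) / 2)) / (1 + x ^ 2)) t
    (- t * exp (- (t ^ 2 * (1 + x ^ 2) / 2))).
Proof.
  pose proof (one_plus_sqr_pos x). auto_derive; [auto|].
  match goal with |- context [exp ?e] => replace e with (- (t ^ 2 * (1 + x ^ 2) / 2)) by (simpl; field) end.
  simpl in *. field. lra.
Qed.

(** Differentiation under the integral sign, followed by the substitution of [t * x] for the
    variable. *)
Lemma hint_derive (t : R) : is_derive hint t (- gexp t * gint t).
Proof.
  replace (- gexp t * gint t)
    with (RInt (fun x => Derive (fun u => exp (- (u ^ 2 * (1 + x ^ 2) / 2)) / (1 + x ^ 2)) t) 0 1).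
  - apply (is_derive_RInt_param (fun u x => exp (- (u ^ 2 * (1 + x ^ 2) / 2)) / (1 + x ^ 2)) 0 1 t).
    + exists (mkposreal 1 Rlt_0_1). intros u _ x _. eexists. apply hint_integrand_derive.
    + intros x _. apply continuity_2d_pt_ext with (fun u v => - u * exp (- (u ^ 2 * (1 + v ^ 2) / 2))).
      { intros u v. symmetry. apply is_derive_unique, hint_integrand_derive. }
      apply continuity_2d_pt_mult.
      * apply continuity_2d_pt_opp, continuity_2d_pt_id1.
      * apply (continuity_1d_2d_pt_comp exp (fun u v => - (u ^ 2 * (1 + v ^ 2) / 2))).
        -- apply derivable_continuous_pt, derivable_pt_exp.
        -- apply continuity_2d_pt_ext with (fun u v => - (u * u * (1 + v * v) * / 2)).
           { intros u v. field. }
           apply continuity_2d_pt_opp. apply continuity_2d_pt_mult; [|apply continuity_2d_pt_const].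
           apply continuity_2d_pt_mult.
           ++ apply continuity_2d_pt_mult; apply continuity_2d_pt_id1.
           ++ apply continuity_2d_pt_plus; [apply continuity_2d_pt_const|].
              apply continuity_2d_pt_mult; apply continuity_2d_pt_id2.
    + exists (mkposreal 1 Rlt_0_1). intros u _. apply ex_RInt_cont.
      intros x. apply continuous_hint_integrand.
  - rewrite (RInt_ext _ (fun x => - gexp t * (t * gexp (t * x + 0)))).
    2:{ intros x _. etransitivity; [apply is_derive_unique, hint_integrand_derive|].
        replace (- (t ^ 2 * (1 + x ^ 2) / 2)) with (- t ^ 2 / 2 + - (t * x + 0) ^ 2 / 2) by field.
        rewrite exp_plus. unfold gexp. real_eq. ring. }
    assert (Hex : forall a b, ex_RInt gexp a b)
      by (intros; apply ex_RInt_cont, continuous_gexp).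
    rewrite (RInt_scal (V := R_CompleteNormedModule) (fun x => t * gexp (t * x + 0))).
    + replace (RInt (fun x => t * gexp (t * x + 0)) 0 1) with (gint t); [reflexivity|].
      pose proof (RInt_comp_lin (V := R_CompleteNormedModule) gexp t 0 0 1 (Hex _ _)) as E.
      replace (t * 0 + 0) with 0 in E by ring. replace (t * 1 + 0) with t in E by ring.
      symmetry. exact E.
    + apply (ex_RInt_comp_lin (V := R_CompleteNormedModule) gexp t 0 0 1), Hex.
Qed.

Lemma hint_0 : hint 0 = PI / 4.
Proof.
  unfold hint. rewrite (RInt_ext _ (fun x => / (1 + x ^ 2))).
  - replace (PI / 4) with (minus (atan 1) (atan 0)) by (rewrite atan_1, atan_0; unfold minus, plus, opp; simpl; ring).
    apply is_RInt_unique. apply (is_RInt_derive (V := R_CompleteNormedModule) atan).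
    + intros x _. apply is_derive_Reals, derivable_pt_lim_atan.
    + intros x _. apply (ex_derive_continuous (fun x => / (1 + x ^ 2))). auto_derive.
      pose proof (one_plus_sqr_pos x). simpl in *. lra.
  - intros x _. replace (- (0 ^ 2 * (1 + x ^ 2) / 2)) with 0 by field. rewrite exp_0. unfold Rdiv. apply Rmult_1_l.
Qed.

Lemma gint_hint (t : R) : gint t ^ 2 + 2 * hint t = PI / 2.
Proof.
  set (g := fun u => gint u ^ 2 + 2 * hint u).
  assert (Hd : forall u, is_derive g u 0).
  { intros u. unfold g.
    replace 0 with (2 * gexp u * gint u + 2 * (- gexp u * gint u)) by ring.
    apply (is_derive_plus (fun u => gint u ^ 2) (fun u => 2 * hint u)).
    - replace (2 * gexp u * gint u) with (INR 2 * gexp u * gint u ^ 1) by (simpl; ring).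
      apply is_derive_pow, gint_derive.
    - apply is_derive_scal, hint_derive. }
  change (g t = PI / 2).
  replace (PI / 2) with (g 0).
  - apply Rminus_diag_uniq. apply Rabs_eq_0. apply Rle_antisym; [|apply Rabs_pos].
    eapply Rle_trans; [apply (mvt_lipschitz g (fun _ => 0) 0); [lra|auto|intros; rewrite Rabs_R0; lra]|lra].
  - unfold g, gint. rewrite RInt_point, hint_0. unfold zero; simpl. field.
Qed.

Lemma hint_bounds (t : R) : 0 <= hint t <= / (1 + t ^ 2 / 2).
Proof.
  assert (Hex : ex_RInt (fun x => exp (- (t ^ 2 * (1 + x ^ 2) / 2)) / (1 + x ^ 2)) 0 1).
  { apply ex_RInt_cont. intros x. apply continuous_hint_integrand. }
  assert (Pt : 0 <= t ^ 2) by apply pow2_ge_0.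
  split.
  - apply RInt_ge_0; auto; [lra|]. intros x _.
    apply Rdiv_le_0_compat; [apply Rlt_le, exp_pos|apply one_plus_sqr_pos].
  - replace (/ (1 + t ^ 2 / 2)) with (RInt (fun _ => / (1 + t ^ 2 / 2)) 0 1)
      by (rewrite RInt_const; unfold scal; simpl; unfold mult; simpl; ring).
    apply RInt_le; auto; [lra|apply ex_RInt_const|]. intros x _.
    pose proof (one_plus_sqr_pos x) as Px. pose proof (pow2_ge_0 x).
    apply Rle_trans with (exp (- (t ^ 2 / 2))).
    + apply Rle_div_l; auto. rewrite <- (Rmult_1_r (exp _)). apply Rmult_le_compat; try lra.
      * apply Rlt_le, exp_pos.
      * apply exp_monotone. assert (0 <= t ^ 2 * x ^ 2) by now apply Rmult_le_pos. lra.
    + rewrite exp_Ropp. apply Rinv_le_contravar; [lra|]. apply exp_ineq1_le.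
Qed.

Lemma gauss_density_pos (x : R) : 0 < gauss_density x.
Proof. rewrite <- kern_1. apply kern_pos. Qed.

Lemma continuous_gauss_density (x : R) : continuous gauss_density x.
Proof.
  apply (continuous_ext (kern 1)); [apply kern_1|].
  apply (ex_derive_continuous (kern 1)). eexists. apply kern_derive_x. lra.
Qed.

Lemma ex_RInt_gauss_density (a b : R) : ex_RInt gauss_density a b.
Proof. apply ex_RInt_cont, continuous_gauss_density. Qed.

(** The mass [m] satisfies [m * m = 1 - 4 / PI * hint b], and [hint_bounds] is explicit. Once
    [m <= 1] is known, [m * m <= m] carries the lower bound over to [m]. *)
Lemma gauss_mass_symmetric (b : R) :
  0 <= b -> 1 - 2 / (1 + b ^ 2 / 2) <= RInt gauss_density (- b) b <= 1.
Proof.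
  intros Hb. pose proof sqrt_2PI_pos as Ps. pose proof PI_RGT_0 as PP.
  assert (Hex : forall c d, ex_RInt gexp c d)
    by (intros; apply ex_RInt_cont, continuous_gexp).
  assert (Hg : 0 <= gint b).
  { apply RInt_ge_0; auto. intros x _. apply Rlt_le, exp_pos. }
  assert (Hneg : RInt gexp (- b) 0 = gint b).
  { pose proof (RInt_comp_lin (V := R_CompleteNormedModule) gexp (-1) 0 0 b) as E.
    replace (-1 * 0 + 0) with 0 in E by ring. replace (-1 * b + 0) with (- b) in E by ring.
    rewrite <- (opp_RInt_swap gexp) by auto. rewrite <- E by auto.
    unfold gint. rewrite <- (RInt_opp (V := R_CompleteNormedModule)).
    - apply RInt_ext. intros x _. unfold opp, scal; simpl. unfold mult; simpl. unfold gexp.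
      replace (- (-1 * x + 0) ^ 2 / 2) with (- x ^ 2 / 2) by field.
      real_eq. ring.
    - apply (ex_RInt_comp_lin (V := R_CompleteNormedModule) gexp (-1) 0 0 b); auto. }
  assert (E : RInt gauss_density (- b) b = 2 * gint b / sqrt (2 * PI)).
  { rewrite (RInt_ext _ (fun x => / sqrt (2 * PI) * gexp x)).
    - rewrite (RInt_scal (V := R_CompleteNormedModule) gexp) by auto.
      rewrite <- (RInt_Chasles gexp (- b) 0 b) by auto. rewrite Hneg.
      unfold plus, scal; simpl. unfold mult; simpl. fold (gint b). field. lra.
    - intros x _. unfold gauss_density, gexp, Rdiv. apply Rmult_comm. }
  rewrite E. set (m := 2 * gint b / sqrt (2 * PI)).
  assert (Hm0 : 0 <= m) by (apply Rdiv_le_0_compat; lra).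
  assert (Hm2 : m * m = 1 - 4 / PI * hint b).
  { unfold m. replace (2 * gint b / sqrt (2 * PI) * (2 * gint b / sqrt (2 * PI)))
      with (4 * gint b ^ 2 / (sqrt (2 * PI) * sqrt (2 * PI))) by (field; lra).
    rewrite sqrt_sqrt by lra. replace (gint b ^ 2) with (PI / 2 - 2 * hint b) by (pose proof (gint_hint b); lra).
    field. lra. }
  destruct (hint_bounds b) as [H0 H1].
  assert (HPI : 4 / PI <= 2) by (apply Rle_div_l; pose proof PI2_1; lra).
  assert (HPI0 : 0 < 4 / PI) by (apply Rdiv_lt_0_compat; lra).
  assert (Hm1 : m <= 1).
  { apply Rsqr_incr_0_var; [|lra]. unfold Rsqr. rewrite Hm2.
    assert (0 <= 4 / PI * hint b) by (apply Rmult_le_pos; lra). lra. }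
  split; [|exact Hm1].
  apply Rle_trans with (m * m).
  - rewrite Hm2. assert (4 / PI * hint b <= 2 * / (1 + b ^ 2 / 2)) by (apply Rmult_le_compat; lra).
    unfold Rdiv at 1. lra.
  - rewrite <- (Rmult_1_r m) at 3. now apply Rmult_le_compat_l.
Qed.

Lemma RInt_mono_interval (g : R -> R) (a b c d : R) :
  (forall x, continuous g x) -> (forall x, 0 <= g x) ->
  c <= a -> a <= b -> b <= d -> RInt g a b <= RInt g c d.
Proof.
  intros Hc Hp H1 H2 H3.
  assert (Hex : forall u v, ex_RInt g u v) by (intros; now apply ex_RInt_cont).
  rewrite <- (RInt_Chasles g c a d) by auto. rewrite <- (RInt_Chasles g a b d) by auto.
  unfold plus; simpl.
  pose proof (RInt_ge_0 g c a H1 (Hex c a) (fun x _ => Hp x)).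
  pose proof (RInt_ge_0 g b d H3 (Hex b d) (fun x _ => Hp x)). lra.
Qed.

Lemma gauss_mass_le_1 (a b : R) : a <= b -> RInt gauss_density a b <= 1.
Proof.
  intros Hab. set (c := Rmax (Rabs a) (Rabs b)).
  assert (Hc : Rabs a <= c /\ Rabs b <= c) by (split; [apply Rmax_l|apply Rmax_r]).
  destruct Hc as [Ha Hb]. apply Rabs_le_between in Ha, Hb.
  eapply Rle_trans; [apply (RInt_mono_interval gauss_density a b (- c) c)|].
  - apply continuous_gauss_density.
  - intros x. apply Rlt_le, gauss_density_pos.
  - lra.
  - exact Hab.
  - lra.
  - apply gauss_mass_symmetric. lra.
Qed.

Lemma gauss_mass_ge (eps : R) :
  0 < eps -> exists A, 0 < A /\ forall a b, a <= - A -> A <= b -> 1 - eps <= RInt gauss_density a b.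
Proof.
  intros He. exists (4 / eps + 1). assert (P : 0 < 4 / eps) by (apply Rdiv_lt_0_compat; lra).
  split; [lra|]. intros a b Ha Hb. set (A := 4 / eps + 1) in *.
  assert (HA1 : 1 <= A) by (unfold A; lra).
  eapply Rle_trans; [|apply (RInt_mono_interval gauss_density (- A) A a b)]; try lra.
  - destruct (gauss_mass_symmetric A) as [H _]; [lra|]. eapply Rle_trans; [|exact H].
    assert (2 / (1 + A ^ 2 / 2) <= eps); [|lra].
    apply Rle_div_l; [pose proof (pow2_ge_0 A); lra|].
    assert (Hx : eps * A = 4 + eps) by (unfold A; field; lra).
    clearbody A. assert (A <= A ^ 2) by nra.
    assert (eps * A <= eps * A ^ 2) by (apply Rmult_le_compat_l; lra). lra.
  - apply continuous_gauss_density.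
  - intros x. apply Rlt_le, gauss_density_pos.
Qed.

(** * Weak convergence *)

Lemma continuous_Rmult (g h : R -> R) (x : R) :
  continuous g x -> continuous h x -> continuous (fun y => g y * h y) x.
Proof. intros Hg Hh. exact (continuous_mult (K := R_AbsRing) g h x Hg Hh). Qed.

Lemma abs_RInt_weighted (h w : R -> R) (a b c : R) :
  a <= b -> (forall x, continuous h x) -> (forall x, continuous w x) -> (forall x, 0 <= w x) ->
  (forall x, a <= x <= b -> Rabs (h x) <= c) ->
  Rabs (RInt (fun x => h x * w x) a b) <= c * RInt w a b.
Proof.
  intros Hab Hh Hw Pw Hc.
  assert (Hhw : forall x, continuous (fun y => h y * w y) x) by (intros; now apply continuous_Rmult).
  eapply Rle_trans; [apply abs_RInt_le; [exact Hab|now apply ex_RInt_cont]|].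
  assert (E : RInt (fun x => c * w x) a b = c * RInt w a b).
  { apply (RInt_scal (V := R_CompleteNormedModule) w). now apply ex_RInt_cont. }
  rewrite <- E. apply RInt_le; auto.
  - apply ex_RInt_cont. intros x.
    apply (continuous_comp (fun y => h y * w y) Rabs); [apply Hhw|apply continuous_Rabs].
  - apply ex_RInt_cont. intros x. apply (continuous_Rmult (fun _ => c)); auto.
    apply continuous_const.
  - intros x Hx. rewrite Rabs_mult, (Rabs_pos_eq (w x)) by auto.
    apply Rmult_le_compat_r; auto. apply Hc. lra.
Qed.

Lemma continuous_mul_gauss (h : R -> R) (x : R) :
  (forall y, continuous h y) -> continuous (fun y => h y * gauss_density y) x.
Proof. intros H. apply continuous_Rmult; auto. apply continuous_gauss_density. Qed.

Lemma abs_RInt_gauss (h : R -> R) (a b c : R) :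
  a <= b -> (forall x, continuous h x) -> (forall x, a <= x <= b -> Rabs (h x) <= c) ->
  Rabs (RInt (fun x => h x * gauss_density x) a b) <= c * RInt gauss_density a b.
Proof.
  intros Hab Hh Hc. apply abs_RInt_weighted; auto.
  - apply continuous_gauss_density.
  - intros y. apply Rlt_le, gauss_density_pos.
Qed.

Lemma abs_RInt_const (h : R -> R) (a b c : R) :
  a <= b -> (forall x, continuous h x) -> (forall x, a <= x <= b -> Rabs (h x) <= c) ->
  Rabs (RInt h a b) <= c * (b - a).
Proof.
  intros Hab Hh Hc.
  pose proof (abs_RInt_weighted h (fun _ => 1) a b c Hab Hh (fun x => continuous_const 1 x)
    (fun _ => Rle_0_1) Hc) as H.
  rewrite RInt_const in H. unfold scal in H; simpl in H. unfold mult in H; simpl in H.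
  rewrite Rmult_1_r in H. rewrite (RInt_ext h (fun x => h x * 1)); auto.
  intros x _. symmetry. apply Rmult_1_r.
Qed.

Lemma RInt_minus_R (g h : R -> R) (a b : R) :
  (forall x, continuous g x) -> (forall x, continuous h x) ->
  RInt (fun x => g x - h x) a b = RInt g a b - RInt h a b.
Proof.
  intros Hg Hh. apply (RInt_minus (V := R_CompleteNormedModule) g h);
    now apply ex_RInt_cont.
Qed.

Lemma RInt_split3 (g : R -> R) (a b c d : R) :
  (forall x, continuous g x) -> RInt g a d = RInt g a b + RInt g b c + RInt g c d.
Proof.
  intros Hg. assert (Hex : forall u v, ex_RInt g u v) by (intros; now apply ex_RInt_cont).
  rewrite <- (RInt_Chasles g a c d), <- (RInt_Chasles g a b c) by auto. reflexivity.
Qed.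

Lemma RInt_vanishing (g : R -> R) (a b : R) :
  (forall x, Rmin a b < x < Rmax a b -> g x = 0) -> RInt g a b = 0.
Proof.
  intros H. rewrite (RInt_ext g (fun _ => 0)) by exact H.
  rewrite RInt_const. unfold scal; simpl. unfold mult; simpl. ring.
Qed.

Lemma continuous_kern (t x : R) : 0 < t -> continuous (kern t) x.
Proof. intros Ht. apply (ex_derive_continuous (kern t)). eexists. now apply kern_derive_x. Qed.

Lemma continuous_kern_shift (t c x : R) : 0 < t -> continuous (fun a => kern t (c - a)) x.
Proof.
  intros Ht. apply (continuous_comp (fun a => c - a) (kern t)); [|now apply continuous_kern].
  apply (ex_derive_continuous (fun a => c - a)). auto_derive. auto.
Qed.

(** Writing the variance as [u ^ 2] keeps the later substitution linear and free of square roots. *)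
Lemma kern_scaling (u y : R) : 0 < u -> u * kern (u ^ 2) (u * y) = gauss_density y.
Proof.
  intros Hu. pose proof sqrt_2PI_pos. unfold kern, gauss_density.
  replace (ln (u ^ 2) / 2) with (ln u) by (rewrite ln_pow by auto; simpl; field).
  replace (- (u * y) ^ 2 / (2 * u ^ 2) - ln u) with (- y ^ 2 / 2 + - ln u) by (field; lra).
  rewrite exp_plus, exp_Ropp, exp_ln by auto. field. lra.
Qed.

Lemma compact_support_uniformly_continuous (g : R -> R) (A eps : R) :
  0 < eps -> (forall x, continuous g x) -> (forall x, A <= Rabs x -> g x = 0) ->
  exists d, 0 < d /\ forall x y, Rabs (x - y) < d -> Rabs (g x - g y) <= eps.
Proof.
  intros He Hc Hs.
  assert (Hpt : forall x, - (A + 1) <= x <= A + 1 -> continuity_pt g x)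
    by (intros x _; apply continuity_pt_filterlim, Hc).
  destruct (Heine_cor2 Hpt (mkposreal eps He)) as [d Hd].
  (* A point within distance 1 of one outside the enlarged interval is still outside the support, so
     both values are 0. *)
  exists (Rmin d 1). split; [apply Rmin_pos; [apply cond_pos|lra]|].
  intros x y Hxy. pose proof (Rmin_l d 1). pose proof (Rmin_r d 1).
  assert (Hcase : forall z w, Rabs (z - w) < Rmin d 1 -> ~ - (A + 1) <= z <= A + 1 -> g z = 0 /\ g w = 0).
  { intros z w Hzw Hz. assert (Hz' : A + 1 < Rabs z).
    { apply Rnot_le_lt. intros Hle. apply Hz. now apply Rabs_le_between. }
    pose proof (Rabs_triang_inv z w). split; apply Hs; lra. }
  destruct (classic (- (A + 1) <= x <= A + 1)) as [Hx|Hx].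
  - destruct (classic (- (A + 1) <= y <= A + 1)) as [Hy|Hy].
    + apply Rlt_le, Hd; auto. lra.
    + destruct (Hcase y x) as [E1 E2]; auto; [now rewrite Rabs_minus_sym|].
      rewrite E1, E2, Rminus_diag, Rabs_R0. lra.
  - destruct (Hcase x y) as [E1 E2]; auto. rewrite E1, E2, Rminus_diag, Rabs_R0. lra.
Qed.

(** Approximate identity. The substitution [a = u * y + x] turns the integral into a Gaussian
    average of [g] around [x]: [T] captures all but [e2] of the mass, and [u * T < d] keeps that
    part within the modulus of uniform continuity. *)
Lemma gauss_smoothing (g : R -> R) (A M eps : R) :
  0 < A -> 0 < eps -> (forall x, continuous g x) -> (forall x, A <= Rabs x -> g x = 0) ->
  (forall x, Rabs (g x) <= M) ->
  exists u0, 0 < u0 /\ forall u x, 0 < u < u0 ->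
    Rabs (RInt (fun a => g a * kern (u ^ 2) (x - a)) (- A) A - g x) <= eps.
Proof.
  intros HA He Hc Hs HM.
  assert (HM0 : 0 <= M) by (eapply Rle_trans; [apply Rabs_pos|apply (HM 0)]).
  set (e2 := eps / (2 * (4 * M + 1))).
  assert (He2 : 0 < e2) by (apply Rdiv_lt_0_compat; lra).
  assert (He2' : 4 * M * e2 <= eps / 2).
  { apply Rle_trans with ((4 * M + 1) * e2); [apply Rmult_le_compat_r; lra|].
    right. unfold e2. field. lra. }
  clearbody e2.
  destruct (compact_support_uniformly_continuous g A (eps / 2) ltac:(lra) Hc Hs) as [d [Hd Huc]].
  destruct (gauss_mass_ge e2 He2) as [T [HT Hmass]].
  exists (d / T). split; [now apply Rdiv_lt_0_compat|]. intros u x [Hu Hud].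
  assert (HuT : u * T < d) by (apply Rlt_div_r in Hud; lra).
  (* The window has to cover the support of [g] as seen from [x], so [N] depends on [x]; the error
     estimates use only [T <= N], which keeps [u0] uniform. *)
  set (N := (Rabs x + A) / u + T). pose proof (Rabs_pos x) as Px.
  assert (HNu : Rabs x + A <= u * N).
  { unfold N. rewrite Rmult_plus_distr_l. replace (u * ((Rabs x + A) / u)) with (Rabs x + A) by (field; lra).
    assert (0 <= u * T) by (apply Rmult_le_pos; lra). lra. }
  assert (HNT : T <= N).
  { unfold N. assert (0 <= (Rabs x + A) / u) by (apply Rdiv_le_0_compat; lra). lra. }
  clearbody N.
  set (F := fun a => g a * kern (u ^ 2) (x - a)).
  assert (Hu2 : 0 < u ^ 2) by (apply pow_lt; auto).
  assert (HcF : forall a, continuous F a).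
  { intros a. apply continuous_Rmult; auto. now apply continuous_kern_shift. }
  assert (Hxb : - Rabs x <= x <= Rabs x) by (apply Rabs_le_between; lra).
  assert (E1 : RInt F (- A) A = RInt F (u * - N + x) (u * N + x)).
  { rewrite (RInt_split3 F (u * - N + x) (- A) A (u * N + x)) by auto.
    rewrite (RInt_vanishing F (u * - N + x) (- A)), (RInt_vanishing F A (u * N + x)).
    - now rewrite Rplus_0_l, Rplus_0_r.
    - intros a Ha. rewrite Rmin_left, Rmax_right in Ha by lra. unfold F.
      rewrite Hs; [ring|]. rewrite Rabs_pos_eq; lra.
    - intros a Ha. rewrite Rmin_left, Rmax_right in Ha by lra. unfold F.
      rewrite Hs; [ring|]. rewrite Rabs_left; lra. }
  set (gx := fun y => g (u * y + x)).
  assert (Hcgx : forall y, continuous gx y).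
  { intros y. apply (continuous_comp (fun y => u * y + x) g); [|apply Hc].
    apply (ex_derive_continuous (fun y => u * y + x)). auto_derive. auto. }
  assert (E2 : RInt F (- A) A = RInt (fun y => gx y * gauss_density y) (- N) N).
  { rewrite E1.
    pose proof (RInt_comp_lin (V := R_CompleteNormedModule) F u x (- N) N
      (ex_RInt_cont F _ _ HcF)) as E.
    rewrite <- E. apply RInt_ext. intros y _. unfold F, gx, scal; simpl. unfold mult; simpl.
    rewrite <- (kern_scaling u y Hu). replace (x - (u * y + x)) with (- (u * y)) by ring.
    rewrite kern_even. simpl. real_eq. ring. }
  rewrite E2.
  set (k := fun y => gx y - g x).
  assert (Hck : forall y, continuous k y).
  { intros y. apply (continuous_minus gx (fun _ => g x)); auto. apply continuous_const. }
  assert (Hckg : forall y, continuous (fun y => k y * gauss_density y) y).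
  { intros y. now apply continuous_mul_gauss. }
  set (m := RInt gauss_density (- N) N).
  assert (Hm : 1 - e2 <= m <= 1) by (split; [apply Hmass; lra|apply gauss_mass_le_1; lra]).
  assert (E3 : RInt (fun y => gx y * gauss_density y) (- N) N - g x
    = RInt (fun y => k y * gauss_density y) (- N) N - g x * (1 - m)).
  { rewrite (RInt_ext (fun y => k y * gauss_density y) (fun y => gx y * gauss_density y - g x * gauss_density y)).
    - rewrite (RInt_minus_R (fun y => gx y * gauss_density y) (fun y => g x * gauss_density y)).
      + assert (E : RInt (fun y => g x * gauss_density y) (- N) N = g x * m)
          by (apply (RInt_scal (V := R_CompleteNormedModule) gauss_density), ex_RInt_gauss_density).
        rewrite E. ring.
      + intros y. apply continuous_Rmult; auto. apply continuous_gauss_density.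
      + intros y. apply (continuous_Rmult (fun _ => g x)); [apply continuous_const|apply continuous_gauss_density].
    - intros y _. unfold k. real_eq. ring. }
  rewrite E3.
  set (w := fun a b => RInt gauss_density a b).
  assert (Hw : forall a b c, a <= b -> (forall y, a <= y <= b -> Rabs (k y) <= c) ->
    Rabs (RInt (fun y => k y * gauss_density y) a b) <= c * w a b).
  { intros a b c Hab Hk. now apply abs_RInt_gauss. }
  assert (Hk2 : forall y, Rabs (k y) <= 2 * M).
  { intros y. unfold k, Rminus. eapply Rle_trans; [apply Rabs_triang|]. rewrite Rabs_Ropp.
    pose proof (HM (u * y + x)). pose proof (HM x). unfold gx. lra. }
  assert (Hk1 : forall y, - T <= y <= T -> Rabs (k y) <= eps / 2).
  { intros y Hy. apply Huc. replace (u * y + x - x) with (u * y) by ring.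
    rewrite Rabs_mult, (Rabs_pos_eq u) by lra.
    apply Rle_lt_trans with (u * T); auto. apply Rmult_le_compat_l; [lra|]. now apply Rabs_le. }
  rewrite (RInt_split3 (fun y => k y * gauss_density y) (- N) (- T) T N) by auto.
  assert (Emass : m = w (- N) (- T) + w (- T) T + w T N).
  { apply RInt_split3. apply continuous_gauss_density. }
  assert (HwT : 1 - e2 <= w (- T) T <= 1) by (split; [apply Hmass; lra|apply gauss_mass_le_1; lra]).
  pose proof (Hw (- N) (- T) (2 * M) ltac:(lra) (fun y _ => Hk2 y)) as B1.
  pose proof (Hw (- T) T (eps / 2) ltac:(lra) Hk1) as B2.
  pose proof (Hw T N (2 * M) HNT (fun y _ => Hk2 y)) as B3.
  assert (B4 : Rabs (g x * (1 - m)) <= M * e2).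
  { rewrite Rabs_mult. apply Rmult_le_compat; auto using Rabs_pos. rewrite Rabs_pos_eq; lra. }
  assert (B5 : 2 * M * (w (- N) (- T) + w T N) <= 2 * M * e2) by (apply Rmult_le_compat_l; lra).
  assert (B6 : eps / 2 * w (- T) T <= eps / 2 * 1) by (apply Rmult_le_compat_l; lra).
  apply Rabs_le_between in B1, B2, B3, B4. apply Rabs_le. lra.
Qed.

(** What an interval adds beyond [[- A, A]] is at most [M] times the Gaussian mass missing there, so
    the truncated integrals are Cauchy. *)
Lemma gauss_integrable (g : R -> R) (M : R) :
  (forall x, continuous g x) -> (forall x, Rabs (g x) <= M) ->
  exists v : R, forall eps, 0 < eps -> exists A, 0 < A /\ forall a b, a <= - A -> A <= b ->
    Rabs (RInt (fun x => g x * gauss_density x) a b - v) <= eps.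
Proof.
  intros Hc HM. set (J := fun a b => RInt (fun x => g x * gauss_density x) a b).
  assert (HM0 : 0 <= M) by (eapply Rle_trans; [apply Rabs_pos|apply (HM 0)]).
  assert (Hcg : forall x, continuous (fun x => g x * gauss_density x) x).
  { intros x. now apply continuous_mul_gauss. }
  assert (Hw : forall a b, a <= b -> Rabs (J a b) <= M * RInt gauss_density a b).
  { intros a b Hab. now apply abs_RInt_gauss. }
  assert (Cauchy : forall eps, 0 < eps -> exists A, 0 < A /\ forall a b, a <= - A -> A <= b ->
    Rabs (J a b - J (- A) A) <= eps).
  { intros eps He. set (e := eps / (M + 1)). assert (He' : 0 < e) by (apply Rdiv_lt_0_compat; lra).
    destruct (gauss_mass_ge e He') as [A [HA Hm]]. exists A. split; auto. intros a b Ha Hb.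
    assert (EJ : J a b = J a (- A) + J (- A) A + J A b) by now apply RInt_split3.
    assert (Em : RInt gauss_density a b = RInt gauss_density a (- A) + RInt gauss_density (- A) A + RInt gauss_density A b)
      by (apply RInt_split3, continuous_gauss_density).
    pose proof (Hw a (- A) Ha) as B1. pose proof (Hw A b Hb) as B2.
    pose proof (gauss_mass_le_1 a b ltac:(lra)). pose proof (Hm (- A) A ltac:(lra) ltac:(lra)).
    assert (B3 : M * (RInt gauss_density a (- A) + RInt gauss_density A b) <= M * e) by (apply Rmult_le_compat_l; lra).
    assert (B4 : M * e <= eps).
    { apply Rle_trans with ((M + 1) * e); [lra|]. right. unfold e. field. lra. }
    apply Rabs_le_between in B1, B2. apply Rabs_le. lra. }
  destruct (ex_lim_seq_cauchy_corr (fun n => J (- INR n) (INR n))) as [_ Hlim].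
  destruct Hlim as [v Hv].
  { intros eps. destruct (Cauchy (eps / 3)) as [A [HA H]]; [pose proof (cond_pos eps); lra|].
    destruct (nat_above A) as [N HN]. exists N. intros n m Hn Hm.
    apply le_INR in Hn, Hm. pose proof (cond_pos eps).
    pose proof (H (- INR n) (INR n) ltac:(lra) ltac:(lra)) as B1.
    pose proof (H (- INR m) (INR m) ltac:(lra) ltac:(lra)) as B2.
    apply Rabs_le_between in B1, B2. apply Rabs_def1; lra. }
  exists v. intros eps He. destruct (Cauchy (eps / 3)) as [A [HA H]]; [lra|].
  exists A. split; auto. intros a b Ha Hb.
  assert (Hv' : Rabs (J (- A) A - v) <= eps / 3).
  { apply (is_lim_seq_le_loc (fun n => Rabs (J (- A) A - J (- INR n) (INR n))) (fun _ => eps / 3)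
      (Rabs (J (- A) A - v)) (eps / 3)).
    - destruct (nat_above A) as [N HN]. exists N. intros n Hn. apply le_INR in Hn.
      rewrite Rabs_minus_sym. apply H; lra.
    - change (Finite (Rabs (J (- A) A - v))) with (Rbar_abs (Finite (J (- A) A - v))).
      apply is_lim_seq_abs. apply is_lim_seq_minus'; [apply is_lim_seq_const|exact Hv].
    - apply is_lim_seq_const. }
  specialize (H a b Ha Hb). fold (J a b).
  apply Rabs_le_between in H, Hv'. apply Rabs_le. lra.
Qed.

Lemma is_RInt_gen_of_limit (h : R -> R) (v : R) :
  (forall x, continuous h x) ->
  (forall eps, 0 < eps -> exists A, 0 < A /\ forall a b, a <= - A -> A <= b -> Rabs (RInt h a b - v) <= eps) ->
  is_RInt_gen h (Rbar_locally m_infty) (Rbar_locally p_infty) v.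
Proof.
  intros Hc H P [eps HP]. pose proof (cond_pos eps).
  destruct (H (eps / 2)) as [A [HA HAb]]; [lra|].
  exists (fun a => a < - A) (fun b => A < b).
  - exists (- A). auto.
  - exists A. auto.
  - intros a b Ha Hb. exists (RInt h a b). split.
    + apply (RInt_correct (V := R_CompleteNormedModule)). now apply ex_RInt_cont.
    + apply HP. change (Rabs (RInt h a b - v) < eps).
      specialize (HAb a b ltac:(lra) ltac:(lra)). lra.
Qed.

Lemma unif_expect_plus (K : nat) (g h : nat -> R) :
  unif_expect K (fun m => g m + h m) = unif_expect K g + unif_expect K h.
Proof. rewrite !unif_expect_bsum, bsum_plus. unfold Rdiv. ring. Qed.

Lemma unif_expect_scal (K : nat) (c : R) (h : nat -> R) :
  unif_expect K (fun m => c * h m) = c * unif_expect K h.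
Proof. rewrite !unif_expect_bsum, bsum_scal. unfold Rdiv. ring. Qed.

Lemma unif_expect_Rabs_le (K : nat) (g h : nat -> R) :
  (0 < K)%nat -> (forall m, Rabs (g m) <= h m) -> Rabs (unif_expect K g) <= unif_expect K h.
Proof.
  intros HK H. apply lt_0_INR in HK. rewrite !unif_expect_bsum. unfold Rdiv.
  rewrite Rabs_mult, (Rabs_pos_eq (/ INR K)) by (apply Rlt_le, Rinv_0_lt_compat; auto).
  apply Rmult_le_compat_r; [apply Rlt_le, Rinv_0_lt_compat; auto|].
  eapply Rle_trans; [apply bsum_Rabs|]. apply bsum_le; auto.
Qed.

Lemma unif_expect_const (K : nat) (c : R) : (0 < K)%nat -> unif_expect K (fun _ => c) = c.
Proof. intros HK. apply lt_0_INR in HK. rewrite unif_expect_bsum, bsum_const. field. lra. Qed.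

Lemma continuous_bsum (F : nat -> R -> R) (K : nat) (a : R) :
  (forall m a, continuous (F m) a) -> continuous (fun a => bsum (fun m => F m a) K) a.
Proof.
  intros H. induction K as [|K IH]; simpl; [apply continuous_const|].
  apply (continuous_plus (fun a => bsum (fun m => F m a) K) (F K)); auto.
Qed.

Lemma RInt_bsum (F : nat -> R -> R) (K : nat) (a b : R) :
  (forall m a, continuous (F m) a) ->
  bsum (fun m => RInt (F m) a b) K = RInt (fun x => bsum (fun m => F m x) K) a b.
Proof.
  intros H. induction K as [|K IH]; simpl.
  - symmetry. apply RInt_vanishing. auto.
  - rewrite IH. symmetry.
    apply (RInt_plus (V := R_CompleteNormedModule) (fun x => bsum (fun m => F m x) K) (F K));
      apply ex_RInt_cont; auto.
    intros x. now apply continuous_bsum.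
Qed.

Section Weak.

Variable X : nat -> nat -> R.
Hypothesis HX : forall s eps, 0 < s -> 0 < eps -> exists K0, forall K a, (K0 <= K)%nat ->
  Rabs (unif_expect K (fun m => kern s (X K m - a)) - kern (s + 1) (- a)) <= eps.

(** Smooth [g] with variance [s], exchange the finite expectation with the integral, and apply [HX]
    under the integral, where its uniformity in [a] is essential. Going from variance [s + 1] to 1
    costs at most [B * s]. *)
Lemma expectation_compact_support (g : R -> R) (A M eps : R) :
  0 < A -> 0 < eps -> (forall x, continuous g x) -> (forall x, A <= Rabs x -> g x = 0) ->
  (forall x, Rabs (g x) <= M) ->
  exists K0, forall K, (K0 <= K)%nat ->
    Rabs (unif_expect K (fun m => g (X K m)) - RInt (fun x => g x * gauss_density x) (- A) A) <= eps.
Proof.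
  intros HA He Hc Hs HM.
  assert (HM0 : 0 <= M) by (eapply Rle_trans; [apply Rabs_pos|apply (HM 0)]).
  destruct (gauss_smoothing g A M (eps / 3) HA ltac:(lra) Hc Hs HM) as [u0 [Hu0 Hu]].
  set (B := kern_bound 1). assert (HB : 0 < B) by (apply kern_bound_pos; lra).
  set (c := eps / (3 * (M * (2 * A) + 1))).
  assert (PMA : 0 <= M * (2 * A)) by (apply Rmult_le_pos; lra).
  assert (Hcp : 0 < c) by (apply Rdiv_lt_0_compat; lra).
  assert (Hc3 : M * c * (A - - A) <= eps / 3).
  { apply Rle_trans with ((M * (2 * A) + 1) * c); [|right; unfold c; field; lra].
    replace (M * c * (A - - A)) with (M * (2 * A) * c) by ring. apply Rmult_le_compat_r; lra. }
  clearbody c.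
  set (u := Rmin (u0 / 2) (Rmin 1 (c / B))).
  assert (PcB : 0 < c / B) by now apply Rdiv_lt_0_compat.
  assert (Hup : 0 < u) by (repeat apply Rmin_pos; lra).
  assert (Hu1 : u <= u0 / 2) by apply Rmin_l.
  assert (Hu2 : u <= 1) by (eapply Rle_trans; [apply Rmin_r|apply Rmin_l]).
  assert (Hu3 : u <= c / B) by (eapply Rle_trans; [apply Rmin_r|apply Rmin_r]).
  clearbody u. set (s := u ^ 2).
  assert (Hsp : 0 < s) by (apply pow_lt; auto).
  assert (HsB : B * s <= c).
  { apply Rle_trans with (B * u).
    - apply Rmult_le_compat_l; [lra|]. unfold s. simpl. rewrite Rmult_1_r.
      rewrite <- (Rmult_1_r u) at 3. apply Rmult_le_compat_l; lra.
    - apply Rle_div_r in Hu3; lra. }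
  destruct (HX s c Hsp Hcp) as [K1 HK1].
  exists (S K1). intros K HK. specialize (HK1 K).
  set (F := fun m a => g a * kern s (X K m - a)).
  assert (HcF : forall m a, continuous (F m) a).
  { intros m a. apply continuous_Rmult; auto. now apply continuous_kern_shift. }
  set (Ek := fun a => unif_expect K (fun m => kern s (X K m - a))).
  assert (HcE : forall a, continuous Ek a).
  { intros a. apply (continuous_ext (fun a => bsum (fun m => kern s (X K m - a)) K * / INR K)).
    - intros b. unfold Ek. rewrite unif_expect_bsum. reflexivity.
    - apply continuous_Rmult; [|apply continuous_const].
      apply (continuous_bsum (fun m a => kern s (X K m - a))). intros m b. now apply continuous_kern_shift. }
  assert (Hcgd : forall a, continuous (fun a => g a * gauss_density a) a).
  { intros a. now apply continuous_mul_gauss. }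
  assert (HcgE : forall a, continuous (fun a => g a * Ek a) a) by (intros; now apply continuous_Rmult).
  assert (E1 : unif_expect K (fun m => RInt (F m) (- A) A) = RInt (fun a => g a * Ek a) (- A) A).
  { rewrite unif_expect_bsum, RInt_bsum by auto. unfold Rdiv. rewrite Rmult_comm.
    assert (E : RInt (fun x => / INR K * bsum (fun m => F m x) K) (- A) A
      = / INR K * RInt (fun x => bsum (fun m => F m x) K) (- A) A).
    { apply (RInt_scal (V := R_CompleteNormedModule) (fun x => bsum (fun m => F m x) K)).
      apply ex_RInt_cont. intros x. now apply continuous_bsum. }
    rewrite <- E. apply RInt_ext. intros a _. unfold Ek, F. rewrite unif_expect_bsum, bsum_scal.
    unfold Rdiv. real_eq. ring. }
  assert (B1 : Rabs (unif_expect K (fun m => g (X K m)) - unif_expect K (fun m => RInt (F m) (- A) A)) <= eps / 3).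
  { replace (unif_expect K (fun m => g (X K m)) - unif_expect K (fun m => RInt (F m) (- A) A))
      with (unif_expect K (fun m => g (X K m) + (-1) * RInt (F m) (- A) A))
      by (rewrite unif_expect_plus, unif_expect_scal; ring).
    eapply Rle_trans; [apply (unif_expect_Rabs_le K _ (fun _ => eps / 3)); [lia|]|].
    - intros m.
      replace (g (X K m) + -1 * RInt (F m) (- A) A) with (- (RInt (F m) (- A) A - g (X K m))) by ring.
      rewrite Rabs_Ropp. apply Hu. lra.
    - rewrite unif_expect_const; [lra|lia]. }
  assert (B2 : Rabs (RInt (fun a => g a * Ek a) (- A) A - RInt (fun x => g x * gauss_density x) (- A) A)
    <= M * (2 * c) * (A - - A)).
  { rewrite <- (RInt_minus_R (fun a => g a * Ek a)) by auto.
    apply abs_RInt_const; [lra| |].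
    - intros a. apply (continuous_minus (fun a => g a * Ek a)); auto.
    - intros a _. replace (g a * Ek a - g a * gauss_density a) with (g a * (Ek a - gauss_density a)) by ring.
      rewrite Rabs_mult. apply Rmult_le_compat; auto using Rabs_pos.
      pose proof (HK1 a ltac:(lia)) as H1.
      change (unif_expect K (fun m => kern s (X K m - a))) with (Ek a) in H1.
      pose proof (kern_lipschitz_t 1 Rlt_0_1 1 (s + 1) (- a) ltac:(lra) ltac:(lra)) as H2.
      fold B in H2. replace (s + 1 - 1) with s in H2 by ring. rewrite (Rabs_pos_eq s) in H2 by lra.
      rewrite (kern_even 1), kern_1 in H2.
      apply Rabs_le_between in H1, H2. apply Rabs_le. lra. }
  rewrite E1 in B1. apply Rabs_le_between in B1, B2. apply Rabs_le. lra.
Qed.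

(** A trapezoid with slopes over the range of [Rabs x] from [A] to [A + 1], in closed form by
    absolute values so that continuity requires no case distinction. *)
Definition cutoff (A x : R) : R := (Rabs (A + 1 - Rabs x) - Rabs (A - Rabs x) + 1) / 2.

Lemma cutoff_bounds (A x : R) : 0 <= cutoff A x <= 1.
Proof.
  unfold cutoff. generalize (Rabs x). intros y. split_Rabs; lra.
Qed.

Lemma cutoff_inside (A x : R) : Rabs x <= A -> cutoff A x = 1.
Proof. intros H. unfold cutoff. rewrite !(Rabs_pos_eq (_ - _)); lra. Qed.

Lemma cutoff_outside (A x : R) : A + 1 <= Rabs x -> cutoff A x = 0.
Proof. intros H. unfold cutoff. rewrite !(Rabs_left1 (_ - _)); lra. Qed.

Lemma continuous_cutoff (A x : R) : continuous (cutoff A) x.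
Proof.
  assert (H : forall c, continuous (fun y => Rabs (c - Rabs y)) x).
  { intros c. apply (continuous_comp (fun y => c - Rabs y) Rabs); [|apply continuous_Rabs].
    apply (continuous_minus (fun _ => c) Rabs); [apply continuous_const|apply continuous_Rabs]. }
  apply continuous_Rmult; [|apply continuous_const].
  apply (continuous_plus (fun y => Rabs (A + 1 - Rabs y) - Rabs (A - Rabs y)) (fun _ => 1));
    [|apply continuous_const].
  apply (continuous_minus (fun y => Rabs (A + 1 - Rabs y)) (fun y => Rabs (A - Rabs y))); apply H.
Qed.

(** Tightness follows from the case of compact support, applied to the cutoff [chi] itself: the
    expectation of [chi] is close to 1, so the part of [g] outside the cutoff is bounded by
    [M * (1 - Echi)]. *)
Lemma weak_convergence : converges_weakly_to_std_gaussian X.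
Proof.
  intros g Hc [M HM].
  assert (HM0 : 0 <= M) by (eapply Rle_trans; [apply Rabs_pos|apply (HM 0)]).
  destruct (gauss_integrable g M Hc HM) as [v Hv]. exists v.
  assert (Hcgd : forall h, (forall x, continuous h x) -> forall a : R, continuous (fun a : R => h a * gauss_density a) a).
  { intros h Hh a. now apply continuous_mul_gauss. }
  split; [apply is_RInt_gen_of_limit; auto|].
  apply is_lim_seq_spec. intros eps. pose proof (cond_pos eps) as He.
  (* Five shares of [eps / 5]: two for the mass of [X K] outside the cutoff, one each for the limit
     with compact support, the cutoff in the integral and the truncation of the integral. [M + 1]
     instead of [M] makes the total strict. *)
  set (e := eps / (5 * (M + 1))). assert (He' : 0 < e) by (apply Rdiv_lt_0_compat; lra).
  assert (HMe : (M + 1) * e = eps / 5) by (unfold e; field; lra).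
  clearbody e.
  destruct (gauss_mass_ge e He') as [A1 [HA1 Hmass]].
  destruct (Hv (eps / 5)) as [A2 [HA2 HJ]]; [lra|].
  set (A := Rmax A1 A2). assert (H1 : A1 <= A) by apply Rmax_l. assert (H2 : A2 <= A) by apply Rmax_r.
  clearbody A. set (chi := cutoff A).
  assert (Hchi : forall x, continuous chi x) by (intros; apply continuous_cutoff).
  assert (Hgchi : forall x, continuous (fun x => g x * chi x) x) by (intros; now apply continuous_Rmult).
  assert (Hb : forall x, 0 <= chi x <= 1) by (intros; apply cutoff_bounds).
  assert (Hout : forall x, A + 1 <= Rabs x -> chi x = 0) by (intros; now apply cutoff_outside).
  set (A' := A + 1) in *.
  destruct (expectation_compact_support chi A' 1 e) as [K1 HK1]; auto; [unfold A'; lra| |].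
  { intros x. rewrite Rabs_pos_eq; apply Hb. }
  destruct (expectation_compact_support (fun x => g x * chi x) A' M (eps / 5)) as [K2 HK2]; auto.
  { unfold A'; lra. }
  { lra. }
  { intros x Hx. rewrite Hout by exact Hx. ring. }
  { intros x. rewrite Rabs_mult, (Rabs_pos_eq (chi x)) by apply Hb.
    pose proof (Hb x). rewrite <- (Rmult_1_r M). apply Rmult_le_compat; auto using Rabs_pos; lra. }
  set (Jchi := RInt (fun x => chi x * gauss_density x) (- A') A') in *.
  assert (HJchi : 1 - e <= Jchi).
  { assert (Pos : forall x, 0 <= chi x * gauss_density x).
    { intros x. apply Rmult_le_pos; [apply Hb|apply Rlt_le, gauss_density_pos]. }
    eapply Rle_trans; [apply (Hmass (- A) A); lra|].
    rewrite (RInt_ext gauss_density (fun x => chi x * gauss_density x)).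
    - apply RInt_mono_interval; auto; unfold A'; lra.
    - intros x Hx. rewrite Rmin_left, Rmax_right in Hx by lra. unfold chi.
      rewrite cutoff_inside by (apply Rabs_le; lra). symmetry. apply Rmult_1_l. }
  assert (Hcut : Rabs (RInt (fun x => g x * gauss_density x) (- A') A'
     - RInt (fun x => g x * chi x * gauss_density x) (- A') A') <= M * e).
  { rewrite <- (RInt_minus_R (fun x => g x * gauss_density x)) by auto.
    rewrite (RInt_ext _ (fun x => g x * (gauss_density x - chi x * gauss_density x))).
    2:{ intros x _. real_eq. ring. }
    eapply Rle_trans; [apply (abs_RInt_weighted g (fun x => gauss_density x - chi x * gauss_density x) _ _ M)|]; auto.
    - unfold A'. lra.
    - intros x. apply (continuous_minus gauss_density (fun x => chi x * gauss_density x)); auto.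
      apply continuous_gauss_density.
    - intros x. pose proof (Hb x). pose proof (gauss_density_pos x).
      assert (chi x * gauss_density x <= 1 * gauss_density x) by (apply Rmult_le_compat_r; lra). lra.
    - rewrite (RInt_minus_R gauss_density (fun x => chi x * gauss_density x)); auto;
        [|apply continuous_gauss_density].
      fold Jchi. apply Rmult_le_compat_l; auto.
      pose proof (gauss_mass_le_1 (- A') A' ltac:(unfold A'; lra)). lra. }
  specialize (HJ (- A') A' ltac:(unfold A'; lra) ltac:(unfold A'; lra)).
  exists (S (K1 + K2)). intros K HK. specialize (HK1 K ltac:(lia)). specialize (HK2 K ltac:(lia)).
  set (Eg := unif_expect K (fun m => g (X K m))).
  set (Echi := unif_expect K (fun m => chi (X K m))) in *.
  set (Egchi := unif_expect K (fun m => g (X K m) * chi (X K m))) in *.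
  assert (Hrest : Rabs (Eg - Egchi) <= M * (1 - Echi)).
  { replace (Eg - Egchi) with (unif_expect K (fun m => g (X K m) + (-1) * (g (X K m) * chi (X K m))))
      by (rewrite unif_expect_plus, unif_expect_scal; unfold Eg, Egchi; ring).
    replace (M * (1 - Echi)) with (unif_expect K (fun m => M + (- M) * chi (X K m))).
    2:{ rewrite unif_expect_plus, unif_expect_scal, unif_expect_const by lia. unfold Echi. ring. }
    apply unif_expect_Rabs_le; [lia|]. intros m.
    replace (g (X K m) + -1 * (g (X K m) * chi (X K m))) with (g (X K m) * (1 - chi (X K m))) by ring.
    replace (M + - M * chi (X K m)) with (M * (1 - chi (X K m))) by ring.
    pose proof (Hb (X K m)). rewrite Rabs_mult, (Rabs_pos_eq (1 - _)) by lra.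
    apply Rmult_le_compat_r; [lra|apply HM]. }
  apply Rabs_le_between in HK1.
  assert (HMchi : M * (1 - Echi) <= M * (2 * e)) by (apply Rmult_le_compat_l; lra).
  apply Rabs_le_between in Hrest, HK2, Hcut, HJ. apply Rabs_def1; lra.
Qed.

End Weak.

Theorem theorem16 (q r : nat) (f : nat -> R) :
  (2 <= q)%nat ->
  (1 <= r)%nat ->
  quasiadditive q r f ->
  log_growth f ->
  (exists n : nat, f n <> 0) ->
  converges_weakly_to_std_gaussian (Znorm q r f).
Proof.
  intros Hq Hr Hf Hlog Hne. apply weak_convergence. intros s eps Hs Heps.
  now apply kernel_limit.
Qed.
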